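(* Suppose $\triangle_M$ has a spectral gap. Let $T>0$, $s>1$, $f\in W^s(SM)$ and $$A_T(f):=\int_0^T f\circ\phi_t^U\,dt.$$ Then for $u\in L^2(SM)$, $$\mathcal L_Uu=f\quad\text{if and only if}\quad u\circ\phi_T^U-u=A_Tf.$$
   Context: $\Gamma\subset PSL(2,\mathbb R)$ is a discrete subgroup acting without fixed points on the hyperbolic upper half-plane $H$, $M=\Gamma\backslash H$ (compact, or noncompact of finite area), $SM=\Gamma\backslash SL(2,\mathbb R)$ with invariant volume. Spectral gap means $\mu_0=\inf(\mathrm{spec}(\triangle_M)\setminus\{0\})>0$, where $\triangle_M$ is the Laplace-Beltrami operator on $M$. The horocycle flow $\phi_t^U$ on $SM$ is right multiplication by $\begin{pmatrix}1&t\\0&1\end{pmatrix}=e^{tU}$; $\mathcal L_U$ is the Lie derivative along $U$, $\mathcal L_Uu=\frac{d}{dt}u\circ\phi_t^U|_{t=0}$, taken in the sense of distributions. With $X=\begin{pmatrix}1&0\\0&-1\end{pmatrix}$, $Y=\begin{pmatrix}0&-1\\-1&0\end{pmatrix}$, $\Theta=\begin{pmatrix}0&1\\-1&0\end{pmatrix}$ and $\triangle=-X^2-Y^2-\Theta^2$, $W^s(SM)$ is the Sobolev space with inner product $\langle(1+\triangle)^sf,g\rangle_{L^2(SM)}$. *)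

(* Defs.v *)
From HB Require Import structures.
From mathcomp Require Import all_boot all_order all_algebra.
From mathcomp Require Import complex.
From mathcomp Require Import all_classical all_reals all_analysis.
From mathcomp Require Import ring lra.

Set Implicit Arguments.
Unset Strict Implicit.
Unset Printing Implicit Defensive.
Import Order.TTheory GRing.Theory Num.Theory.
Import numFieldNormedType.Exports.

Local Open Scope classical_set_scope.
Local Open Scope ring_scope.
Local Open Scope quotient_scope.
Local Open Scope complex_scope.

Definition SL2 (R : realType) : Type := {A : 'M[R]_2 | \det A == 1}.

Section SL2.
Variable R : realType.
Local Notation G := (SL2 R).

HB.instance Definition _ := SubChoice.on G.
HB.instance Definition _ := Topological.copy G (initial_topology (\val : G -> 'M[R]_2)).

Fact SL2_one_subproof : \det (1%:M : 'M[R]_2) == 1.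
Proof. by rewrite det1. Qed.
Definition SL2_one : G := Sub 1%:M SL2_one_subproof.

Fact SL2_mul_subproof (g h : G) : \det (val g *m val h) == 1.
Proof. by rewrite det_mulmx (eqP (valP g)) (eqP (valP h)) mulr1. Qed.
Definition SL2_mul (g h : G) : G := Sub (val g *m val h) (SL2_mul_subproof g h).

Lemma SL2_unitmx (g : G) : val g \in unitmx.
Proof. by rewrite unitmxE (eqP (valP g)) unitr1. Qed.

Fact SL2_inv_subproof (g : G) : \det (invmx (val g)) == 1.
Proof. by rewrite det_inv (eqP (valP g)) invr1. Qed.
Definition SL2_inv (g : G) : G := Sub (invmx (val g)) (SL2_inv_subproof g).

Fact SL2_mulA : associative SL2_mul.
Proof. by move=> g h k; apply/val_inj; rewrite /= mulmxA. Qed.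
Fact SL2_mul1 : left_id SL2_one SL2_mul.
Proof. by move=> g; apply/val_inj; rewrite /= mul1mx. Qed.
Fact SL2_mulr1 : right_id SL2_one SL2_mul.
Proof. by move=> g; apply/val_inj; rewrite /= mulmx1. Qed.
Fact SL2_mulV : left_inverse SL2_one SL2_inv SL2_mul.
Proof. by move=> g; apply/val_inj; rewrite /= mulVmx ?SL2_unitmx. Qed.
Fact SL2_mulrV : right_inverse SL2_one SL2_inv SL2_mul.
Proof. by move=> g; apply/val_inj; rewrite /= mulmxV ?SL2_unitmx. Qed.

HB.instance Definition _ :=
  isGroup.Build G SL2_mulA SL2_mul1 SL2_mulr1 SL2_mulV SL2_mulrV.
HB.instance Definition _ := isPointed.Build G SL2_one.
End SL2.

Definition mx22 (R : realType) (a b c d : R) : 'M[R]_2 :=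
  \matrix_(i < 2, j < 2)
    if i == 0 then (if j == 0 then a else b) else (if j == 0 then c else d).

Lemma det_mx22 (R : realType) (A : 'M[R]_2) :
  \det A = A 0 0 * A 1 1 - A 0 1 * A 1 0.
Proof.
rewrite (expand_det_row _ 0) !big_ord_recl big_ord0 /cofactor !det_mx11 !mxE /=.
rewrite /bump /= !(addn0, add0n) expr0 expr1 mul1r addr0 mulN1r mulrN.
have E (i j k l : 'I_2) : val i = val k -> val j = val l -> A i j = A k l.
  by move=> /val_inj -> /val_inj ->.
by congr (_ * _ - _ * _); apply: E.
Qed.

Section one_parameter_subgroups.
Variable R : realType.
Implicit Type t : R.

Definition cosh t := (expR t + expR (- t)) / 2.
Definition sinh t := (expR t - expR (- t)) / 2.

Fact expU_subproof t : \det (mx22 1 t 0 1) == 1.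
Proof. by rewrite det_mx22 !mxE /= mulr1 mulr0 subr0. Qed.
Fact expX_subproof t : \det (mx22 (expR t) 0 0 (expR (- t))) == 1.
Proof. by rewrite det_mx22 !mxE /= mulr0 subr0 -expRD subrr expR0. Qed.
Fact expY_subproof t :
  \det (mx22 (cosh t) (- sinh t) (- sinh t) (cosh t)) == 1.
Proof.
rewrite det_mx22 !mxE /= /cosh /sinh; apply/eqP.
have e : expR t * expR (- t) = 1 by rewrite -expRD subrr expR0.
by rewrite -[RHS]e; field.
Qed.
Fact expT_subproof t : \det (mx22 (cos t) (sin t) (- sin t) (cos t)) == 1.
Proof. by rewrite det_mx22 !mxE /= mulrN opprK -!expr2 cos2Dsin2. Qed.

(** [expU t] = exp(tU), and likewise for
    X = (1, 0; 0, -1), Y = (0, -1; -1, 0) and Theta = (0, 1; -1, 0). *)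
Definition expU t : SL2 R := Sub (mx22 1 t 0 1) (expU_subproof t).
Definition expX t : SL2 R :=
  Sub (mx22 (expR t) 0 0 (expR (- t))) (expX_subproof t).
Definition expY t : SL2 R :=
  Sub (mx22 (cosh t) (- sinh t) (- sinh t) (cosh t)) (expY_subproof t).
Definition expT t : SL2 R :=
  Sub (mx22 (cos t) (sin t) (- sin t) (cos t)) (expT_subproof t).

End one_parameter_subgroups.

Definition Hplane (R : realType) : Type := {z : R[i] | 0 < complex.Im z}.

Section Hplane.
Variable R : realType.
Local Notation H := (Hplane R).

HB.instance Definition _ := SubChoice.on H.
HB.instance Definition _ := Topological.copy H
  (initial_topology
    ((fun z => (complex.Re (val z), complex.Im (val z))) : H -> R * R)).

Fact Hpoint_subproof : 0 < complex.Im (0 +i* 1 : R[i]).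
Proof. by rewrite /= ltr01. Qed.
HB.instance Definition _ := isPointed.Build H (Sub (0 +i* 1) Hpoint_subproof).

Definition mobden (g : SL2 R) (z : R[i]) : R[i] :=
  (val g 1 0)%:C * z + (val g 1 1)%:C.
Definition mob (g : SL2 R) (z : R[i]) : R[i] :=
  ((val g 0 0)%:C * z + (val g 0 1)%:C) / mobden g z.

Lemma mobden_neq0 (g : SL2 R) (z : H) : mobden g (val z) != 0.
Proof.
case: z => -[x y] /= y0; rewrite /mobden; simpc.
rewrite eq_complex /=.
apply/negP => /andP[/eqP h1 /eqP h2].
have c0 : val g 1 0 = 0.
  by apply/eqP; move/eqP: h2; rewrite mulf_eq0 (gt_eqF y0) orbF.
move: h1; rewrite c0 mul0r add0r => d0.
have := eqP (valP g); rewrite det_mx22 c0 d0 !mulr0 subrr => /eqP.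
by rewrite eq_sym oner_eq0.
Qed.

Fact Hact_subproof (g : SL2 R) (z : H) : 0 < complex.Im (mob g (val z)).
Proof.
have := mobden_neq0 g z; have := eqP (valP g); rewrite det_mx22.
rewrite /mob /mobden; case: z => -[x y] /= y0; simpc.
set a := val g 0 0; set b := val g 0 1; set c := val g 1 0; set d := val g 1 1.
move: a b c d => a b c d; rewrite eq_complex negb_and /= => detg den0.
set n := _ ^+ 2 + _ ^+ 2.
have n0 : 0 < n.
  rewrite lt0r addr_ge0 ?sqr_ge0// andbT paddr_eq0 ?sqr_ge0//.
  by rewrite !sqrf_eq0 negb_and.
rewrite (_ : _ + _ = y * (a * d - b * c) / n); last by field; rewrite gt_eqF.
by rewrite detg mulr1 divr_gt0.
Qed.

Definition Hact (g : SL2 R) (z : H) : H := Sub (mob g (val z)) (Hact_subproof g z).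

Lemma Hact1 (z : H) : Hact 1%g z = z.
Proof.
apply/val_inj; rewrite /= /mob /mobden /= !mxE /=.
by rewrite mul1r mul0r add0r addr0 divr1.
Qed.

Lemma HactM (g h : SL2 R) (z : H) : Hact (g * h)%g z = Hact g (Hact h z).
Proof.
apply/val_inj => /=; have h0 := mobden_neq0 h z.
have gh0 := mobden_neq0 (g * h)%g z; move: h0 gh0.
rewrite /mob /mobden /= !mxE !big_ord_recl !big_ord0 !addr0.
have -> : lift ord0 ord0 = 1 :> 'I_2 by apply/val_inj.
rewrite !rmorphD !rmorphM /= => h0 gh0.
move: gh0; set n := (X in X != 0) => n0.
by field; rewrite h0 (_ : _ + _ = n) // /n; ring.
Qed.

End Hplane.

(** A subgroup of PSL(2,R) is given by a subgroup [Gamma] of SL(2,R) that maps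
    onto it: its preimage, or a lift that does not contain -1.  M is
    Gamma\H and SM is Gamma\SL(2,R), with the quotient topologies and their
    Borel sets. *)

Definition discrete_subgroup (R : realType) (Gamma : {pred SL2 R}) : Prop :=
  forall g, g \in Gamma -> isolated [set` Gamma] g.

(** Only the elements 1 and -1 of SL(2,R), which are trivial in PSL(2,R), may
    have fixed points. *)
Definition acts_freely (R : realType) (Gamma : {pred SL2 R}) : Prop :=
  forall g z, g \in Gamma -> Hact g z = z ->
    val g = 1%:M \/ val g = - 1%:M.

Section quotients.
Variables (R : realType) (Gamma : groupClosed (SL2 R)).

Definition rel_SM (g h : SL2 R) : bool := (h * g^-1)%g \in Gamma.

Fact rel_SM_refl : reflexive rel_SM.
Proof. by move=> g; rewrite /rel_SM mulgV gpred1. Qed.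
Fact rel_SM_sym : symmetric rel_SM.
Proof. by move=> g h; rewrite /rel_SM -gpredV invgM invgK. Qed.
Fact rel_SM_trans : transitive rel_SM.
Proof.
move=> h g k; rewrite /rel_SM => hg kh.
by rewrite -(mulgVK h k) -mulgA gpredM.
Qed.
Definition equiv_SM := EquivRel rel_SM rel_SM_refl rel_SM_sym rel_SM_trans.

Definition rel_M (z w : Hplane R) : bool :=
  `[< exists2 g, g \in Gamma & w = Hact g z >].

Fact rel_M_refl : reflexive rel_M.
Proof. by move=> z; apply/asboolP; exists 1%g; rewrite ?gpred1 ?Hact1. Qed.
Fact rel_M_sym : symmetric rel_M.
Proof.
suff sym z w : rel_M z w -> rel_M w z by move=> z w; apply/idP/idP; exact: sym.
move=> /asboolP[g gG ->]; apply/asboolP; exists (g^-1)%g; first by rewrite gpredV.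
by rewrite -HactM mulVg Hact1.
Qed.
Fact rel_M_trans : transitive rel_M.
Proof.
move=> w z v /asboolP[g gG ->] /asboolP[h hG ->]; apply/asboolP.
by exists (h * g)%g; rewrite ?gpredM ?HactM.
Qed.
Definition equiv_M := EquivRel rel_M rel_M_refl rel_M_sym rel_M_trans.

Definition SM : Type := quotient_topology {eq_quot equiv_SM}.
HB.instance Definition _ := Quotient.on SM.
HB.instance Definition _ := Topological.on SM.
HB.instance Definition _ := Pointed.on SM.
HB.instance Definition _ := Measurable.copy SM (g_sigma_algebraType (@open SM)).

Definition M : Type := quotient_topology {eq_quot equiv_M}.
HB.instance Definition _ := Quotient.on M.
HB.instance Definition _ := Topological.on M.
HB.instance Definition _ := Pointed.on M.
HB.instance Definition _ := Measurable.copy M (g_sigma_algebraType (@open M)).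

Definition rtrans (g : SL2 R) (x : SM) : SM := \pi_SM (repr x * g)%g.
Definition phiU (t : R) : SM -> SM := rtrans (expU t).

(** Such a measure is unique up to a constant factor. *)
Definition invariant_volume (vol : {measure set SM -> \bar R}) : Prop :=
  [/\ forall g A, measurable A -> vol (rtrans g @^-1` A) = vol A,
      forall K, compact K -> (vol K < +oo)%E &
      (0 < vol setT)%E].

(** The measure induced on M by the area dx dy / y^2 of the upper half-plane:
    the projection preserves the area of the Borel sets on which it is
    injective. *)
Definition hyperbolic_area (area : {measure set M -> \bar R}) : Prop :=
  forall A : set (R * R),
    measurable A -> (forall p, A p -> 0 < p.2) ->
    let A' := [set z : Hplane R | A (complex.Re (val z), complex.Im (val z))] in
    set_inj A' (\pi_M : Hplane R -> M) ->
    area (\pi_M @` A') =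
      (\int[lebesgue_measure \x lebesgue_measure]_(p in A) (p.2 ^- 2)%:E)%E.

End quotients.

(** Measurability, integrals, limits and derivatives of complex-valued
    functions are taken componentwise. *)

Definition abs2 (R : realType) (z : R[i]) : R :=
  complex.Re z ^+ 2 + complex.Im z ^+ 2.

Section L2.
Context d (T : measurableType d) (R : realType) (mu : {measure set T -> \bar R}).
Implicit Types f g u w : T -> R[i].

Definition cmeasurable f : Prop :=
  measurable_fun setT (fun x => complex.Re (f x)) /\
  measurable_fun setT (fun x => complex.Im (f x)).

Definition cintegral (D : set T) f : R[i] :=
  (\int[mu]_(x in D) complex.Re (f x)) +i* (\int[mu]_(x in D) complex.Im (f x)).

Definition L2 : set (T -> R[i]) :=
  [set f | cmeasurable f /\ (\int[mu]_x (abs2 (f x))%:E < +oo)%E].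

Definition dotL2 f g : R[i] := cintegral setT (fun x => f x * (g x)^*).

Definition normL2 f : R := Num.sqrt (\int[mu]_x abs2 (f x)).

(** Unbounded operators on L^2 are given by their graphs, [A u w] meaning that
    u is in the domain and A u = w.  [opclosure D A] is the closure of the
    operator A with domain D. *)
Definition opgraph := (T -> R[i]) -> (T -> R[i]) -> Prop.

Definition opclosure (D : set (T -> R[i])) (A : (T -> R[i]) -> (T -> R[i])) :
    opgraph :=
  fun u w => [/\ L2 u, L2 w &
    exists2 phi : nat -> T -> R[i], (forall n, D (phi n)) &
      normL2 (fun x => phi n x - u x) @[n --> \oo] --> 0 /\
      normL2 (fun x => A (phi n) x - w x) @[n --> \oo] --> 0].

Definition resolvent_set (A : opgraph) : set R[i] :=
  [set z | (forall u w, A u w -> w = (fun x => z * u x) %[ae mu] ->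
              u = cst 0 %[ae mu]) /\
           exists C : R, forall f, L2 f -> exists u w,
             [/\ A u w, (fun x => w x - z * u x) = f %[ae mu] &
                 normL2 u <= C * normL2 f]].

Definition spectrum (A : opgraph) : set R[i] := ~` resolvent_set A.

(** [spectral_resolution A E m]: E is a projection-valued measure on the Borel
    sets of R, [m u] is the measure B |-> <E(B) u, u> = |E(B) u|^2, and
    A = \int l dE(l): the domain of A is the set of the u such that
    \int l^2 dm_u(l) < oo, and <A u, u> = \int l dm_u(l) on the domain.
    By polarization the latter determines A u.  Linearity of E(B) follows from
    its symmetry. *)
Definition spectral_resolution (A : opgraph)
    (E : set R -> (T -> R[i]) -> (T -> R[i]))
    (m : (T -> R[i]) -> {measure set (measurableTypeR R) -> \bar R}) : Prop :=
  [/\ (forall B f, measurable B -> L2 f -> L2 (E B f)),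
      (forall B f g, measurable B -> L2 f -> L2 g ->
         dotL2 (E B f) g = dotL2 f (E B g)),
      (forall B B' f, measurable B -> measurable B' -> L2 f ->
         E B (E B' f) = E (B `&` B') f %[ae mu]),
      (forall f, L2 f -> E setT f = f %[ae mu]) &
      [/\ (forall B f, measurable B -> L2 f ->
             m f B = (normL2 (E B f) ^+ 2)%:E),
          (forall u, L2 u ->
             (exists w, A u w) <-> (\int[m u]_l (l ^+ 2)%:E < +oo)%E) &
          (forall u w, A u w -> dotL2 w u = (\int[m u]_l l)%:C)]].

(** The domain of (1 + A)^(s/2), that is, the form domain of (1 + A)^s: it
    consists of the f such that <(1 + A)^s f, f> = \int (1 + l)^s dm_f(l)
    is finite. *)
Definition sobolev (A : opgraph) (s : R) : set (T -> R[i]) :=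
  [set f | L2 f /\ exists E m, spectral_resolution A E m /\
     (\int[m f]_l ((1 + l) `^ s)%:E < +oo)%E].

End L2.

Section smooth.
Context (R : realType) (T : topologicalType).
Implicit Types (phi : T -> R[i]) (h : R -> R[i]).

Definition cderivable h (t : R) : Prop :=
  derivable (fun r => complex.Re (h r)) t 1 /\
  derivable (fun r => complex.Im (h r)) t 1.

Definition cderive h (t : R) : R[i] :=
  derive1 (fun r => complex.Re (h r)) t +i* derive1 (fun r => complex.Im (h r)) t.

(** [dcurve c phi x] is the derivative of phi at x along the curve [c x], which
    passes through x at time 0. *)
Definition dcurve (c : T -> R -> T) phi : T -> R[i] :=
  fun x => cderive (fun t => phi (c x t)) 0.

(** [smooth_along n c D phi]: on D, the iterated derivatives of phi of order up
    to n along the family of curves c exist and are continuous. *)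
Fixpoint smooth_along (n : nat) (I : Type) (c : I -> T -> R -> T) (D : set T)
    phi : Prop :=
  (forall x, D x -> {for x, continuous (fun y => complex.Re (phi y))} /\
                    {for x, continuous (fun y => complex.Im (phi y))}) /\
  if n is n'.+1 then
    forall i, (forall x, D x -> cderivable (fun t => phi (c i x t)) 0) /\
              smooth_along n' c D (dcurve (c i) phi)
  else True.

Definition compactly_supported phi : Prop :=
  exists2 K : set T, compact K & forall x, ~ K x -> phi x = 0.

End smooth.

Section laplacian_M.
Variables (R : realType) (Gamma : groupClosed (SL2 R)).
Implicit Type phi : M Gamma -> R[i].

(** The lift of phi to the upper half-plane, in the coordinates (x, y), and
    extended by 0. *)
Definition lift_M phi (p : R * R) : R[i] :=
  if insub (p.1 +i* p.2) : option (Hplane R) is Some z then phi (\pi_(M Gamma) z)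
  else 0.

Definition coord_curve (i : bool) (p : R * R) (t : R) : R * R :=
  if i then (p.1 + t, p.2) else (p.1, p.2 + t).

Definition test_M : set (M Gamma -> R[i]) :=
  [set phi | compactly_supported phi /\
     forall n, smooth_along n coord_curve [set p | 0 < p.2] (lift_M phi)].

(** - y^2 (d^2/dx^2 + d^2/dy^2), the Laplacian of the metric of curvature -1 *)
Definition laplace_M phi : M Gamma -> R[i] := fun q =>
  let z := val (repr q) in
  let p := (complex.Re z, complex.Im z) in
  let d2 i := dcurve (coord_curve i) (dcurve (coord_curve i) (lift_M phi)) p in
  - (p.2 ^+ 2)%:C * (d2 true + d2 false).

Variable area : {measure set (M Gamma) -> \bar R}.

(** M is complete, so this closure is the unique self-adjoint extension. *)
Definition Laplacian_M : opgraph (M Gamma) R := opclosure area test_M laplace_M.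

Definition mu0 : \bar R :=
  ereal_inf [set (complex.Re z)%:E | z in spectrum area Laplacian_M `\ 0].

Definition spectral_gap : Prop := (0 < mu0)%E.

End laplacian_M.

Section analysis_SM.
Variables (R : realType) (Gamma : groupClosed (SL2 R)).
Implicit Types phi f u : SM Gamma -> R[i].

Definition flow (c : R -> SL2 R) (x : SM Gamma) (t : R) : SM Gamma :=
  rtrans (c t) x.

(** The derivatives along these three flows are the left-invariant vector fields
    X, Y and Theta.  They form a frame, so the functions all of whose iterated
    derivatives along them are continuous are the smooth functions. *)
Definition frame (i : 'I_3) : R -> SL2 R :=
  nth (@expX R) [:: @expX R; @expY R; @expT R] i.

Definition test_SM : set (SM Gamma -> R[i]) :=
  [set phi | compactly_supported phi /\
     forall n, smooth_along n (fun i => flow (frame i)) setT phi].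

Definition laplace_SM phi : SM Gamma -> R[i] := fun x =>
  - \sum_(i < 3) dcurve (flow (frame i)) (dcurve (flow (frame i)) phi) x.

Variable vol : {measure set (SM Gamma) -> \bar R}.

(** The closure is self-adjoint, as for M. *)
Definition Laplacian_SM : opgraph (SM Gamma) R :=
  opclosure vol test_SM laplace_SM.

Definition W (s : R) : set (SM Gamma -> R[i]) := sobolev vol Laplacian_SM s.

(** L_U u = f in the sense of distributions; U preserves the volume. *)
Definition LU_eq u f : Prop :=
  forall phi, test_SM phi ->
    - cintegral vol setT (fun x => u x * dcurve (flow (@expU R)) phi x) =
    cintegral vol setT (fun x => f x * phi x).

Definition average (T : R) f (x : SM Gamma) : R[i] :=
  cintegral (@lebesgue_measure R) `[0, T] (fun t => f (phiU t x)).

End analysis_SM.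

(* Main.v *)
Require Import Defs.
From HB Require Import structures.
From mathcomp Require Import all_boot all_order all_algebra.
From mathcomp Require Import complex.
From mathcomp Require Import all_classical all_reals all_analysis.
From mathcomp Require Import measurable_realfun.
From mathcomp Require Import ring lra.

(** Let v and w be the real, or the imaginary, parts of u and f, and let

      D_t = v o phi_t - v - int_0^t w o phi_s ds

    be the failure of the integrated equation at time t ([defect]).  For a test
    function g, invariance of the volume, the fundamental theorem of calculus
    along the orbits and the Fubini theorem give ([integral_defect_mul])

      int D_t g = - int_0^t J(s) ds,
      J(s) = int (v o phi_s) (U g) + int (w o phi_s) g.

    Moving the flow to the other factor, J(s) = 0 is the distributional equation
    tested against g o phi_(-s).  So if U v = w as distributions, then D_T is
    orthogonal to all test functions, and D_T = 0 almost everywhere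
    ([defect_eq0], by [bump_separation]).

    Conversely, let D_T = 0.  Since D_(s+t) = D_s + D_t o phi_s, computing
    D_(T+t) in two ways shows that D_t is invariant under phi_T.  The superlevel
    sets of |D_t| have finite volume, because u and f are square integrable, and
    the Mautner phenomenon ([mautner]) makes D_t invariant under the whole flow.
    Hence D is additive in time, so D_(T/n) = 0 for all n, and J integrates to
    zero over [0, T/n].  As J is continuous, J(0) = 0, which is the
    distributional equation tested against g ([LU_of_defect_eq0]).

    The Mautner phenomenon rests on an identity in SL(2,R): conjugated by
    exp(mU), a lower triangular element of size 1/m^2 becomes, up to an element
    that tends to 1, a given exp(cU); and small elements almost preserve every
    set of finite volume ([trset_continuous]).

    Two facts link this to smooth functions on the quotient.  There are enough
    of them: polynomials in the matrix entries, composed with the flat function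
    exp(-1/x), yield bump functions on small balls of SL(2,R), which descend to
    the quotient because Gamma is discrete ([exists_periodization]).  And a
    function that is C^1 along Y and Theta is C^1 along U = (Theta - Y) / 2,
    because exp(tU) is a product of elements of their one-parameter subgroups
    ([is_derive_expU]). *)

Set Implicit Arguments.
Unset Strict Implicit.
Unset Printing Implicit Defensive.
Import Order.TTheory GRing.Theory Num.Theory.
Import numFieldNormedType.Exports.

Local Open Scope classical_set_scope.
Local Open Scope ring_scope.
Local Open Scope quotient_scope.

(** * The topology of SL(2,R) *)

Section SL2_topology.
Variable R : realType.
Local Notation G := (SL2 R).

Lemma nbhs_SL2 (g : G) (A : set G) :
  nbhs g A <-> exists2 C : set 'M[R]_2, nbhs (val g) C &
                 forall h : G, C (val h) -> A h.
Proof.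
split.
  rewrite nbhsE => -[B [[C oC CB] Bg] BA].
  exists C; first by apply: open_nbhs_nbhs; split => //; rewrite -[C _]/((val @^-1` C) g) CB.
  by move=> h Ch; apply: BA; rewrite -CB.
move=> [C Cg CA]; apply: (@filterS _ _ _ (val @^-1` C)) => //.
exact: (@initial_continuous G 'M[R]_2 val g C Cg).
Qed.

Lemma cvg_SL2 (S : Type) (F : set_system S) {FF : Filter F} (f : S -> G) (g : G) :
  (forall i j, val (f x) i j @[x --> F] --> val g i j) -> f x @[x --> F] --> g.
Proof.
move=> fg A /nbhs_SL2[C [P gP PC] CA].
suff : \forall x \near F, forall i j, P i j (val (f x) i j).
  by apply: filterS => x Px; apply/CA/PC.
apply: filter_forall => i; apply: filter_forall => j.
exact: fg (gP i j).
Qed.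

Lemma continuous_entry i j : continuous (fun g : G => val g i j).
Proof.
move=> g A gA; apply/nbhs_SL2.
exists [set M : 'M[R]_2 | A (M i j)] => //.
exists (fun i' j' => if (i' == i) && (j' == j) then A else setT).
  by move=> i' j'; case: ifPn => [/andP[/eqP-> /eqP->]//|_]; exact: filterT.
by move=> M /(_ i j); rewrite /= !eqxx.
Qed.

Lemma SL2_mulE (g h : G) i j :
  val (g * h)%g i j = val g i 0 * val h 0 j + val g i 1 * val h 1 j.
Proof.
rewrite /= mxE !big_ord_recl big_ord0 addr0.
by have -> : lift ord0 ord0 = 1 :> 'I_2 by apply/val_inj.
Qed.

Lemma cvg_SL2_mul (S : Type) (F : set_system S) {FF : Filter F} (f f' : S -> G) (g g' : G) :
  f x @[x --> F] --> g -> f' x @[x --> F] --> g' ->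
  (f x * f' x)%g @[x --> F] --> (g * g')%g.
Proof.
move=> fg fg'; apply: cvg_SL2 => i j.
under eq_cvg do rewrite SL2_mulE.
rewrite SL2_mulE; apply: cvgD; apply: cvgM;
  by [apply: (cvg_comp _ _ fg (@continuous_entry _ _ _))|
      apply: (cvg_comp _ _ fg' (@continuous_entry _ _ _))].
Qed.

Lemma ord2E (P : 'I_2 -> Prop) : P 0 -> P 1 -> forall i, P i.
Proof.
move=> P0 P1 [[|[|//]] lti].
  by rewrite (_ : Ordinal lti = 0) //; apply/val_inj.
by rewrite (_ : Ordinal lti = 1) //; apply/val_inj.
Qed.

Lemma SL2_invE (g : G) :
  val (g^-1)%g = mx22 (val g 1 1) (- val g 0 1) (- val g 1 0) (val g 0 0).
Proof.
suff invmx2 (A : 'M[R]_2) : \det A = 1 ->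
    invmx A = mx22 (A 1 1) (- A 0 1) (- A 1 0) (A 0 0).
  by apply: invmx2; exact: (eqP (valP g)).
move=> detA; have AU : A \in unitmx by rewrite unitmxE detA unitr1.
move: detA; rewrite det_mx22 => detA.
suff AB : A *m mx22 (A 1 1) (- A 0 1) (- A 1 0) (A 0 0) = 1%:M.
  by rewrite -[LHS]mulmx1 -AB mulKmx.
apply/matrixP; apply: ord2E; apply: ord2E; rewrite !mxE !big_ord_recl big_ord0 addr0.
all: have -> : lift ord0 ord0 = 1 :> 'I_2 by apply/val_inj.
all: rewrite !mxE /=.
- by rewrite -detA; ring.
- by ring.
- by ring.
- by rewrite -detA; ring.
Qed.

Lemma cvg_SL2_inv (S : Type) (F : set_system S) {FF : Filter F} (f : S -> G) (g : G) :
  f x @[x --> F] --> g -> (f x)^-1%g @[x --> F] --> (g^-1)%g.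
Proof.
move=> fg; have e i j := cvg_comp _ _ fg (@continuous_entry i j g).
apply: cvg_SL2; apply: ord2E; apply: ord2E; rewrite SL2_invE;
  under eq_cvg do rewrite SL2_invE mxE /=; rewrite mxE /=.
- exact: e.
- by apply: cvgN; apply: e.
- by apply: cvgN; apply: e.
- exact: e.
Qed.

(** A filter containing a set that is compact in the space of matrices has a
    cluster point there; the topology of SL(2,R) being induced, it is also a
    cluster point in SL(2,R). *)
Lemma compact_SL2 (S : set G) : compact (val @` S : set 'M[R]_2) -> compact S.
Proof.
move=> cS F PF FS.
have [|_ [[g Sg <-] clg]] := cS (val @ F) (fmap_proper_filter _ PF).
  by rewrite /nbhs/=; apply: filterS FS => g Sg; exists g.
exists g; split=> // A B FA /nbhs_SL2[C gC CB].
have /clg : (val @ F) (val @` A).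
  by rewrite /nbhs/=; apply: filterS FA => h Ah; exists h.
by move=> /(_ C gC)[_ [[h Ah <-] Ch]]; exists h; split=> //; apply: CB.
Qed.

Lemma compact_mx_box (m : R) :
  compact [set A : 'M[R]_2 | forall i j, `|A i j| <= m].
Proof.
pose I : set R := `[- m, m]%classic.
have cI : compact I by exact: segment_compact.
have c4 := compact_setX (compact_setX cI cI) (compact_setX cI cI).
pose f (p : (R * R) * (R * R)) := mx22 p.1.1 p.1.2 p.2.1 p.2.2.
rewrite (_ : [set _ | _] = f @` ((I `*` I) `*` (I `*` I))).
  apply: continuous_compact => //; apply: continuous_subspaceT => p A [P pP PA].
  suff : \forall q \near p, forall i j, P i j (f q i j).
    by apply: filterS => q ?; apply: PA.
  apply: (@filter_forall _ _ (fun i q => forall j, P i j (f q i j)) (nbhs p)) => i.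
  apply: (@filter_forall _ _ (fun j q => P i j (f q i j)) (nbhs p)) => j.
  suff : (f q i j @[q --> p] --> f p i j) by apply; exact: pP.
  have F1 (q : R * R) : (fst x @[x --> q] --> q.1) by exact: cvg_fst.
  have F2 (q : R * R) : (snd x @[x --> q] --> q.2) by exact: cvg_snd.
  have G1 : (fst x @[x --> p] --> p.1) by exact: cvg_fst.
  have G2 : (snd x @[x --> p] --> p.2) by exact: cvg_snd.
  rewrite /f mxE; under eq_cvg do rewrite mxE.
  by case: eqP => _; case: eqP => _;
    [exact: (cvg_comp _ _ G1 (F1 _))|exact: (cvg_comp _ _ G1 (F2 _))
    |exact: (cvg_comp _ _ G2 (F1 _))|exact: (cvg_comp _ _ G2 (F2 _))].
apply/seteqP; split=> [A Am|_ [p [[/= a b] [c d]] <-]]; last first.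
  move: a b c d; rewrite /I /= !in_itv /= -!ler_norml => a b c d i j.
  by rewrite /f mxE; case: ifP => _; case: ifP.
exists ((A 0 0, A 0 1), (A 1 0, A 1 1)).
  by split; split; rewrite /I /= in_itv /= -ler_norml; exact: Am.
by apply/matrixP; apply: ord2E; apply: ord2E; rewrite mxE.
Qed.

End SL2_topology.

(** * The quotient by the discrete group *)

Section quotient.
Variables (R : realType) (Gamma : groupClosed (SL2 R)).
Local Notation G := (SL2 R).
Local Notation SM := (SM Gamma).
Local Notation pi := (\pi_SM : G -> SM).

Lemma piSM_eqP (g h : G) :
  pi g = pi h <-> exists2 k, k \in Gamma & h = (k * g)%g.
Proof.
have e : reflect (pi g = pi h) ((h * g^-1)%g \in Gamma).
  exact: (@eqmodP _ (equiv_SM Gamma) g h).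
split=> [/e hG|[k kG hE]]; last by apply/e; rewrite hE mulgK.
by exists (h * g^-1)%g => //; rewrite mulgVK.
Qed.

Lemma piSM_lmul (k g : G) : k \in Gamma -> pi (k * g)%g = pi g.
Proof. by move=> kG; apply/esym/piSM_eqP; exists k. Qed.

Lemma piSM_surj (x : SM) : exists g, x = pi g.
Proof. by exists (repr x); rewrite reprK. Qed.

Lemma rtrans_pi (g h : G) : rtrans g (pi h) = pi (h * g)%g.
Proof.
have /piSM_eqP[k kG hE] : pi (repr (pi h)) = pi h by rewrite reprK.
rewrite /rtrans; move: (repr _) hE => r ->; by rewrite -mulgA (piSM_lmul _ kG).
Qed.

Lemma rtransM (g h : G) (x : SM) : rtrans (g * h)%g x = rtrans h (rtrans g x).
Proof. by have [k ->] := piSM_surj x; rewrite !rtrans_pi mulgA. Qed.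

Lemma rtrans1 (x : SM) : rtrans 1%g x = x.
Proof. by have [k ->] := piSM_surj x; rewrite !rtrans_pi mulg1. Qed.

Lemma rtransK (g : G) : cancel (rtrans g : SM -> SM) (rtrans g^-1%g).
Proof. by move=> x; rewrite -rtransM mulgV rtrans1. Qed.

Lemma continuous_piSM : continuous pi.
Proof. exact: pi_continuous. Qed.

Lemma continuous_lmul (k : G) : continuous (fun g : G => (k * g)%g).
Proof.
move=> g; apply: (@cvg_SL2_mul _ _ (nbhs g) _ (fun=> k) id).
  exact: cvg_cst.
exact: cvg_id.
Qed.

Lemma continuous_rmul (k : G) : continuous (fun g : G => (g * k)%g).
Proof.
move=> g; apply: (@cvg_SL2_mul _ _ (nbhs g) _ id (fun=> k)).
  exact: cvg_id.
exact: cvg_cst.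
Qed.

(** The saturation of an open set of SL(2,R) is the union of its translates. *)
Lemma open_piSM (A : set G) : open A -> open (pi @` A).
Proof.
move=> oA; rewrite /open /= /quotient_open.
rewrite (_ : _ @^-1` _ =
    \bigcup_(k in [set` Gamma]) ((fun g : G => (k * g)%g) @^-1` A)).
  by apply: bigcup_open => k _; move/continuousP: (@continuous_lmul k); apply.
apply/seteqP; split=> [g [h Ah /piSM_eqP[k kG ->]]|g [k /= kG Akg]].
  by exists k^-1%g; rewrite /= ?gpredV// mulKg.
by exists (k * g)%g => //; exact: piSM_lmul.
Qed.

Lemma nbhs_piSM (g : G) (A : set G) : nbhs g A -> nbhs (pi g) (pi @` A).
Proof.
rewrite nbhsE => -[B [oB Bg] BA]; apply: (@filterS _ _ _ (pi @` B)).
  exact: image_subset.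
by apply: open_nbhs_nbhs; split; [exact: open_piSM|exists g].
Qed.

Lemma nbhs_SME (g : G) (B : set SM) : nbhs (pi g) B <-> nbhs g (pi @^-1` B).
Proof.
split; first exact: continuous_piSM.
move=> /nbhs_piSM; apply: filterS => _ [h Bh <-]; exact: Bh.
Qed.

(** As pi is open, the product topology on the space of pairs may be tested
    on lifts. *)
Lemma continuous_action (T : topologicalType) (c : T -> G) :
  continuous c -> continuous (fun p : T * SM => rtrans (c p.1) p.2).
Proof.
move=> cc [t x]; have [g ->] := piSM_surj x => A /=.
rewrite rtrans_pi => /nbhs_SME gA.
have : (p.2 * c p.1)%g @[p --> (t, g)] --> (g * c t)%g.
  apply: cvg_SL2_mul; first exact: cvg_snd.
  by apply: (cvg_comp _ _ (@cvg_fst _ _ (nbhs t) (nbhs g) _)); exact: cc.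
move=> /(_ _ gA)[[B C] [/= tB gC] BC].
exists (B, pi @` C) => /=; first by split=> //; exact: nbhs_piSM.
by move=> [s _] [/= Bs [h Ch <-]]; rewrite rtrans_pi; exact: (BC (s, h)).
Qed.

Lemma continuous_rtrans (g : G) : continuous (rtrans g : SM -> SM).
Proof.
move=> x; have := @continuous_action G id (fun=> cvg_id) (g, x).
apply: (@continuous_comp _ _ _ (fun x : SM => (g, x))
  (fun p : G * SM => rtrans p.1 p.2)).
by apply: (@cvg_pair _ _ _ (nbhs x) (nbhs g) (nbhs x)); [exact: cvg_cst|exact: cvg_id].
Qed.

Lemma continuous_orbit (x : SM) : continuous (fun g : G => rtrans g x).
Proof.
move=> g; have := @continuous_action G id (fun=> cvg_id) (g, x).
apply: (@continuous_comp _ _ _ (fun g : G => (g, x))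
  (fun p : G * SM => rtrans p.1 p.2)).
by apply: (@cvg_pair _ _ _ (nbhs g) (nbhs g) (nbhs x)); [exact: cvg_id|exact: cvg_cst].
Qed.

End quotient.

(** * Functions that are flat at the origin *)

Section flat.
Variable R : realType.
Implicit Types (p q : {poly R}) (x y : R).

(** For [p = 1] this is the classical smooth function that vanishes to infinite
    order at 0; the polynomial factor in 1/x makes the family closed under
    differentiation. *)
Definition flat p x : R := if 0 < x then expR (- x^-1) * p.[x^-1] else 0.

Definition dflat p : {poly R} := 'X^2 * (p - p^`()).

Lemma flat_le0 p x : x <= 0 -> flat p x = 0.
Proof. by rewrite /flat leNgt => /negbTE ->. Qed.

(** The degree [i] term is beaten by the term of degree [i.+1] of the
    exponential series. *)
Lemma expRN_horner_le p :
  exists C, forall y, 0 < y -> expR (- y) * `|p.[y]| <= C * y^-1.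
Proof.
exists (\sum_(i < size p) `|p`_i| * i.+1`!%:R) => y y0.
rewrite horner_coef mulr_suml.
apply: (@le_trans _ _ (expR (- y) * \sum_(i < size p) `|p`_i * y ^+ i|)).
  by rewrite ler_wpM2l ?expR_ge0 ?ler_norm_sum.
rewrite mulr_sumr ler_sum// => i _.
rewrite normrM [`|y ^+ i|]ger0_norm ?exprn_ge0 ?(ltW y0)//.
rewrite mulrCA -mulrA ler_wpM2l// expRN ler_pdivlMr// -mulrA -exprSr.
rewrite ler_pdivrMl ?expR_gt0// -ler_pdivrMr ?ltr0n ?fact_gt0//.
by apply: le_trans (expR_ge1Dxn i (ltW y0)); rewrite lerDr.
Qed.

Lemma cvg_flat0 p : flat p x @[x --> 0] --> 0.
Proof.
have [C pC] := expRN_horner_le p.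
have Cx : `|C * x| @[x --> (0 : R)] --> (0 : R).
  have h : C * x @[x --> (0 : R)] --> C * 0 by exact: mulrl_continuous.
  by have := cvg_norm h; rewrite mulr0 normr0; exact.
apply: (@squeeze_cvgr _ _ _ _ (fun x => - `|C * x|) (fun x => `|C * x|)).
- near=> x; rewrite -ler_norml; have [x0|x0] := leP x 0.
    by rewrite flat_le0// normr0.
  rewrite /flat x0 normrM ger0_norm ?expR_ge0//.
  apply: le_trans (pC _ _) _; first by rewrite invr_gt0.
  by rewrite invrK ler_norm.
- by have := cvgN Cx; rewrite oppr0; exact.
- exact: Cx.
Unshelve. all: by end_near.
Qed.

(** At the origin the difference quotient of [flat p] is [flat ('X * p)]. *)
Lemma is_derive_flat p x : is_derive x 1 (flat p) (flat (dflat p) x).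
Proof.
have [x0|x0|->] := ltgtP x 0.
- rewrite flat_le0 ?(ltW x0)//.
  apply: (@near_eq_is_derive _ _ _ (cst 0)) => //.
  near=> y; rewrite flat_le0//=; near: y; apply: filterS (lt_nbhsl x0) => y; exact: ltW.
- apply: (@near_eq_is_derive _ _ _ (fun y => expR (- y^-1) * p.[y^-1])).
    near=> y; rewrite /flat ifT//; near: y; exact: lt_nbhsr.
  have x_neq0 : x != 0 by rewrite gt_eqF.
  have dV : is_derive x 1 (fun y : R => y^-1) (- x ^- 2 *: 1) by exact: is_deriveV.
  have dE : is_derive x 1 (fun y => expR (- y^-1)) (expR (- x^-1) * - (- x ^- 2 *: 1)).
    by apply: (@is_derive1_comp _ expR (fun y => - y^-1)).
  have dp := @is_derive1_comp _ (horner p) (fun y => y^-1) x _ _ (is_derive_poly _ _) dV.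
  apply: (is_derive_eq (is_deriveM dE dp)).
  rewrite /flat x0 /dflat hornerM hornerXn hornerD hornerN /=.
  rewrite /GRing.scale /= mulr1 exprVn.
  have E (a b c y : R) : a * (c * - y) + b * (a * - - y) = a * (y * (b - c)).
    by ring.
  exact: E.
- rewrite flat_le0//; apply/is_derive1_caratheodory.
  exists (flat ('X * p)); split; last by rewrite flat_le0.
    move=> z; rewrite (flat_le0 p (lexx 0)) !subr0 /flat; case: ifPn => [z0|_]; last by rewrite mul0r.
    by rewrite hornerM hornerX mulrCA [RHS]mulrC mulVKf ?gt_eqF.
  by have := @cvg_flat0 ('X * p); rewrite -[X in _ --> X](flat_le0 ('X * p) (lexx 0)); exact.
Unshelve. all: by end_near.
Qed.

Lemma continuous_flat p : continuous (flat p).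
Proof.
move=> x; apply: differentiable_continuous; apply/derivable1_diffP.
by have [] := is_derive_flat p x.
Qed.

Lemma flat1_itv x : 0 <= flat 1 x <= 1.
Proof.
rewrite /flat; case: ifPn => [x0|_]; last by rewrite lexx ler01.
by rewrite hornerC mulr1 expR_ge0 expR_le1 oppr_le0 invr_ge0 ltW.
Qed.

(** For positive [x], the exponent - 1 / (n x) tends to 0. *)
Lemma cvg_flat1 x : flat 1 (n%:R * x) @[n --> \oo] --> ((0 < x)%R%:R : R).
Proof.
have [x0|x0] := boolP (0 < x); last first.
  have -> : (fun n : nat => flat 1 (n%:R * x)) = cst 0.
    by apply/funext => n; rewrite flat_le0 // mulr_ge0_le0 ?ler0n ?leNgt.
  exact: cvg_cst.
suff : flat 1 (n%:R * x) @[n --> \oo] --> expR (- (0 : R)).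
  by rewrite oppr0 expR0; exact.
apply: (@cvg_trans _ ((fun n : nat => expR (- (n%:R * x)^-1)) @ \oo)).
  apply: near_eq_cvg; near=> n; rewrite /flat hornerC mulr1 ifT// mulr_gt0// ltr0n.
  by near: n; exact: nbhs_infty_gt.
apply: continuous_cvg; first exact: continuous_expR.
have h : (n%:R^-1 : R) @[n --> \oo] --> (0 : R).
  by rewrite -(cvg_shiftS (fun n : nat => n%:R^-1 : R)); exact: cvg_harmonic.
have h2 : ((n%:R * x)^-1 : R) @[n --> \oo] --> (0 : R).
  under eq_cvg do rewrite invfM.
  by have := cvgM h (@cvg_cst _ x^-1 _ \oo _); rewrite mul0r; exact.
exact: cvgN h2.
Unshelve. all: by end_near.
Qed.

End flat.

Local Open Scope complex_scope.

(** * Smooth functions on the quotient *)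

Section polyflat.
Variable R : realType.
Local Notation G := (SL2 R).

(** A supply of smooth functions on SL(2,R) that is closed under the
    derivations, is invariant under translations and contains bump functions. *)
Inductive polyflat : (G -> R) -> Prop :=
| polyflat_cst c : polyflat (fun=> c)
| polyflat_entry i j : polyflat (fun g => val g i j)
| polyflatD F1 F2 : polyflat F1 -> polyflat F2 -> polyflat (fun g => F1 g + F2 g)
| polyflatM F1 F2 : polyflat F1 -> polyflat F2 -> polyflat (fun g => F1 g * F2 g)
| polyflat_flat p F : polyflat F -> polyflat (fun g => flat p (F g)).

(** For a one-parameter subgroup, [V] is its infinitesimal generator. *)
Definition velocity (c : R -> G) (V : 'M[R]_2) : Prop :=
  c 0 = 1%g /\ forall i j, is_derive (0 : R) 1 (fun t => val (c t) i j) (V i j).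

Lemma cvg_curve (c : R -> G) V (g : G) :
  velocity c V -> (g * c t)%g @[t --> (0 : R)] --> g.
Proof.
move=> [c0 dc]; rewrite -[X in _ --> X]mulg1 -c0.
apply: cvg_SL2_mul; first exact: cvg_cst.
apply: cvg_SL2 => i j.
have [d _] := dc i j.
by move: d => /derivable1_diffP/differentiable_continuous; exact.
Qed.

Lemma continuous_polyflat F : polyflat F -> continuous F.
Proof.
elim=> {F} [c|i j|F1 F2 _ IH1 _ IH2|F1 F2 _ IH1 _ IH2|p F _ IH] g.
- exact: cst_continuous.
- exact: continuous_entry.
- exact: cvgD (IH1 g) (IH2 g).
- exact: cvgM (IH1 g) (IH2 g).
- exact: (continuous_comp (IH g) (@continuous_flat _ p (F g))).
Qed.

Lemma polyflat_lmul (k : G) F : polyflat F -> polyflat (fun g => F (k * g)%g).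
Proof.
elim=> {F} [c|i j|F1 F2 _ IH1 _ IH2|F1 F2 _ IH1 _ IH2|p F _ IH].
- exact: polyflat_cst.
- under eq_fun do rewrite SL2_mulE.
  by apply: polyflatD; apply: polyflatM; (apply: polyflat_cst || apply: polyflat_entry).
- exact: polyflatD IH1 IH2.
- exact: polyflatM IH1 IH2.
- exact: polyflat_flat IH.
Qed.

Lemma polyflat_rmul (k : G) F : polyflat F -> polyflat (fun g => F (g * k)%g).
Proof.
elim=> {F} [c|i j|F1 F2 _ IH1 _ IH2|F1 F2 _ IH1 _ IH2|p F _ IH].
- exact: polyflat_cst.
- under eq_fun do rewrite SL2_mulE.
  by apply: polyflatD; apply: polyflatM; (apply: polyflat_cst || apply: polyflat_entry).
- exact: polyflatD IH1 IH2.
- exact: polyflatM IH1 IH2.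
- exact: polyflat_flat IH.
Qed.

Lemma polyflat_derive (c : R -> G) V F : velocity c V -> polyflat F ->
  exists2 F', polyflat F' &
    forall g, is_derive (0 : R) 1 (fun t => F (g * c t)%g) (F' g).
Proof.
move=> cV; have [c0 dc] := cV.
elim=> {F} [a|i j|F1 F2 pF1 [F1' pF1' d1] pF2 [F2' pF2' d2]
  |F1 F2 pF1 [F1' pF1' d1] pF2 [F2' pF2' d2]|p F pF [F' pF' d]].
- by exists (fun=> 0); [exact: polyflat_cst|move=> g; exact: is_derive_cst].
- exists (fun g : G => val g i 0 * V 0 j + val g i 1 * V 1 j).
    by apply: polyflatD; apply: polyflatM; (apply: polyflat_cst || apply: polyflat_entry).
  move=> g; under eq_fun do rewrite SL2_mulE.
  exact: is_deriveD (is_deriveZ (val g i 0) (dc 0 j)) (is_deriveZ (val g i 1) (dc 1 j)).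
- exists (fun g => F1' g + F2' g); first exact: polyflatD.
  by move=> g; exact: is_deriveD (d1 g) (d2 g).
- exists (fun g => F1 g * F2' g + F2 g * F1' g).
    by apply: polyflatD; exact: polyflatM.
  by move=> g; have := is_deriveM (d1 g) (d2 g); rewrite c0 mulg1.
- exists (fun g => flat (dflat p) (F g) * F' g).
    by apply: polyflatM => //; exact: polyflat_flat.
  move=> g; apply: (@is_derive1_comp _ (flat p) (fun t => F (g * c t)%g)) => //.
  by have := is_derive_flat p (F g); rewrite -{1}[g]mulg1 -c0.
Qed.

Lemma is_derive_cosh0 : is_derive (0 : R) 1 (@cosh R) 0.
Proof.
have d1 : is_derive (0 : R) 1 (fun t : R => expR (- t)) (expR (- 0) * - 1).
  exact: (@is_derive1_comp _ expR (fun t => - t)).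
have := is_deriveZ 2^-1 (is_deriveD (is_derive_expR (0 : R)) d1).
rewrite oppr0 expR0 mul1r subrr scaler0; congr is_derive.
by apply/funext => t; rewrite /cosh mulrC.
Qed.

Lemma is_derive_sinh0 : is_derive (0 : R) 1 (@sinh R) 1.
Proof.
have d1 : is_derive (0 : R) 1 (fun t : R => expR (- t)) (expR (- 0) * - 1).
  exact: (@is_derive1_comp _ expR (fun t => - t)).
have := is_deriveZ 2^-1 (is_deriveB (is_derive_expR (0 : R)) d1).
rewrite oppr0 expR0 mul1r opprK; rewrite [_ *: _](_ : _ = 1); last first.
  by rewrite /GRing.scale /= -[1 + 1]/(2%:R) mulVf// pnatr_eq0.
congr is_derive.
by apply/funext => t; rewrite /sinh mulrC.
Qed.

Lemma velocity_mx22 (c : R -> G) (a b d e : R -> R) a' b' d' e' :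
  (forall t, val (c t) = mx22 (a t) (b t) (d t) (e t)) ->
  a 0 = 1 -> b 0 = 0 -> d 0 = 0 -> e 0 = 1 ->
  is_derive (0 : R) 1 a a' -> is_derive (0 : R) 1 b b' ->
  is_derive (0 : R) 1 d d' -> is_derive (0 : R) 1 e e' ->
  velocity c (mx22 a' b' d' e').
Proof.
move=> cE a0 b0 d0 e0 ha hb hd he; split.
  apply/val_inj; rewrite cE a0 b0 d0 e0; apply/matrixP.
  by apply: ord2E; apply: ord2E; rewrite !mxE.
by apply: ord2E; apply: ord2E; (under eq_fun do rewrite cE mxE /=); rewrite mxE /=.
Qed.

Lemma velocity_expU : velocity (@expU R) (mx22 0 1 0 0).
Proof. by apply: (@velocity_mx22 _ (fun=> 1) id (fun=> 0) (fun=> 1)); rewrite //=; exact: is_derive_cst. Qed.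

Lemma velocity_expX : velocity (@expX R) (mx22 1 0 0 (- 1)).
Proof.
apply: (@velocity_mx22 _ expR (fun=> 0) (fun=> 0) (fun t => expR (- t))) => //.
- by rewrite expR0.
- by rewrite oppr0 expR0.
- by have := is_derive_expR (0 : R); rewrite expR0.
- have : is_derive (0 : R) 1 (fun t : R => expR (- t)) (expR (- 0) * - 1).
    exact: (@is_derive1_comp _ expR (fun t => - t)).
  by rewrite oppr0 expR0 mul1r.
Qed.

Lemma velocity_expY : velocity (@expY R) (mx22 0 (- 1) (- 1) 0).
Proof.
have ds := is_deriveN is_derive_sinh0; have dc := is_derive_cosh0.
apply: (@velocity_mx22 _ (@cosh R) (fun t => - sinh t) (fun t => - sinh t) (@cosh R)) => //;
  rewrite /cosh /sinh oppr0 expR0 ?subrr ?mul0r ?oppr0//.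
all: by rewrite -[1 + 1]/(2%:R) divff// pnatr_eq0.
Qed.

Lemma velocity_expT : velocity (@expT R) (mx22 0 1 (- 1) 0).
Proof.
have ds := is_derive_sin (0 : R); have dc := is_derive_cos (0 : R).
rewrite cos0 in ds; rewrite sin0 oppr0 in dc.
apply: (@velocity_mx22 _ (@cos R) (@sin R) (fun t => - sin t) (@cos R)) => //;
  rewrite ?sin0 ?cos0 ?oppr0//.
Qed.

Lemma velocity_frame (i : 'I_3) : exists V, velocity (@frame R i) V.
Proof.
case: i => -[|[|[|//]]] lti; rewrite /frame /=.
- by eexists; exact: velocity_expX.
- by eexists; exact: velocity_expY.
- by eexists; exact: velocity_expT.
Qed.

End polyflat.

Section locally_polyflat.
Variables (R : realType) (Gamma : groupClosed (SL2 R)).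
Local Notation G := (SL2 R).
Local Notation SM := (SM Gamma).
Local Notation pi := (\pi_SM : G -> SM).
Implicit Type phi : SM -> R.

Definition locally_polyflat phi : Prop :=
  forall g : G, exists2 F, polyflat F & \forall h \near g, phi (pi h) = F h.

Lemma continuous_locally_polyflat phi : locally_polyflat phi -> continuous phi.
Proof.
move=> lphi; apply/quotient_continuous => g.
have [F pF phiF] := lphi g.
have Fg : F x @[x --> g] --> F g by exact: (@continuous_polyflat _ F pF).
have phiFg : phi (pi g) = F g := nbhs_singleton phiF.
move=> A /=; rewrite phiFg => /Fg FA.
suff : \forall h \near (g : G), A (phi (pi h)) by [].
have {}FA : \forall h \near (g : G), A (F h) by exact: FA.
by near=> h; have -> : phi (pi h) = F h; near: h.
Unshelve. all: by end_near.
Qed.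

Lemma locally_polyflatM phi psi : locally_polyflat phi -> locally_polyflat psi ->
  locally_polyflat (fun x => phi x * psi x).
Proof.
move=> lphi lpsi g; have [F pF phiF] := lphi g; have [F' pF' psiF'] := lpsi g.
exists (fun h => F h * F' h); first exact: polyflatM.
by near=> h; congr (_ * _); near: h.
Unshelve. all: by end_near.
Qed.

Lemma locally_polyflat_rtrans (k : G) phi : locally_polyflat phi ->
  locally_polyflat (phi \o rtrans k).
Proof.
move=> lphi g; have [F pF phiF] := lphi (g * k)%g.
exists (fun h => F (h * k)%g); first exact: polyflat_rmul.
have {}phiF : \forall h \near g, phi (pi (h * k)%g) = F (h * k)%g.
  exact: (@continuous_rmul _ k g _ phiF).
by near=> h; rewrite /= rtrans_pi; near: h.
Unshelve. all: by end_near.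
Qed.

(** The derivative at [pi g] may be computed on the local lifts of [phi] near
    [g], since [h * c t] stays near [g] for small [t] and [h] near [g]. *)
Lemma locally_polyflat_derive (c : R -> G) V phi :
  velocity c V -> locally_polyflat phi ->
  exists2 phi', locally_polyflat phi' &
    forall x, is_derive (0 : R) 1 (fun t => phi (rtrans (c t) x)) (phi' x).
Proof.
move=> cV lphi.
have key g : exists2 F', polyflat F' & \forall h \near (g : G),
    is_derive (0 : R) 1 (fun t => phi (rtrans (c t) (pi h))) (F' h).
  have [F pF phiF] := lphi g.
  have [F' pF' dF] := polyflat_derive cV pF; exists F' => //.
  have : \forall h \near g, \forall h' \near h, phi (pi h') = F h'.
    exact: nbhs_interior phiF.
  move=> phiFF; near=> h.
  have hF : \forall h' \near h, phi (pi h') = F h' by near: h.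
  apply: near_eq_is_derive (dF h).
  have htF : \forall t \near (0 : R), phi (pi (h * c t)%g) = F (h * c t)%g.
    exact: (@cvg_curve _ c V h cV _ hF).
  by near=> t; rewrite rtrans_pi; apply: esym; near: t.
exists (fun x => 'D_1 (fun t => phi (rtrans (c t) x)) (0 : R)).
  move=> g; have [F' pF' dF'] := key g; exists F' => //.
  near=> h.
  have [_ //] : is_derive (0 : R) 1 (fun t => phi (rtrans (c t) (pi h))) (F' h).
  by near: h.
move=> x; have [g ->] := piSM_surj x; have [F' _ dF'] := key g.
by have [d _] := nbhs_singleton dF'; exact: derivableP.
Unshelve. all: by end_near.
Qed.

Lemma dcurve_real (c : R -> G) phi phi' :
  (forall x, is_derive (0 : R) 1 (fun t => phi (rtrans (c t) x)) (phi' x)) ->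
  dcurve (flow c) (fun x => (phi x)%:C) = (fun x => (phi' x)%:C).
Proof.
move=> d; apply/funext => x; have [_ dE] := d x.
by rewrite /dcurve /cderive /flow /= !derive1E dE derive_cst.
Qed.

Lemma smooth_locally_polyflat phi n : locally_polyflat phi ->
  smooth_along n (fun i => flow (@frame R i)) setT (fun x : SM => (phi x)%:C).
Proof.
elim: n phi => [|n IH] phi lphi /=.
  split=> // x _; split; first exact: continuous_locally_polyflat.
  exact: (@cst_continuous _ _ (0 : R) x).
split.
  move=> x _; split; first exact: continuous_locally_polyflat.
  exact: (@cst_continuous _ _ (0 : R) x).
move=> i; have [V cV] := velocity_frame R i.
have [phi' lphi' d] := locally_polyflat_derive cV lphi.
split; last by rewrite (dcurve_real d); exact: IH.
move=> x _; split; last exact: derivable_cst.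
by have [] := d x.
Qed.

End locally_polyflat.

(** * Bump functions *)

Section wandering.
Variables (R : realType) (Gamma : groupClosed (SL2 R)).
Local Notation G := (SL2 R).
Local Notation SM := (SM Gamma).
Local Notation pi := (\pi_SM : G -> SM).

(** Proper discontinuity in the form needed to push functions with support in
    [S] down to the quotient: near each point, at most one translate of [S] is
    met. *)
Definition wandering (S : set G) : Prop :=
  forall h : G, exists2 N, nbhs h N & forall k1 k2 n1 n2,
    k1 \in Gamma -> k2 \in Gamma -> N n1 -> N n2 ->
    S (k1 * n1)%g -> S (k2 * n2)%g -> k1 = k2.

Lemma sub_wandering (S S' : set G) : S `<=` S' -> wandering S' -> wandering S.
Proof.
move=> SS' wS' h; have [N hN NS'] := wS' h; exists N => // k1 k2 n1 n2 *.
by apply: (NS' _ _ n1 n2) => //; exact: SS'.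
Qed.

(** If k1 n1 = s1 and k2 n2 = s2 then k1 k2^-1 = s1 (n1^-1 n2) s2^-1, which is
    close to 1 when the s_i are close to g and the n_i to each other; by
    discreteness it is then equal to 1. *)
Lemma nbhs_wandering (g : G) : discrete_subgroup Gamma ->
  exists2 S, nbhs g S & wandering S.
Proof.
move=> /(_ 1%g gpred1)[_ [U U1 UGamma]].
have c : (p.1.1 * p.2 * p.1.2^-1)%g @[p --> ((g, g), (1%g : G))] --> (1%g : G).
  have f1 : p.1 @[p --> ((g, g), (1%g : G))] --> (g, g) by exact: cvg_fst.
  have f2 : p.2 @[p --> ((g, g), (1%g : G))] --> (1%g : G) by exact: cvg_snd.
  have f11 : p.1.1 @[p --> ((g, g), (1%g : G))] --> g.
    by apply: (cvg_comp _ _ f1); exact: cvg_fst.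
  have f12 : p.1.2 @[p --> ((g, g), (1%g : G))] --> g.
    by apply: (cvg_comp _ _ f1); exact: cvg_snd.
  have := cvg_SL2_mul (cvg_SL2_mul f11 f2) (cvg_SL2_inv f12).
  by rewrite mulg1 mulgV; exact.
have [[B V] [/= [[S1 S2] [/= gS1 gS2] S12] V1] BV] := c _ U1.
exists (S1 `&` S2); first exact: filterI.
move=> h.
have d : (p.1^-1 * p.2)%g @[p --> (h, h)] --> (1%g : G).
  have f1 : p.1 @[p --> (h, h)] --> h by exact: cvg_fst.
  have f2 : p.2 @[p --> (h, h)] --> h by exact: cvg_snd.
  by have := cvg_SL2_mul (cvg_SL2_inv f1) f2; rewrite mulVg; exact.
have [[N1 N2] [/= hN1 hN2] N12] := d _ V1.
exists (N1 `&` N2); first exact: filterI.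
move=> k1 k2 n1 n2 k1G k2G [Nn1 _] [_ Nn2] [S1n1 _] [_ S2n2].
have kU : U (k1 * n1 * (n1^-1 * n2) * (k2 * n2)^-1)%g.
  apply: (BV ((k1 * n1, k2 * n2), n1^-1 * n2)%g).
  by split; [exact: (S12 (k1 * n1, k2 * n2)%g)|exact: (N12 (n1, n2))].
have kE : (k1 * n1 * (n1^-1 * n2) * (k2 * n2)^-1 = k1 * k2^-1)%g.
  by rewrite invgM !mulgA !mulgK.
rewrite /= kE in kU.
have : (U `&` [set` Gamma]) (k1 * k2^-1)%g by split=> //=; rewrite gpredM ?gpredV.
rewrite UGamma /= => k12.
by rewrite -[RHS]mul1g -k12 mulgVK.
Qed.

(** The sum of [F] over the translates by [Gamma] has at most one nonzero term,
    and locally the same one, so that it is as regular as [F]. *)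
Lemma exists_periodization (S : set G) (F : G -> R) :
  wandering S -> polyflat F -> (forall g, F g != 0 -> S g) ->
  exists phi : SM -> R, [/\ locally_polyflat phi,
    forall g, S g -> phi (pi g) = F g &
    forall x, phi x != 0 -> (pi @` S) x].
Proof.
move=> wS pF FS.
(* the element of [Gamma] that gives the only possibly nonzero term *)
pose sel g : G := xget 1%g [set k | k \in Gamma /\ S (k * g)%g].
have selG g : sel g \in Gamma by rewrite /sel; case: xgetP => [k _ []//|_]; exact: gpred1.
pose phi (x : SM) : R := F (sel (repr x) * repr x)%g.
have phiE g k : k \in Gamma -> S (k * g)%g -> phi (pi g) = F (k * g)%g.
  move=> kG Skg.
  have /piSM_eqP[l lG gE] : pi (repr (pi g)) = pi g by rewrite reprK.
  rewrite /phi; move: (repr _) gE => r rE.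
  have Sr : S (sel r * r)%g.
    rewrite /sel; case: xgetP => [m _ []//|/(_ (k * l)%g) nS].
    by exfalso; apply: nS; split; rewrite ?gpredM// -mulgA -rE.
  have [N rN NS] := wS r; have Nr := nbhs_singleton rN.
  rewrite (NS (sel r) (k * l)%g r r) ?selG ?gpredM// -?mulgA -?rE//.
have phi0 g : (forall k, k \in Gamma -> ~ S (k * g)%g) -> phi (pi g) = 0.
  move=> nS.
  have /piSM_eqP[l lG gE] : pi (repr (pi g)) = pi g by rewrite reprK.
  rewrite /phi; move: (repr _) gE => r rE.
  have /eqP // : F (sel r * r)%g == 0.
  apply/negP => /negP/FS; rewrite -(mulKg l r) -rE mulgA => /nS.
  by apply; rewrite gpredM ?gpredV ?selG.
exists phi; split.
- move=> g; have [N gN NS] := wS g.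
  have [[k0 [n0 [k0G Nn0 Sk0]]]|nS] :=
      pselect (exists k0 n0, [/\ k0 \in Gamma, N n0 & S (k0 * n0)%g]).
    exists (fun h => F (k0 * h)%g); first exact: polyflat_lmul.
    apply: filterS gN => n Nn.
    have [[k [kG Sk]]|nS] := pselect (exists k, k \in Gamma /\ S (k * n)%g).
      by rewrite (NS k0 k n0 n)//; exact: phiE.
    have n0S : ~ S (k0 * n)%g by move=> ?; apply: nS; exists k0.
    rewrite phi0; last by move=> k kG Sk; apply: nS; exists k.
    by apply/esym/eqP; apply/negPn/negP => /FS.
  exists (fun=> 0); first exact: polyflat_cst.
  apply: filterS gN => n Nn; apply: phi0 => k kG Sk.
  by apply: nS; exists k, n.
- by move=> g Sg; rewrite (@phiE g 1%g) ?mul1g ?gpred1.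
- move=> x; have [g ->] := piSM_surj x => /eqP phig.
  have [[k [kG Sk]]|nS] := pselect (exists k, k \in Gamma /\ S (k * g)%g).
    by exists (k * g)%g => //; exact: piSM_lmul.
  by exfalso; apply: phig; apply: phi0 => k kG Sk; apply: nS; exists k.
Qed.

Lemma closed_pi_wandering (S : set G) :
  wandering S -> closed S -> closed (pi @` S).
Proof.
move=> wS cS; rewrite -openC openE => x nx.
have [g gx] := piSM_surj x; rewrite gx in nx *.
have nS k : k \in Gamma -> ~ S (k * g)%g.
  by move=> kG Sk; apply: nx; exists (k * g)%g => //; exact: piSM_lmul.
apply/nbhs_SME; have [N gN NS] := wS g.
have notin n : (forall k, k \in Gamma -> ~ S (k * n)%g) -> (~` (pi @` S)) (pi n).
  by move=> h [s Ss /esym/piSM_eqP[k kG sE]]; apply: (h k) => //; rewrite -sE.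
have [[k0 [n0 [k0G Nn0 Sk0]]]|nSN] := pselect (exists k0 n0, [/\ k0 \in Gamma, N n0 & S (k0 * n0)%g]).
  have nSk0 : nbhs g [set h | ~ S (k0 * h)%g].
    apply: (@continuous_lmul _ k0 g (~` S)).
    by apply: open_nbhs_nbhs; split; [rewrite openC|exact: nS].
  suff : \forall n \near g, (~` (pi @` S)) (pi n) by [].
  near=> n; apply: notin => k kG Sk.
  have Nn : N n by near: n.
  suff : ~ S (k0 * n)%g by rewrite (NS k0 k n0 n).
  by near: n.
suff : \forall n \near g, (~` (pi @` S)) (pi n) by [].
near=> n; apply: notin => k kG Sk.
by apply: nSN; exists k, n; split => //; near: n.
Unshelve. all: by end_near.
Qed.

End wandering.

Section balls.
Variables (R : realType).
Local Notation G := (SL2 R).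

(** Positive exactly on the open euclidean ball with centre [q] and radius [r]. *)
Definition ball_fun (q : 'M[R]_2) (r : R) (g : G) : R :=
  r ^+ 2 - \sum_i \sum_j (val g i j - q i j) ^+ 2.

Definition oball q r : set G := [set g | 0 < ball_fun q r g].
Definition cball q r : set G := [set g | 0 <= ball_fun q r g].

Lemma polyflat_ball_fun q r : polyflat (ball_fun q r).
Proof.
have pe i j : polyflat (fun g : G => (val g i j - q i j) ^+ 2).
  under eq_fun do rewrite expr2.
  by apply: polyflatM; apply: polyflatD; (exact: polyflat_entry || exact: polyflat_cst).
have -> : ball_fun q r = fun g => r ^+ 2 + (-1) * (((val g 0 0 - q 0 0) ^+ 2 +
   (val g 0 1 - q 0 1) ^+ 2) + ((val g 1 0 - q 1 0) ^+ 2 + (val g 1 1 - q 1 1) ^+ 2)).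
  apply/funext => g; rewrite /ball_fun !big_ord_recl !big_ord0 !addr0 mulN1r.
  by have -> : lift ord0 ord0 = 1 :> 'I_2 by apply/val_inj.
apply: polyflatD; first exact: polyflat_cst.
apply: polyflatM; first exact: polyflat_cst.
by apply: polyflatD; apply: polyflatD.
Qed.

Lemma open_oball q r : open (oball q r).
Proof.
rewrite (_ : oball q r = ball_fun q r @^-1` [set x | 0 < x])//.
by move/continuousP: (continuous_polyflat (polyflat_ball_fun q r)); apply; exact: open_gt.
Qed.

Lemma closed_cball q r : closed (cball q r).
Proof.
rewrite (_ : cball q r = ball_fun q r @^-1` [set x | 0 <= x])//.
move/continuous_closedP: (continuous_polyflat (polyflat_ball_fun q r)).
by apply; exact: closed_ge.
Qed.

Lemma cball_entry q r g i j : 0 <= r -> cball q r g -> `|val g i j - q i j| <= r.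
Proof.
move=> r0; rewrite /cball /= /ball_fun subr_ge0 => h.
rewrite -(ger0_norm r0) -ler_sqr ?nnegrE// !real_normK ?num_real//.
apply: le_trans h; rewrite (bigD1 i)//= (bigD1 j)//= -!addrA lerDl.
by rewrite addr_ge0 ?sumr_ge0// => k _; rewrite ?sumr_ge0// ?sqr_ge0// => l _; rewrite sqr_ge0.
Qed.

Lemma compact_cball q r : 0 <= r -> compact (cball q r).
Proof.
move=> r0.
pose m := \sum_i \sum_j `|q i j| + r.
have cbox : compact [set g : G | forall i j, `|val g i j| <= m].
  apply: compact_SL2.
  have -> : val @` [set g : G | forall i j, `|val g i j| <= m] =
     [set A : 'M[R]_2 | forall i j, `|A i j| <= m] `&`
     ((fun A : 'M[R]_2 => \det A) @^-1` [set 1]).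
    apply/seteqP; split=> [_ [g gm <-]|A [Am detA]].
      by split=> //=; exact/eqP/(valP g).
    by exists (Sub A (introT eqP detA)).
  apply: compact_closedI; first exact: compact_mx_box.
  have cdet : continuous (fun A : 'M[R]_2 => \det A).
    have -> : (fun A : 'M[R]_2 => \det A) =
       (fun A : 'M[R]_2 => A 0 0 * A 1 1 - A 0 1 * A 1 0).
      by apply/funext => A; rewrite det_mx22.
    move=> A; have c i j : ((fun B : 'M[R]_2 => B i j) B @[B --> A] --> A i j) by exact: coord_continuous.
    by have := cvgB (cvgM (c 0 0) (c 1 1)) (cvgM (c 0 1) (c 1 0)); exact.
  by move/continuous_closedP: cdet; apply; exact: closed_eq.
apply: (subclosed_compact _ cbox); first exact: closed_cball.
move=> g gq i j; rewrite -[val g i j](subrK (q i j)) (le_trans (ler_normD _ _))//.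
rewrite /m addrC lerD ?cball_entry//.
rewrite (bigD1 i)//= (bigD1 j)//= -!addrA lerDl.
by rewrite addr_ge0 ?sumr_ge0// => k _; rewrite ?sumr_ge0.
Qed.

(** The centre is a rational matrix that need not lie in SL(2,R); so there are
    countably many balls, and no dense sequence of SL(2,R) is called for. *)
Lemma rational_ball (g : G) (U : set G) : nbhs g U ->
  exists (q : 'M[rat]_2) (r : rat), [/\ 0 <= ratr r :> R,
    oball (map_mx ratr q) (ratr r) g & cball (map_mx ratr q) (ratr r) `<=` U].
Proof.
move=> /nbhs_SL2[C /nbhs_ballP[e /= e0 eC] CU].
have [r /=] := rat_in_itvoo (divr_gt0 e0 (ltr0n R 2)); rewrite in_itv /= => /andP[r0 re].
have hq i j : exists q : rat, `|val g i j - ratr q| < ratr r / 2 :> R.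
  have h : val g i j - ratr r / 2 < val g i j + ratr r / 2 :> R.
    by rewrite ltrD2l gtrN// divr_gt0.
  have [q /=] := rat_in_itvoo h; rewrite in_itv /= => /andP[q1 q2].
  by exists q; rewrite ltr_norml; apply/andP; split; lra.
pose q := \matrix_(i, j) projT1 (cid (hq i j)) : 'M[rat]_2.
have qP i j : `|val g i j - ratr (q i j)| < ratr r / 2 :> R.
  by rewrite mxE; case: cid.
exists q, r; split; first exact: ltW.
  rewrite /oball /= /ball_fun subr_gt0 !big_ord_recl !big_ord0 !addr0.
  have hs i j : (val g i j - map_mx ratr q i j) ^+ 2 < (ratr r / 2) ^+ 2.
    rewrite -real_normK ?num_real// ltr_sqr ?nnegrE ?normr_ge0//.
      by rewrite [map_mx _ _ _ _]mxE.
    by rewrite divr_ge0// ltW.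
  have -> : lift ord0 ord0 = 1 :> 'I_2 by apply/val_inj.
  have := (hs 0 0, hs 0 1, hs 1 0, hs 1 1); case=> [[[]]].
  have -> : (ratr r / 2) ^+ 2 = ratr r ^+ 2 / 4 :> R by field.
  by lra.
move=> h hr; apply/CU/eC; split=> // i j.
have := cball_entry i j (ltW r0) hr; have := qP i j; rewrite [map_mx _ _ _ _]mxE => h1 h2.
rewrite /ball /=.
have -> : val g i j - val h i j = (val g i j - ratr (q i j)) - (val h i j - ratr (q i j)) by ring.
rewrite (le_lt_trans (ler_normB _ _))//; lra.
Qed.

End balls.

Section bumpable.
Variables (R : realType) (Gamma : groupClosed (SL2 R)).
Local Notation G := (SL2 R).
Local Notation SM := (SM Gamma).
Local Notation pi := (\pi_SM : G -> SM).
Variable vol : {measure set SM -> \bar R}.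
Hypothesis Gamma_discrete : discrete_subgroup Gamma.
Hypothesis vol_inv : invariant_volume vol.

Lemma open_measurableSM (A : set SM) : open A -> measurable A.
Proof. by move=> oA; apply: sub_sigma_algebra. Qed.

Lemma closed_measurableSM (A : set SM) : closed A -> measurable A.
Proof.
move=> cA; rewrite -[A]setCK; apply: measurableC; apply: open_measurableSM.
by rewrite openC.
Qed.

Definition bump_fun (phi : SM -> R) : Prop :=
  locally_polyflat phi /\ exists2 K : set SM, compact K & forall x, ~ K x -> phi x = 0.

Lemma bump_funM phi psi : bump_fun phi -> bump_fun psi ->
  bump_fun (fun x => phi x * psi x).
Proof.
move=> [lphi [K cK Kphi]] [lpsi _]; split; first exact: locally_polyflatM.
by exists K => // x Kx; rewrite Kphi// mul0r.
Qed.

Lemma bump_fun_rtrans k phi : bump_fun phi -> bump_fun (phi \o rtrans k).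
Proof.
move=> [lphi [K cK Kphi]]; split; first exact: locally_polyflat_rtrans.
exists (rtrans k^-1%g @` K).
  apply: continuous_compact => //.
  by apply: continuous_subspaceT; exact: continuous_rtrans.
move=> x nx; apply: Kphi => Kx; apply: nx.
by exists (rtrans k x) => //; rewrite rtransK.
Qed.

Lemma bump_fun_test phi : bump_fun phi -> test_SM (fun x => (phi x)%:C).
Proof.
move=> [lphi [K cK Kphi]]; split; last by move=> n; exact: smooth_locally_polyflat.
by exists K => // x /Kphi ->.
Qed.

(** The sets on which bump functions detect integrals. They contain a base of the
    topology and are closed under intersections. *)
Definition bumpable (A : set SM) : Prop :=
  [/\ open A, (vol A < +oo)%E & exists phi : nat -> SM -> R,
    [/\ forall n, bump_fun (phi n), forall n x, 0 <= phi n x <= \1_A x &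
        forall x, phi n x @[n --> \oo] --> (\1_A x : R)]].

Lemma bumpable0 : bumpable set0.
Proof.
split; [exact: open0|by rewrite measure0 ltry|].
exists (fun _ _ => 0); split.
- move=> _; split.
    by move=> g; exists (fun=> 0); [exact: polyflat_cst|near=> h].
  by exists set0; [exact: compact0|].
- by move=> _ x; rewrite indic0 lexx.
- by move=> x; rewrite indic0; exact: cvg_cst.
Unshelve. all: by end_near.
Qed.

Lemma bumpableI A B : bumpable A -> bumpable B -> bumpable (A `&` B).
Proof.
move=> [oA vA [phi [bphi phiA phi1]]] [oB vB [psi [bpsi psiB psi1]]]; split.
- exact: openI.
- apply: le_lt_trans vA; apply: le_measure; rewrite ?inE.
  + by apply: measurableI; exact: open_measurableSM.
  + exact: open_measurableSM.
  + exact: subIsetl.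
- exists (fun n x => phi n x * psi n x); split.
  + by move=> n; exact: bump_funM.
  + move=> n x; have /andP[a0 a1] := phiA n x; have /andP[b0 b1] := psiB n x.
    by rewrite mulr_ge0//= indicI ler_pM.
  + by move=> x; rewrite indicI; exact: cvgM (phi1 x) (psi1 x).
Qed.

(** Steeper and steeper flat steps of [ball_fun q r] tend to the indicator
    function of the ball; on a wandering ball they descend to the quotient. *)
Lemma bumpable_ball q r : 0 <= r -> wandering Gamma (cball q r) ->
  bumpable (pi @` oball q r).
Proof.
move=> r0 wS; have opb : open (pi @` oball q r) by apply: open_piSM; exact: open_oball.
have cK : compact (pi @` cball q r).
  apply: continuous_compact; last exact: compact_cball.
  by apply: continuous_subspaceT; exact: continuous_piSM.
have sub : pi @` oball q r `<=` pi @` cball q r.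
  by apply: image_subset => g; exact: ltW.
have [_ vK _] := vol_inv.
split => //.
  apply: (le_lt_trans _ (vK _ cK)); apply: le_measure; rewrite ?inE//.
    exact: open_measurableSM.
  by apply: closed_measurableSM; apply: closed_pi_wandering => //; exact: closed_cball.
pose F n (g : G) := flat 1 (n%:R * ball_fun q r g).
have F0 n g : F n g != 0 -> oball q r g.
  move=> Fg; rewrite /oball /= ltNge; apply/negP => bg.
  by move/eqP: Fg; apply; rewrite /F flat_le0// mulr_ge0_le0.
have pF n : polyflat (F n).
  apply: polyflat_flat; apply: polyflatM; first exact: polyflat_cst.
  exact: polyflat_ball_fun.
have FS n g : F n g != 0 -> cball q r g by move=> /F0; exact: ltW.
have /choice[phi phiP] : forall n, exists phi : SM -> R, [/\ locally_polyflat phi,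
    forall g, cball q r g -> phi (pi g) = F n g &
    forall x, phi x != 0 -> (pi @` cball q r) x].
  by move=> n; apply: (exists_periodization wS (pF n)) => g; exact: FS.
have phi0 n x : ~ (pi @` cball q r) x -> phi n x = 0.
  by have [_ _ h] := phiP n; move=> nx; apply/eqP/negPn/negP => /h.
exists phi; split.
- move=> n; split; first by have [] := phiP n.
  by exists (pi @` cball q r) => // x; exact: phi0.
- move=> n x; have [[g bg <-]|nx] := pselect ((pi @` cball q r) x); last first.
    by rewrite phi0// lexx indicE ler0n.
  have [_ -> // _] := phiP n.
  have /andP[F00 F1] : 0 <= F n g <= 1 := flat1_itv (n%:R * ball_fun q r g).
  rewrite F00 /=; have [/eqP ->|/F0 Fg] := boolP (F n g == 0).
    by rewrite indicE ler0n.
  by rewrite indicE mem_set//; exists g.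
- move=> x; have [[g bg <-]|nx] := pselect ((pi @` cball q r) x); last first.
    under eq_cvg do rewrite phi0//.
    rewrite indicE memNset; first exact: cvg_cst.
    by move=> /sub.
  rewrite (_ : (fun n => _) = fun n => F n g); last first.
    by apply/funext => n; have [_ -> // _] := phiP n.
  rewrite (_ : \1_ _ _ = ((0 < ball_fun q r g)%R%:R : R)); first exact: cvg_flat1.
  rewrite indicE; congr (_%:R); congr nat_of_bool.
  apply/idP/idP => [/set_mem[h bh /esym/piSM_eqP[k kG gE]]|bg']; last first.
    by apply: mem_set; exists g.
  have [N hN NS] := wS g; have Nh := nbhs_singleton hN.
  have k1 : k = 1%g.
    by apply: (NS _ _ g g) => //; rewrite ?gpred1// -?gE ?mul1g//; exact: ltW.
  by rewrite k1 mul1g in gE; rewrite -gE.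
Qed.

(** The images of the rational balls that are small enough to wander. *)
Lemma countable_base : exists E : nat -> set SM, (forall n, bumpable (E n)) /\
  forall O x, open O -> O x -> exists2 n, E n x & E n `<=` O.
Proof.
pose T : Type := ('M[rat]_2 * rat)%type.
pose small (p : T) := 0 <= ratr p.2 :> R /\
  wandering Gamma (cball (map_mx ratr p.1) (ratr p.2) : set G).
pose E n := if unpickle n is Some p then
  if `[< small p >] then pi @` oball (map_mx ratr p.1) (ratr p.2) else set0
  else set0.
exists E; split.
  move=> n; rewrite /E; case E0: (unpickle n) => [p|]; last exact: bumpable0.
  by case: asboolP => [sm|_]; [case: sm => r0 wS; exact: bumpable_ball|exact: bumpable0].
move=> O x oO Ox; have [g gx] := piSM_surj x; rewrite gx in Ox *.
have [S gS wS] := nbhs_wandering g Gamma_discrete.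
have gO : nbhs g (pi @^-1` O).
  by apply/nbhs_SME; apply: open_nbhs_nbhs.
have [q [r [r0 bg bU]]] := rational_ball (filterI gS gO).
have sm : small (q, r).
  by split=> //; apply: sub_wandering wS => h /bU[].
exists (pickle (q, r)); rewrite /E pickleK asboolT//=.
  by exists g.
by move=> _ [h bh <-]; have [] := bU h (ltW bh).
Qed.

End bumpable.

Section pi_system.
Context d (T : measurableType d) (R : realType) (mu : {measure set T -> \bar R}).
Local Open Scope ereal_scope.

(** The sets over which [v] integrates to zero form a Dynkin class. *)
Lemma ae_eq0_pi_system (G : set (set T)) (D : set T) (v : T -> R) :
  measurable = <<s G >> -> setI_closed G -> G D ->
  mu.-integrable D (EFin \o v) ->
  (forall A, G A -> \int[mu]_(x in A) (v x)%:E = 0) ->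
  ae_eq mu D v (cst 0%R).
Proof.
move=> mG GI GD iv v0.
have mD : measurable D by rewrite mG; exact: sub_sigma_algebra.
have ivS S : measurable S -> mu.-integrable (S `&` D) (EFin \o v).
  by move=> mS; apply: integrableS iv => //; exact: measurableI.
suff h S : <<s G >> S -> \int[mu]_(x in S `&` D) (v x)%:E = 0.
  have : ae_eq mu D (EFin \o v) (cst 0).
    apply: integral_ae_eq => // S SD mS.
    rewrite integral0 -[S in LHS](setIidl SD); apply: h; by rewrite -mG.
  by apply: filterS => x vx Dx; have [] := vx Dx.
apply: (dynkin_induction (P := fun S => \int[mu]_(x in S `&` D) (v x)%:E = 0)) => //.
- by rewrite setTI v0.
- by move=> A GA; apply: v0; exact: GI.
- move=> A mA vA.
  have : \int[mu]_(x in D) (v x)%:E = 0 by exact: v0.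
  rewrite [in X in X -> _](_ : D = (A `&` D) `|` (~` A `&` D)); last first.
    by rewrite -setIUl setUCr setTI.
  rewrite integral_setU//; [by rewrite vA add0e|exact: measurableI| | |].
  + by apply: measurableI => //; exact: measurableC.
  + by rewrite -setIUl setUCr setTI; case/integrableP : iv.
  + apply/disj_setPS => x [[Ax _] [nAx _]]; exact: nAx.
- move=> F mF tF vF; rewrite setI_bigcupl integral_bigcup.
  + by rewrite eseries0// => k _ _; exact: vF.
  + by apply: trivIset_setIr.
  + by move=> k; exact: measurableI.
  + by rewrite -setI_bigcupl; apply: ivS; exact: bigcup_measurable.
Qed.

End pi_system.

Section separation.
Variables (R : realType) (Gamma : groupClosed (SL2 R)).
Local Notation SM := (SM Gamma).
Variable vol : {measure set SM -> \bar R}.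
Hypothesis Gamma_discrete : discrete_subgroup Gamma.
Hypothesis vol_inv : invariant_volume vol.

Lemma measurable_bumpable : @measurable _ SM = <<s [set A | bumpable vol A] >>.
Proof.
have [E [bE baseE]] := countable_base Gamma_discrete vol_inv.
apply/seteqP; split.
  apply: smallest_sub; first exact: smallest_sigma_algebra.
  move=> O oO; rewrite (_ : O = \bigcup_(n in [set n | E n `<=` O]) E n).
    rewrite bigcup_mkcond.
    apply: sigma_algebra_bigcup => n.
    case: ifPn => _; last exact: sigma_algebra0.
    by apply: sub_sigma_algebra; exact: bE.
  apply/seteqP; split=> [x Ox|x [n nO Enx]]; last exact: nO.
  by have [n Enx EnO] := baseE O x oO Ox; exists n.
apply: smallest_sub; first exact: sigma_algebra_measurable.
by move=> A [oA _ _]; exact: open_measurableSM.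
Qed.

Lemma continuous_measurableSM (v : SM -> R) : continuous v -> measurable_fun setT v.
Proof.
move=> /continuousP cv; apply: (measurability _ (measurable_realfun.RGenOpens.measurableE R)).
move=> _ [_ [a [b ->] <-]]; rewrite setTI; apply: open_measurableSM.
exact/cv/interval_open.
Qed.

Definition locint (v : SM -> R) : Prop := measurable_fun setT v /\
  forall A, measurable A -> (vol A < +oo)%E -> vol.-integrable A (EFin \o v).

(** By dominated convergence, the integrals of [v] over the bumpable sets are
    limits of integrals against bump functions, so they vanish; and the bumpable
    sets form a generating pi-system. *)
Lemma bump_separation (v : SM -> R) : locint v ->
  (forall phi, bump_fun phi -> \int[vol]_x (v x * phi x) = 0) ->
  {ae vol, forall x, v x = 0}.
Proof.
move=> [mv iv] v0; have [E [bE baseE]] := countable_base Gamma_discrete vol_inv.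
suff h n : {ae vol, forall x, E n x -> v x = 0}.
  apply: filterS (ae_foralln h) => x vx.
  by have [n Enx _] := baseE setT x openT I; exact: vx Enx.
have bI : setI_closed [set A | bumpable vol A] by move=> A B; exact: bumpableI.
have [oEn vEn _] := bE n.
apply: (ae_eq0_pi_system measurable_bumpable bI (bE n)).
  by apply: iv => //; exact: open_measurableSM.
move=> A [oA vA [phi [bphi phiA phi1]]].
have mA := open_measurableSM oA.
have iA := iv _ mA vA.
have mphi k : measurable_fun setT (phi k).
  by apply: continuous_measurableSM; apply: continuous_locally_polyflat; have [] := bphi k.
have phi0 k x : ~ A x -> phi k x = 0.
  move=> nAx; have := phiA k x; rewrite indicE memNset// => /andP[a b].
  by apply/le_anti; rewrite a b.
have ivphi k : vol.-integrable A (EFin \o (fun x => v x * phi k x)).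
  apply: (le_integrable mA _ _ iA).
    apply/measurable_EFinP; apply: measurable_funS (measurable_funM mv (mphi k)) => //.
  move=> x Ax /=; rewrite lee_fin normrM ler_piMr//.
  have /andP[a b] := phiA k x; rewrite ger0_norm// (le_trans b)// indicE lern1 leq_b1.
have intphi k : (\int[vol]_(x in A) (v x * phi k x)%:E = 0)%E.
  have := v0 _ (bphi k); rewrite /Rintegral.
  rewrite (_ : \int[vol]_x (v x * phi k x)%:E = \int[vol]_(x in A) (v x * phi k x)%:E)%E.
    move=> h; have := integrable_fin_num mA (ivphi k).
    by move/fineK => <-; rewrite h.
  rewrite [RHS]integral_mkcond; apply: eq_integral => x _; rewrite patchE.
  by case: ifPn => // /negP nAx; rewrite phi0 ?mulr0// => Ax; apply: nAx; exact: mem_set.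
have [|||||_ _] := @dominated_convergence _ _ _ vol A mA (fun k x => (v x * phi k x)%:E)
  (fun x => (v x)%:E) (fun x => `|(v x)%:E|%E).
- by move=> k; case/integrableP : (ivphi k).
- by case/integrableP : iA.
- apply/aeW => x Ax; apply: cvg_EFin; first by near=> k.
  have := cvgM (@cvg_cst _ (v x) _ \oo _) (phi1 x).
  by rewrite indicE mem_set// mulr1; exact.
- exact: integrable_abse.
- apply/aeW => x k Ax /=; rewrite lee_fin normrM ler_piMr//.
  have /andP[a b] := phiA k x; rewrite ger0_norm// (le_trans b)// indicE lern1 leq_b1.
rewrite (_ : [sequence _]_n = fun=> 0%E); last by apply/funext => k; exact: intphi.
move=> c.
exact: (cvg_unique _ c (cvg_cst _)).
Unshelve. all: by end_near.
Qed.

End separation.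

(** * Continuity of translation in measure, and the Mautner phenomenon *)

Section translation.
Variables (R : realType) (Gamma : groupClosed (SL2 R)).
Local Notation G := (SL2 R).
Local Notation SM := (SM Gamma).
Variable vol : {measure set SM -> \bar R}.
Hypothesis Gamma_discrete : discrete_subgroup Gamma.
Hypothesis vol_inv : invariant_volume vol.

Definition trset (g : G) (A : set SM) : set SM := rtrans g @^-1` A.

Lemma trsetM g h A : trset (g * h)%g A = trset g (trset h A).
Proof. by apply/seteqP; split=> x; rewrite /trset /= rtransM. Qed.

Lemma trset1 A : trset 1%g A = A.
Proof. by apply/seteqP; split=> x; rewrite /trset /= rtrans1. Qed.

Lemma measurable_rtrans g : measurable_fun setT (rtrans g : SM -> SM).
Proof.
apply: (measurability (@open SM)) => //.
move=> _ [U oU <-]; rewrite setTI; apply: open_measurableSM.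
by move/continuousP: (@continuous_rtrans _ Gamma g); apply.
Qed.

Lemma measurable_trset g A : measurable A -> measurable (trset g A).
Proof. by move=> mA; rewrite -[trset g A]setTI; exact: measurable_rtrans. Qed.

Lemma vol_trset g A : measurable A -> vol (trset g A) = vol A.
Proof. by case: vol_inv => h _ _; exact: h. Qed.

Lemma trsetD g A B : trset g (A `\` B) = trset g A `\` trset g B.
Proof. by []. Qed.

(** Both sides are the volume of [A] minus that of its intersection with the
    translate. *)
Lemma vol_trsetD_sym g A : measurable A -> (vol A < +oo)%E ->
  vol (trset g A `\` A) = vol (A `\` trset g A).
Proof.
move=> mA vA; have mB := measurable_trset g mA.
have vB : (vol (trset g A) < +oo)%E by rewrite vol_trset.
have e1 : (vol (trset g A `\` A) = vol (trset g A) - vol (trset g A `&` A))%E.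
  exact: measureD.
have e2 : (vol (A `\` trset g A) = vol A - vol (A `&` trset g A))%E.
  exact: measureD.
by rewrite e1 e2 vol_trset// setIC.
Qed.

Variable h : nat -> G.
Hypothesis h1 : h n @[n --> \oo] --> (1%g : G).

(** The translates of [A] by [h n] tend to [A] in measure; by [vol_trsetD_sym],
    it is enough to control one half of the symmetric differences. *)
Definition tcont (A : set SM) : Prop := forall e : R, 0 < e ->
  \forall n \near \oo, (vol (A `\` trset (h n) A) < e%:E)%E.

(** A point of the open set [O] is moved out of [O] by finitely many of the
    [h n] only. *)
Lemma tcont_open (O : set SM) : open O -> (vol O < +oo)%E -> tcont O.
Proof.
move=> oO vO e e0; have mO := open_measurableSM oO.
pose B n := \bigcup_(m in [set m | (n <= m)%N]) (O `\` trset (h m) O).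
have mB n : measurable (B n).
  apply: bigcup_measurable => m _; apply: measurableD => //.
  exact: measurable_trset.
have BO n : B n `<=` O by move=> x [m _ []].
have B0 : \bigcap_n B n = set0.
  apply/seteqP; split=> // x Bx; have Ox : O x by exact: (BO 0%N) (Bx 0%N I).
  have : rtrans (h n) x @[n --> \oo] --> x.
    rewrite -[X in _ --> X]rtrans1.
    exact: (cvg_comp _ _ h1 (@continuous_orbit _ _ x 1%g)).
  move=> /(_ O (open_nbhs_nbhs (conj oO Ox)))[n _ nO].
  by have [m /= nm [_]] := Bx n I; apply; exact: nO.
have vB : (vol (B 0%N) < +oo)%E.
  by apply: le_lt_trans vO; apply: le_measure; rewrite ?inE.
have niB : nonincreasing_seq B.
  move=> m n mn; apply/subsetPset => x [k /= nk Bk]; exists k => //=.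
  exact: leq_trans nk.
have := nonincreasing_cvg_mu vB mB (bigcapT_measurable mB) niB.
rewrite B0 measure0.
move=> /fine_cvgP[fB cB]; near=> n.
apply: (@le_lt_trans _ _ (vol (B n))).
  apply: le_measure; rewrite ?inE//; first apply: measurableD => //.
    exact: measurable_trset.
  by move=> x Ox; exists n => //=.
rewrite -[vol (B n)]fineK; last by near: n.
rewrite lte_fin; near: n.
by move/cvgrPdist_lt : cB => /(_ e e0); apply: filterS => n /=; rewrite sub0r normrN => /ltr_normlW.
Unshelve. all: by end_near.
Qed.

Lemma tcont0 : tcont set0.
Proof. by move=> e e0; near=> n; rewrite set0D measure0 lte_fin. Unshelve. all: by end_near. Qed.

Lemma tcontU A B : measurable A -> measurable B -> tcont A -> tcont B -> tcont (A `|` B).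
Proof.
move=> mA mB tA tB e e0; have e20 : 0 < e / 2 by rewrite divr_gt0.
have mt n C : measurable C -> measurable (C `\` trset (h n) C).
  by move=> mC; apply: measurableD => //; exact: measurable_trset.
near=> n.
apply: (@le_lt_trans _ _ (vol ((A `\` trset (h n) A) `|` (B `\` trset (h n) B)))).
  apply: le_measure; rewrite ?inE.
  - by apply: mt; exact: measurableU.
  - by apply: measurableU; exact: mt.
  - move=> x [[Ax|Bx] nx]; [left|right]; split=> // tx; apply: nx; by [left|right].
apply: (le_lt_trans (measureU2 _ _ _)); [exact: mt|exact: mt|].
rewrite [e]splitr EFinD; apply: lteD; near: n; [exact: tA|exact: tB].
Unshelve. all: by end_near.
Qed.

Lemma tcont_approx A : measurable A ->
  (forall e : R, 0 < e -> exists B, [/\ measurable B, B `<=` A, tcont B &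
     (vol (A `\` B) < e%:E)%E]) -> tcont A.
Proof.
move=> mA aA e e0; have e20 : 0 < e / 2 by rewrite divr_gt0.
have [B [mB BA tB vAB]] := aA _ e20.
have mt n C : measurable C -> measurable (C `\` trset (h n) C).
  by move=> mC; apply: measurableD => //; exact: measurable_trset.
near=> n.
apply: (@le_lt_trans _ _ (vol ((A `\` B) `|` (B `\` trset (h n) B)))).
  apply: le_measure; rewrite ?inE.
  - exact: mt.
  - by apply: measurableU; [exact: measurableD|exact: mt].
  - move=> x [Ax nx]; have [Bx|nBx] := pselect (B x); [right|left]; split=> //.
    by move=> tx; apply: nx; exact: BA.
apply: (le_lt_trans (measureU2 _ _ _)); [exact: measurableD|exact: mt|].
rewrite [e]splitr EFinD; apply: lteD => //; near: n; exact: tB.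
Unshelve. all: by end_near.
Qed.

(** By continuity of the volume, finitely many of the [F n] cover [A] up to a
    set of small volume. *)
Lemma tcont_bigcup A (F : (set SM)^nat) : measurable A -> (vol A < +oo)%E ->
  (forall n, measurable (F n)) -> A `<=` \bigcup_n F n ->
  (forall n, tcont (A `&` F n)) -> tcont A.
Proof.
move=> mA vA mF AF tF; apply: tcont_approx => // e e0.
pose U n := \big[setU/set0]_(i < n) F i.
have mU n : measurable (U n) by exact: bigsetU_measurable.
pose B n := A `\` U n.
have mB n : measurable (B n) by exact: measurableD.
have vB : (vol (B 0%N) < +oo)%E.
  by apply: le_lt_trans vA; apply: le_measure; rewrite ?inE//; exact: subDsetl.
have niB : nonincreasing_seq B.
  move=> m n mn; apply/subsetPset => x [Ax nU]; split=> // Um; apply: nU.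
  by move: Um; exact: (@subset_bigsetU _ F m n mn).
have := nonincreasing_cvg_mu vB mB (bigcapT_measurable mB) niB.
have -> : \bigcap_n B n = set0.
  apply/seteqP; split=> // x Bx; have [Ax _] := Bx 0%N I.
  have [n _ Fnx] := AF _ Ax; have [_] := Bx n.+1 I; apply.
  by rewrite /U big_ord_recr /=; right.
rewrite measure0.
move=> /fine_cvgP[fB cB].
have : \forall n \near \oo, (vol (A `\` U n) < e%:E)%E.
  near=> n; rewrite -[vol _]fineK; last by near: n.
  rewrite lte_fin; near: n.
  by move/cvgrPdist_lt : cB => /(_ e e0); apply: filterS => n /=; rewrite sub0r normrN => /ltr_normlW.
case=> n _ /(_ n (leqnn n)) /= vn.
exists (A `&` U n); split; [exact: measurableI|exact: subIsetl| |by rewrite setDIr setDv set0U].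
have -> : A `&` U n = \big[setU/set0]_(i < n) (A `&` F i).
  by rewrite /U big_distrr.
clear vn; elim: n => [|n IH]; first by rewrite big_ord0; exact: tcont0.
rewrite big_ord_recr /=; apply: tcontU => //.
- by apply: bigsetU_measurable => i _; exact: measurableI.
- exact: measurableI.
Unshelve. all: by end_near.
Qed.

(** The sets [A] with this property form a Dynkin class that contains the open
    sets. *)
Lemma tcont_setI (E A : set SM) : open E -> (vol E < +oo)%E -> measurable A ->
  tcont (A `&` E).
Proof.
move=> oE vE; have mE := open_measurableSM oE.
have vAE A' : measurable A' -> (vol (A' `&` E) < +oo)%E.
  move=> mA; apply: le_lt_trans vE; apply: le_measure; rewrite ?inE//.
  exact: measurableI.
move: A; apply: (dynkin_induction (G := @open SM)) => //.
- by move=> A B; exact: openI.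
- by rewrite setTI; exact: tcont_open.
- move=> O oO; apply: tcont_open; first exact: openI.
  by apply: vAE; exact: open_measurableSM.
- move=> A mA tA e e0; have e20 : 0 < e / 2 by rewrite divr_gt0.
  have mAE : measurable (A `&` E) by exact: measurableI.
  have tA' : \forall n \near \oo,
      (vol (trset (h n) (A `&` E) `\` (A `&` E)) < (e / 2)%:E)%E.
    by move: (tA _ e20); apply: filterS => n; rewrite vol_trsetD_sym//; exact: vAE.
  near=> n.
  have mt C : measurable C -> measurable (C `\` trset (h n) C).
    by move=> mC; apply: measurableD => //; exact: measurable_trset.
  have mt' : measurable (trset (h n) (A `&` E) `\` (A `&` E)).
    by apply: measurableD => //; exact: measurable_trset.
  apply: (@le_lt_trans _ _ (vol ((E `\` trset (h n) E) `|`
     (trset (h n) (A `&` E) `\` (A `&` E))))).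
    apply: le_measure; rewrite ?inE.
    - by apply: mt; apply: measurableI => //; exact: measurableC.
    - by apply: measurableU => //; exact: mt.
    - move=> x [[nAx Ex] nx]; have [tE|ntE] := pselect (trset (h n) E x).
        right; split; last by case.
        split=> //; apply: contrapT => nA; apply: nx; split=> //.
      by left.
  apply: (le_lt_trans (measureU2 _ _ _)); [exact: mt|exact: mt'|].
  rewrite [e]splitr EFinD; apply: lteD; near: n; [exact: tcont_open|exact: tA'].
- move=> F mF tF IH; apply: (@tcont_bigcup _ F) => //.
  + by apply: measurableI => //; exact: bigcup_measurable.
  + by apply: vAE; exact: bigcup_measurable.
  + move=> n; rewrite (_ : \bigcup_k F k `&` E `&` F n = F n `&` E) //.
    apply/seteqP; split=> x; first by case=> [[_ ?]].
    by case=> Fx Ex; split=> //; split=> //; exists n.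
Unshelve. all: by end_near.
Qed.

(** A countable cover by open sets of finite volume reduces the claim to
    [tcont_setI]. *)
Lemma trset_continuous A : measurable A -> (vol A < +oo)%E -> tcont A.
Proof.
move=> mA vA; have [E [bE baseE]] := countable_base Gamma_discrete vol_inv.
apply: (@tcont_bigcup _ E) => //.
- by move=> n; have [oE _ _] := bE n; exact: open_measurableSM.
- by move=> x _; have [n Enx _] := baseE setT x openT I; exists n.
- by move=> n; have [oE vE _] := bE n; exact: tcont_setI.
Qed.

End translation.

Section unipotent.
Variable R : realType.
Local Notation G := (SL2 R).

Lemma expUD (s t : R) : (expU s * expU t)%g = expU (s + t).
Proof.
apply/val_inj/matrixP; apply: ord2E; apply: ord2E; rewrite SL2_mulE !mxE /=; ring.
Qed.

Lemma expU0 : expU 0 = 1%g :> G.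
Proof. by apply/val_inj/matrixP; apply: ord2E; apply: ord2E; rewrite !mxE. Qed.

Lemma expUV (t : R) : (expU t)^-1%g = expU (- t).
Proof. by rewrite -[LHS]mulg1 -expU0 -(subrr t) -expUD mulKg. Qed.

Fact expL_subproof (t : R) : \det (mx22 1 0 t 1) == 1.
Proof. by rewrite det_mx22 !mxE /= mulr1 mul0r subr0. Qed.
Definition expL (t : R) : G := Sub (mx22 1 0 t 1) (expL_subproof t).

Lemma cvg_expL (y : nat -> R) :
  y n @[n --> \oo] --> (0 : R) -> expL (y n) @[n --> \oo] --> (1%g : G).
Proof.
move=> y0; apply: cvg_SL2; apply: ord2E; apply: ord2E; rewrite !mxE /=;
  (under eq_cvg do rewrite mxE /=) => //; exact: cvg_cst.
Qed.

(** Conjugation by a large unipotent element takes a lower triangular element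
    that tends to 1 to a fixed upper triangular one: with y = 1/m,
    exp(mU) (1, 0; c y^2, 1) exp(-mU) tends to exp(-cU). *)
Lemma cvg_conj_expL (c : R) (y : nat -> R) : (forall n, y n != 0) ->
  y n @[n --> \oo] --> (0 : R) ->
  (expU c * (expU (y n)^-1 * expL (c * y n ^+ 2) * expU (- (y n)^-1)))%g
     @[n --> \oo] --> (1%g : G).
Proof.
move=> yn0 y0.
have cM (a : R) : a * y n @[n --> \oo] --> (0 : R).
  by have := cvgM (@cvg_cst _ a _ \oo _) y0; rewrite mulr0; exact.
have cM2 (a : R) : a * y n ^+ 2 @[n --> \oo] --> (0 : R).
  under eq_cvg do rewrite expr2 mulrA.
  by have := cvgM (cM a) y0; rewrite mulr0; exact.
have E n i j : val (expU c * (expU (y n)^-1 * expL (c * y n ^+ 2) * expU (- (y n)^-1)))%g i j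
  = mx22 (1 + (c * y n + c ^+ 2 * y n ^+ 2)) ((- c ^+ 2) * y n) (c * y n ^+ 2) (1 - c * y n) i j.
  move: i j; apply: ord2E; apply: ord2E; rewrite !SL2_mulE !mxE /=; by field.
have I i j : val (1%g : G) i j = (i == j)%:R by rewrite mxE.
apply: cvg_SL2; apply: ord2E; apply: ord2E; rewrite I; under eq_cvg do rewrite E mxE /=.
- have := cvgD (@cvg_cst _ (1 : R) _ \oo _) (cvgD (cM c) (cM2 (c ^+ 2))).
  by rewrite !addr0; exact.
- exact: cM.
- exact: cM2.
- have := cvgB (@cvg_cst _ (1 : R) _ \oo _) (cM c).
  by rewrite subr0; exact.
Qed.

End unipotent.

Section mautner.
Variables (R : realType) (Gamma : groupClosed (SL2 R)).
Local Notation SM := (SM Gamma).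
Variable vol : {measure set SM -> \bar R}.
Hypothesis Gamma_discrete : discrete_subgroup Gamma.
Hypothesis vol_inv : invariant_volume vol.
Implicit Types A B : set SM.

Let mt g A : measurable A -> measurable (trset g A).
Proof. exact: measurable_trset. Qed.

Lemma vol_setD_trset g A B : measurable A -> measurable B ->
  vol (trset g A `\` trset g B) = vol (A `\` B).
Proof. by move=> mA mB; rewrite -trsetD vol_trset//; exact: measurableD. Qed.

Lemma vol_setD_trans A B C : measurable A -> measurable B -> measurable C ->
  (vol (A `\` C) <= vol (A `\` B) + vol (B `\` C))%E.
Proof.
move=> mA mB mC.
apply: (le_trans _ (measureU2 _ _ _)); [|exact: measurableD|exact: measurableD].
apply: le_measure; rewrite ?inE; [exact: measurableD|apply: measurableU; exact: measurableD|].
by move=> x [Ax nCx]; have [Bx|nBx] := pselect (B x); [right|left].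
Qed.

Lemma vol_trsetV g A : measurable A -> (vol A < +oo)%E ->
  vol (A `\` trset g A) = 0%E -> vol (A `\` trset g^-1%g A) = 0%E.
Proof.
move=> mA vA h; rewrite -(vol_setD_trset g)//; last exact: mt.
by rewrite -trsetM mulgV trset1 vol_trsetD_sym.
Qed.

Lemma vol_trset_expU_iter (T : R) A n : measurable A ->
  vol (A `\` trset (expU T) A) = 0%E -> vol (A `\` trset (expU (n%:R * T)) A) = 0%E.
Proof.
move=> mA h; elim: n => [|n IH]; first by rewrite mul0r expU0 trset1 setDv measure0.
apply/eqP; rewrite -measure_le0.
apply: (le_trans (vol_setD_trans mA (mt (expU (n%:R * T)) mA) (mt _ mA))).
rewrite IH add0e -nat1r mulrDl mul1r addrC -expUD trsetM vol_setD_trset ?h//.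
exact: mt.
Qed.

(** Let g = exp(mU), where m is a large multiple of T, so that A is g-invariant,
    and let l be the lower triangular element of [cvg_conj_expL] for y = 1/m.
    As l tends to 1, A is almost l-invariant, hence almost invariant under
    g l g^-1 = exp(cU) k, where k tends to 1. *)
Theorem mautner_set (T c : R) A : 0 < T -> measurable A -> (vol A < +oo)%E ->
  vol (A `\` trset (expU T) A) = 0%E -> vol (A `\` trset (expU c) A) = 0%E.
Proof.
move=> T0 mA vA invA.
pose y n : R := (n.+1%:R * T)^-1.
have yn0 n : y n != 0 by rewrite invr_eq0 mulf_neq0// gt_eqF.
have y0 : y n @[n --> \oo] --> (0 : R).
  rewrite /y; under eq_cvg do rewrite invfM.
  by have := cvgM (@cvg_harmonic R) (@cvg_cst _ (T^-1) _ \oo _); rewrite mul0r; exact.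
have c2 : (- c) * y n ^+ 2 @[n --> \oo] --> (0 : R).
  under eq_cvg do rewrite expr2 mulrA.
  by have := cvgM (cvgM (@cvg_cst _ (- c) _ \oo _) y0) y0; rewrite mulr0; exact.
have t1 := trset_continuous Gamma_discrete vol_inv (cvg_expL c2) mA vA.
have t2 := trset_continuous Gamma_discrete vol_inv (cvg_conj_expL (- c) yn0 y0) mA vA.
apply/eqP; rewrite -measure_le0; apply/lee_addgt0Pr => e e0; rewrite add0e.
have e20 : 0 < e / 2 by rewrite divr_gt0.
suff : \forall n \near \oo, (vol (A `\` trset (expU c) A) <= e%:E)%E.
  by case=> n _ /(_ n (leqnn n)).
have {t1 t2} : \forall n \near \oo,
    (vol (A `\` trset (expL ((- c) * y n ^+ 2)) A) < (e / 2)%:E)%E /\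
    (vol (A `\` trset (expU (- c) * (expU (y n)^-1 * expL ((- c) * y n ^+ 2) *
       expU (- (y n)^-1)))%g A) < (e / 2)%:E)%E.
  by near=> n; split; near: n; [exact: t1|exact: t2].
apply: filterS => n [/ltW t1 /ltW t2].
set U := expU (y n)^-1 in t2 *; set l := expL ((- c) * y n ^+ 2) in t1 t2 *.
pose k := (expU (- c) * (U * l * expU (- (y n)^-1)))%g.
have kE : (U * l * U^-1 = expU c * k)%g.
  by rewrite /k expUV mulgA expUD subrr expU0 mul1g.
have vU : vol (A `\` trset U A) = 0%E.
  by rewrite /U /y invrK; exact: vol_trset_expU_iter.
have vUV := vol_trsetV mA vA vU.
apply: (le_trans (vol_setD_trans mA (mt U mA) (mt _ mA))); rewrite vU add0e.
apply: (le_trans (vol_setD_trans (mt U mA) (mt U (mt l mA)) (mt _ mA))).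
rewrite vol_setD_trset//; last exact: mt.
rewrite [e]splitr EFinD; apply: leeD; first exact: t1.
have E : trset (expU c) (trset k A) = trset U (trset l (trset U^-1%g A)).
  by rewrite -[LHS]trsetM -kE !trsetM.
have mck := mt (expU c) (mt k mA).
apply: (le_trans (vol_setD_trans (mt U (mt l mA)) mck (mt _ mA))).
have -> : vol (trset U (trset l A) `\` trset (expU c) (trset k A)) = 0%E.
  have mV := mt U^-1%g mA.
  by rewrite E vol_setD_trset ?vol_setD_trset//; exact: mt.
rewrite add0e vol_setD_trset//; last exact: mt.
by rewrite vol_trsetD_sym.
Unshelve. all: by end_near.
Qed.

(** The superlevel sets of [v] and [- v] at positive rational heights are
    invariant sets of finite volume, and together they determine [v]. *)
Theorem mautner (T c : R) (v : SM -> R) : 0 < T -> measurable_fun setT v ->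
  (forall a, 0 < a -> (vol [set x | (a < `|v x|)%R] < +oo)%E) ->
  {ae vol, forall x, v (phiU T x) = v x} ->
  {ae vol, forall x, v (phiU c x) = v x}.
Proof.
move=> T0 mv vv vT.
have main (w : SM -> R) : measurable_fun setT w ->
    (forall x, `|w x| = `|v x|) -> {ae vol, forall x, w (phiU T x) = w x} ->
    {ae vol, forall x, forall a : rat, 0 < ratr a :> R ->
       (ratr a < w x) = (ratr a < w (phiU c x))}.
  move=> mw wv wT.
  suff h (a : rat) : {ae vol, forall x, 0 < ratr a :> R ->
      (ratr a < w x) = (ratr a < w (phiU c x))}.
    have := ae_foralln (fun n => h (odflt 0 (unpickle n))).
    by apply: filterS => x hx a; have := hx (pickle a); rewrite pickleK.
  have [a0|a0] := ltP 0 (ratr a : R); last by apply/aeW.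
  pose A : set SM := [set x | ratr a < w x].
  have mA : measurable A.
    have -> : A = setT `&` (w @^-1` `]ratr a, +oo[).
      by rewrite setTI; apply/seteqP; split=> x /=; rewrite in_itv /= andbT.
    exact: mw.
  have mabs : measurable [set x | (ratr a < `|v x|)%R].
    have -> : [set x | (ratr a < `|v x|)%R] =
        setT `&` ((fun x => `|v x|) @^-1` `]ratr a, +oo[).
      by rewrite setTI; apply/seteqP; split=> x /=; rewrite in_itv /= andbT.
    by apply: (measurableT_comp (@normr_measurable R setT)).
  have vA : (vol A < +oo)%E.
    apply: le_lt_trans (vv _ a0); apply: le_measure; rewrite ?inE//.
    by move=> x /= ax; rewrite -wv (lt_le_trans ax)// ler_norm.
  have inv : vol (A `\` trset (expU T) A) = 0%E.
    have mD : measurable (A `\` trset (expU T) A) by apply: measurableD => //; exact: mt.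
    have [N [mN N0 wN]] := wT.
    apply: (subset_measure0 mD mN _ N0) => x [Ax nTx]; apply: wN => /= e; apply: nTx.
    by rewrite /trset /A /= -[rtrans _ x]/(phiU T x) e.
  have c0 := mautner_set c T0 mA vA inv.
  have c1 : vol (trset (expU c) A `\` A) = 0%E by rewrite vol_trsetD_sym.
  have mD1 : measurable (A `\` trset (expU c) A) by apply: measurableD => //; exact: mt.
  have mD2 : measurable (trset (expU c) A `\` A) by apply: measurableD => //; exact: mt.
  exists ((A `\` trset (expU c) A) `|` (trset (expU c) A `\` A)); split.
  - exact: measurableU.
  - exact: etrans (measureU0 mD1 mD2 c1) c0.
  - move=> x /= nx; apply: contrapT => nD; apply: nx => _; apply/idP/idP => h;
      apply: contrapT => nh; apply: nD; by [left|right].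
have main1 := main v mv (fun=> erefl) vT.
have main2 := main (fun x => - v x).
have {main2} : {ae vol, forall x, forall a : rat, 0 < ratr a :> R ->
     (ratr a < - v x) = (ratr a < - v (phiU c x))}.
  apply: main2; [exact: measurable_funN|by move=> x; rewrite normrN|].
  by apply: filterS vT => x ->.
apply: filterS2 main1 => x m1 m2.
have key (p q : R) : (forall a : rat, 0 < ratr a :> R -> (ratr a < p) = (ratr a < q)) ->
   0 < p -> p <= q.
  move=> pq p0; rewrite leNgt; apply/negP => qp.
  have /rat_in_itvoo[a] : Num.max q 0 < p by rewrite gt_max qp p0.
  rewrite in_itv /= gt_max => /andP[/andP[qa a0] ap].
  by move: ap; rewrite pq// ltNge (ltW qa).
have sym (p q : R) : (forall a : rat, 0 < ratr a :> R -> (ratr a < p) = (ratr a < q)) ->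
   forall a : rat, 0 < ratr a :> R -> (ratr a < q) = (ratr a < p).
  by move=> pq a a0; rewrite pq.
have m1' := sym _ _ m1; have m2' := sym _ _ m2.
apply/eqP; rewrite eq_le; apply/andP; split.
- have [p0|p0] := ltP 0 (v (phiU c x)); first exact: key m1' p0.
  have [q0|q0] := leP 0 (v x); first exact: le_trans q0.
  by rewrite -lerN2; apply: key m2 _; rewrite oppr_gt0.
- have [p0|p0] := ltP 0 (v x); first exact: key m1 p0.
  have [q0|q0] := leP 0 (v (phiU c x)); first exact: le_trans q0.
  by rewrite -lerN2; apply: key m2' _; rewrite oppr_gt0.
Qed.

Lemma ae_rtrans g (P : SM -> Prop) : {ae vol, forall x, P x} ->
  {ae vol, forall x, P (rtrans g x)}.
Proof.
move=> [N [mN N0 PN]]; exists (trset g N); split; [exact: mt|by rewrite vol_trset|].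
by move=> x nP; apply: PN.
Qed.

End mautner.

(** * Integration along a measure-preserving flow *)

Section measure_preserving.
Context d (T : measurableType d) (R : realType) (mu : {measure set T -> \bar R}).
Variable p : T -> T.
Hypothesis mp : measurable_fun setT p.
Hypothesis pp : forall A, measurable A -> mu (p @^-1` A) = mu A.
Local Open Scope ereal_scope.

Lemma ge0_integral_measure_preserving (F : T -> \bar R) : measurable_fun setT F ->
  (forall x, 0 <= F x) -> \int[mu]_x F (p x) = \int[mu]_x F x.
Proof.
move=> mF F0.
transitivity (\int[pushforward mu p]_x F x).
  by rewrite ge0_integral_pushforward// preimage_setT.
by apply: eq_measure_integral => A mA _; exact: pp.
Qed.

Lemma integral_measure_preserving (F : T -> \bar R) : measurable_fun setT F ->
  \int[mu]_x F (p x) = \int[mu]_x F x.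
Proof.
move=> mF; rewrite integralE [RHS]integralE; congr (_ - _).
  by under eq_integral do rewrite (funepos_comp F p) /=;
  rewrite ge0_integral_measure_preserving//; exact: measurable_funepos.
by under eq_integral do rewrite (funeneg_comp F p) /=;
rewrite ge0_integral_measure_preserving//; exact: measurable_funeneg.
Qed.

End measure_preserving.

Section lebesgue_shift.
Variable R : realType.
Local Notation leb := (@lebesgue_measure R).
Local Open Scope ereal_scope.

Lemma lebesgue_measure_shift (a : R) (A : set (measurableTypeR R)) : measurable A ->
  leb ((fun s : measurableTypeR R => (s + a)%R) @^-1` A) = leb A.
Proof.
move=> mA; have ms : measurable_fun setT (fun s : measurableTypeR R => (s + a)%R : measurableTypeR R).
  by apply: measurable_funD.
have ms' : isMeasurableFun _ _ _ _ (fun s : measurableTypeR R => (s + a)%R : measurableTypeR R).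
  by constructor.
pose sh : {mfun _ >-> _} := HB.pack (fun s : measurableTypeR R => (s + a)%R : measurableTypeR R) ms'.
apply/esym; apply: (lebesgue_measure_unique (mu := pushforward leb sh)) => //= _ [[b c]] _ <-.
rewrite /pushforward (_ : _ @^-1` _ = `](b - a)%R, (c - a)%R]%classic).
  rewrite !lebesgue_measure_itv/= !lte_fin ltrD2r; case: ifP => // _.
  by rewrite -!EFinB; congr EFin; ring.
by apply/seteqP; split=> s /=; rewrite !in_itv /= ltrBlDr lerBrDr.
Qed.

Lemma Rintegral_shift (a t : R) (g : measurableTypeR R -> R) : measurable_fun setT g ->
  (\int[leb]_(s in `[0%R, t]) g (s + a) = \int[leb]_(s in `[a, (t + a)%R]) g s)%R.
Proof.
move=> mg; rewrite /Rintegral; congr fine.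
rewrite integral_mkcond [RHS]integral_mkcond.
pose F := (EFin \o g) \_ `[a, (t + a)%R]%classic.
have mF : measurable_fun setT F.
  apply/(measurable_restrictT _ _).1 => //; apply/measurable_EFinP; exact: measurable_funS mg.
have msh : measurable_fun setT (fun s : measurableTypeR R => (s + a)%R : measurableTypeR R).
  by apply: measurable_funD.
have := integral_measure_preserving msh (lebesgue_measure_shift a) mF.
move=> <-; apply: eq_integral => s _; rewrite /F !patchE; congr (if _ then _ else _).
by apply/idP/idP; rewrite !inE /= !in_itv /= => /andP[h1 h2]; apply/andP; split; move: h1 h2; lra.
Qed.

End lebesgue_shift.

Section pairing.
Context d (X : measurableType d) (R : realType).
Variables (mu : {measure set X -> \bar R}) (phi : R -> X -> X).
Implicit Types w psi : X -> R.

Definition sqint w : Prop :=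
  measurable_fun setT w /\ (\int[mu]_x (w x ^+ 2)%:E < +oo)%E.

Definition dominated psi : Prop := measurable_fun setT psi /\
  exists (C : R) E, [/\ measurable E, (mu E < +oo)%E, 0 <= C &
    forall x, `|psi x| <= C * \1_E x].

Definition pairing w psi (s : measurableTypeR R) : R := \int[mu]_x (w (phi s x) * psi x).

Lemma mul_dominated_le (C e a p : R) : 0 <= C -> 0 <= e <= 1 -> `|p| <= C * e ->
  `|a * p| <= C * (e + a ^+ 2).
Proof.
move=> C0 /andP[e0 e1] pC; rewrite normrM; apply: (@le_trans _ _ (`|a| * (C * e))).
  by rewrite ler_wpM2l.
rewrite mulrCA ler_wpM2l// -[a ^+ 2]real_normK ?num_real//.
have := normr_ge0 a; move: (`|a|) => b b0; nra.
Qed.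

Lemma integrable_mul_dominated w psi : sqint w -> dominated psi ->
  mu.-integrable setT (EFin \o (fun x => w x * psi x)).
Proof.
move=> [mw iw] [mpsi [C [E [mE vE C0 psiC]]]].
have iE : mu.-integrable setT (EFin \o (\1_E : X -> R)).
  apply/integrableP; split; first exact/measurable_EFinP.
  by under eq_integral do rewrite /= ger0_norm//; rewrite integral_indic// setIT.
have iw2 : mu.-integrable setT (EFin \o (fun x => w x ^+ 2)).
  apply/integrableP; split; first by apply/measurable_EFinP; exact: measurable_funX.
  by under eq_integral do rewrite /= ger0_norm ?sqr_ge0//.
apply: (@le_integrable _ _ _ mu setT _ _ (EFin \o (fun x => C * (\1_E x + w x ^+ 2)))) => //.
- by apply/measurable_EFinP; exact: measurable_funM.
- move=> x _; rewrite /= lee_fin [leRHS]ger0_norm; last first.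
    by rewrite mulr_ge0// addr_ge0// sqr_ge0.
  by apply: mul_dominated_le => //; rewrite indicE ler0n lern1 leq_b1.
- by have := integrableZl measurableT C (integrableD measurableT iE iw2).
Qed.

End pairing.

Section flow.
Context d (X : measurableType d) (R : realType).
Variable mu : {sigma_finite_measure set X -> \bar R}.
Local Notation leb := (@lebesgue_measure R).
Variable phi : R -> X -> X.
Hypothesis mphi :
  measurable_fun setT (fun q : measurableTypeR R * X => phi q.1 q.2).
Hypothesis phip : forall s A, measurable A -> mu (phi s @^-1` A) = mu A.
Implicit Types (w psi : X -> R) (s t : R).
Local Notation sqint := (sqint mu).
Local Notation dominated := (dominated mu).
Local Notation pairing := (pairing mu phi).

Definition flow_average t w x : R := \int[leb]_(s in `[0, t]) w (phi s x).

Lemma measurable_phi s : measurable_fun setT (phi s).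
Proof.
exact: (measurableT_comp mphi (pair1_measurable (s : measurableTypeR R))).
Qed.

Lemma measurable_orbit w x : measurable_fun setT w ->
  measurable_fun setT (fun s : measurableTypeR R => w (phi s x)).
Proof.
by move=> mw; exact: (measurableT_comp mw (measurableT_comp mphi (pair2_measurable x))).
Qed.

Lemma sqint_phi s w : sqint w -> sqint (w \o phi s).
Proof.
move=> [mw iw]; split; first exact: measurableT_comp mw (measurable_phi s).
rewrite (ge0_integral_measure_preserving (measurable_phi s) (phip s)
  (F := fun x => (w x ^+ 2)%:E)) //.
- by apply/measurable_EFinP; exact: measurable_funX.
- by move=> x; rewrite lee_fin sqr_ge0.
Qed.

(** The integrand on time times space whose two iterated integrals are compared. *)
Definition fubini_fun t w psi (q : measurableTypeR R * X) : R :=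
  \1_(`[0, t]%classic : set R) q.1 * (w (phi q.1 q.2) * psi q.2).

Lemma measurable_fubini_fun t w psi : measurable_fun setT w ->
  measurable_fun setT psi -> measurable_fun setT (fubini_fun t w psi).
Proof.
move=> mw mpsi; apply: measurable_funM.
  have mI : measurable_fun setT (\1_(`[0, t]%classic) : measurableTypeR R -> R).
    exact: measurable_indic.
  exact: (measurableT_comp mI measurable_fst).
apply: measurable_funM; first exact: (measurableT_comp mw mphi).
exact: (measurableT_comp mpsi measurable_snd).
Qed.

Lemma integrable_fubini_fun t w psi : sqint w -> dominated psi ->
  (leb \x mu)%E.-integrable setT (EFin \o fubini_fun t w psi).
Proof.
move=> sw dpsi; have [mw iw] := sw; have [mpsi [C [E [mE vE C0 psiC]]]] := dpsi.
have mK := measurable_fubini_fun t mw mpsi.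
apply/integrable12ltyP; first exact/measurable_EFinP.
pose M := (C%:E * (mu E + \int[mu]_x (w x ^+ 2)%:E))%E.
have M0 : (0 <= M)%E.
  by rewrite mule_ge0// adde_ge0// integral_ge0// => x _; rewrite lee_fin sqr_ge0.
have Mfin : (M < +oo)%E by rewrite lte_mul_pinfty// lte_add_pinfty.
have inner s : (\int[mu]_x `|(EFin \o fubini_fun t w psi) (s, x)| <=
    (\1_(`[0%R, t]%classic : set R) s : R)%:E * M)%E.
  have [mws iws] := sqint_phi s sw.
  have I0 : 0 <= \1_(`[0%R, t]%classic : set R) s :> R by rewrite indicE ler0n.
  have mB : measurable_fun setT (fun x => (\1_E x + w (phi s x) ^+ 2)%:E).
    by apply/measurable_EFinP; apply: measurable_funD => //; exact: measurable_funX.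
  have B0 x : (0 <= (\1_E x + w (phi s x) ^+ 2)%:E)%E.
    by rewrite lee_fin addr_ge0// ?sqr_ge0// indicE ler0n.
  apply: (@le_trans _ _ (\int[mu]_x ((\1_(`[0%R, t]%classic : set R) s : R)%:E *
      (C%:E * (\1_E x + w (phi s x) ^+ 2)%:E)))%E).
    apply: ge0_le_integral => //.
    - apply: measurableT_comp => //; apply/measurable_EFinP.
      exact: (measurableT_comp mK (pair1_measurable (s : measurableTypeR R))).
    - by apply: measurable_funeM; apply: measurable_funeM.
    - move=> x _; rewrite /fubini_fun /= lee_fin normrM ger0_norm// ler_wpM2l//.
      by apply: mul_dominated_le => //; rewrite indicE ler0n lern1 leq_b1.
  rewrite ge0_integralZl_EFin//; last 2 first.
    by move=> x _; rewrite mule_ge0.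
    by apply: measurable_funeM.
  rewrite ge0_integralZl_EFin// /M.
  under eq_integral do rewrite EFinD.
  have h1 : measurable_fun setT (fun x : X => (\1_E x : R)%:E).
    by apply/measurable_EFinP; exact: measurable_indic.
  have h2 : measurable_fun setT (fun x => (w (phi s x) ^+ 2)%:E).
    by apply/measurable_EFinP; exact: measurable_funX.
  rewrite ge0_integralD//; last first.
    by move=> x _; rewrite lee_fin sqr_ge0.
  rewrite integral_indic// setIT.
  rewrite (ge0_integral_measure_preserving (measurable_phi s) (phip s)
    (F := fun x => (w x ^+ 2)%:E)) //.
    by apply/measurable_EFinP; exact: measurable_funX.
  by move=> x; rewrite lee_fin sqr_ge0.
have h1 : measurable_fun setT
    (fun s : measurableTypeR R => (\1_(`[0%R, t]%classic : set R) s : R)%:E).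
  by apply/measurable_EFinP; exact: measurable_indic.
apply: (@le_lt_trans _ _ (\int[leb]_s ((\1_(`[0%R, t]%classic : set R) s : R)%:E * M))%E).
  apply: ge0_le_integral => //.
  - by move=> s _; exact: integral_ge0.
  - apply: (measurable_fun_fubini_tonelli_F (fun q => `|(EFin \o fubini_fun t w psi) q|%E)) => //.
    by apply: measurableT_comp => //; exact/measurable_EFinP.
  - exact: (emeasurable_funM h1 (measurable_cst M)).
rewrite ge0_integralZr//.
rewrite integral_indic// setIT lte_mul_pinfty//= lebesgue_measure_itv/=.
by case: ifPn => _; rewrite ?ltry.
Qed.

(** By the Fubini theorem, almost every orbit is integrable in time, so that the
    extended real integral is the real-valued average. *)
Lemma ae_integral_fubini_fun t w psi : sqint w -> dominated psi ->
  {ae mu, forall x, \int[leb]_s (fubini_fun t w psi (s, x))%:E =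
     (flow_average t w x * psi x)%:E}%E.
Proof.
move=> sw dpsi; have mw := sw.1.
have := ae_integrable2 (integrable_fubini_fun t sw dpsi).
apply: filterS => x ix.
have [p0|p0] := eqVneq (psi x) 0.
  rewrite p0 mulr0 integral0_eq// => s _.
  by rewrite /fubini_fun p0 !mulr0.
pose g := (fun s => w (phi s x)) \_ `[0, t]%classic : measurableTypeR R -> R.
have E s : fubini_fun t w psi (s, x) = g s * psi x.
  rewrite /fubini_fun /g /= patchE indicE.
  by case: ifPn => _; rewrite ?mul1r ?mul0r.
have ig : leb.-integrable setT (EFin \o g).
  have := integrableZr measurableT (psi x)^-1 ix.
  congr (_.-integrable _ _); apply/funext => s.
  by rewrite /= E -EFinM mulfK.
have -> : flow_average t w x = \int[leb]_s g s by rewrite /flow_average Rintegral_mkcond.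
rewrite -RintegralZr// /Rintegral fineK; last first.
  have := integrable_fin_num measurableT ix; congr (_ \is a fin_num).
  by apply: eq_integral => s _; rewrite /= E.
by apply: eq_integral => s _; rewrite E.
Qed.

Lemma measurable_flow_average t w : measurable_fun setT w ->
  measurable_fun setT (flow_average t w).
Proof.
move=> mw; pose K := EFin \o fubini_fun t w (fun=> 1).
have mK : measurable_fun setT K.
  by apply/measurable_EFinP; apply: measurable_fubini_fun.
have -> : flow_average t w = fine \o (fun x => \int[leb]_s K (s, x))%E.
  apply/funext => x; rewrite /flow_average Rintegral_mkcond /Rintegral /=; congr fine.
  apply: eq_integral => s _; rewrite /K /= /fubini_fun /= patchE indicE mulr1.
  by case: ifPn => _; rewrite ?mul1r ?mul0r.
apply: (measurableT_comp (fine_measurable measurableT)).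
rewrite (_ : (fun x => _) = (fun x => \int[leb]_s K^\+ (s, x)) \- (fun x => \int[leb]_s K^\- (s, x)))%E.
  apply: emeasurable_funB; apply: measurable_fun_fubini_tonelli_G => //.
    exact: measurable_funepos.
  exact: measurable_funeneg.
apply/funext => x; rewrite [LHS]integralE.
under eq_integral do rewrite funepos_comp/=.
by under [X in (_ - X)%E = _]eq_integral do rewrite funeneg_comp/=.
Qed.

Lemma integrable_flow_average t w psi : sqint w -> dominated psi ->
  mu.-integrable setT (EFin \o (fun x => flow_average t w x * psi x)).
Proof.
move=> sw dpsi.
have mA : measurable_fun setT (EFin \o (fun x => flow_average t w x * psi x)).
  apply/measurable_EFinP; apply: measurable_funM; last exact: dpsi.1.
  exact: measurable_flow_average sw.1.
have iK := integrable_fubini_fun t sw dpsi.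
apply/integrableP; split => //.
have mK := measurable_int _ iK.
apply: (le_lt_trans _ ((integrable21ltyP _ _ mK).1 iK)).
rewrite (ae_eq_integral (fun x => `|\int[leb]_s (fubini_fun t w psi (s, x))%:E|)%E) //.
- apply: ge0_le_integral => //.
  + apply: (measurableT_comp (@abse_measurable R setT)).
    exact: measurable_fubini_G iK.
  + apply: (measurable_fun_fubini_tonelli_G (fun q => `|(EFin \o fubini_fun t w psi) q|%E)) => //.
    by apply: measurableT_comp => //; exact: mK.
  + move=> x _; apply: le_abse_integral => //.
    exact: (measurableT_comp mK (pair2_measurable x)).
- exact: measurableT_comp.
- apply: (measurableT_comp (@abse_measurable R setT)).
  exact: measurable_fubini_G iK.
- by apply: filterS (ae_integral_fubini_fun t sw dpsi) => x /= -> _.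
Qed.

Lemma integral_fubini_fun1 t w psi s : sqint w -> dominated psi ->
  (\int[mu]_x (fubini_fun t w psi (s, x))%:E =
   ((pairing w psi \_ `[0%R, t]) s)%:E)%E.
Proof.
move=> sw dpsi; rewrite patchE /fubini_fun /= indicE; case: ifPn => _; last first.
  by under eq_integral do rewrite mul0r; rewrite integral0.
under eq_integral do rewrite mul1r.
rewrite /pairing /Rintegral fineK//.
exact: integrable_fin_num (integrable_mul_dominated (sqint_phi s sw) dpsi).
Qed.

Lemma integrable_pairing t w psi : sqint w -> dominated psi ->
  leb.-integrable `[0, t] (EFin \o pairing w psi).
Proof.
move=> sw dpsi; apply/(integrable_mkcond _ _).2 => //.
have := integrable_fubini_F (integrable_fubini_fun t sw dpsi).
congr (_.-integrable _ _); apply/funext => s.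
by rewrite /fubini_F /= integral_fubini_fun1// restrict_EFin.
Qed.

Lemma integral_flow_average t w psi : sqint w -> dominated psi ->
  \int[mu]_x (flow_average t w x * psi x) = \int[leb]_(s in `[0, t]) pairing w psi s.
Proof.
move=> sw dpsi; rewrite [RHS]Rintegral_mkcond /Rintegral; congr fine.
have iK := integrable_fubini_fun t sw dpsi.
transitivity (\int[mu]_x \int[leb]_s (fubini_fun t w psi (s, x))%:E)%E.
  apply: ae_eq_integral => //.
  - by have /integrableP[] := integrable_flow_average t sw dpsi.
  - exact: measurable_fubini_G iK.
  - by apply: filterS (ae_integral_fubini_fun t sw dpsi) => x -> _.
rewrite -(Fubini iK); apply: eq_integral => s _.
exact: integral_fubini_fun1.
Qed.

Lemma ae_integrable_orbit w : sqint w ->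
  {ae mu, forall x t, leb.-integrable `[0, t] (fun s => (w (phi s x))%:E)}.
Proof.
move=> sw; have mw := sw.1.
have [E [ET Eoo]] := sigma_finiteT mu.
have dE k : dominated (\1_(E k)).
  have [mE vE] := Eoo k.
  split; first exact: measurable_indic.
  by exists 1, (E k); split=> // x; rewrite mul1r indicE ger0_norm.
have h := ae_foralln (fun n => ae_foralln (fun k =>
  ae_integrable2 (integrable_fubini_fun n%:R sw (dE k)))).
apply: filterS h => x hx t.
have [k _ Ekx] : (\bigcup_k E k) x by rewrite -ET.
have := hx (Num.bound `|t|) k.
have E1 : (\1_(E k) x : R) = 1 by rewrite indicE mem_set.
move=> ix.
have : leb.-integrable `[0, (Num.bound `|t|)%:R] (fun s => (w (phi s x))%:E).
  apply/(integrable_mkcond _ _).2 => //; move: ix.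
  congr (_.-integrable _ _); apply/funext => s.
  rewrite /= /fubini_fun /= E1 mulr1 patchE indicE.
  by case: ifPn => _; rewrite ?mul1r ?mul0r.
apply: integrableS => //; apply: subset_itvl => /=.
by rewrite bnd_simp (le_trans (ler_norm _))// ltW// archi_boundP.
Qed.

End flow.

Section levels.
Context d (X : measurableType d) (R : realType).
Variable mu : {measure set X -> \bar R}.
Implicit Types f g w : X -> R.

Definition fin_levels f : Prop := forall a : R, 0 < a ->
  (mu [set x | (a < `|f x|)%R] < +oo)%E.

Lemma measurable_levels f a : measurable_fun setT f -> measurable [set x | (a < `|f x|)%R].
Proof.
move=> mf; have -> : [set x | (a < `|f x|)%R] =
    setT `&` ((fun x => `|f x|) @^-1` `]a, +oo[).
  by rewrite setTI; apply/seteqP; split=> x /=; rewrite in_itv /= andbT.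
by apply: (measurableT_comp (@normr_measurable R setT)).
Qed.

(** Markov inequality, for a [Q] that controls [f] on its superlevel sets. *)
Lemma fin_levels_ge0_integral f (Q : X -> \bar R) : measurable_fun setT f ->
  measurable_fun setT Q -> (forall x, 0 <= Q x)%E -> (\int[mu]_x Q x < +oo)%E ->
  (forall a, 0 < a -> exists2 b : R, 0 < b &
     forall x, (a < `|f x|)%R -> (b%:E <= Q x)%E) ->
  fin_levels f.
Proof.
move=> mf mQ Q0 iQ h a a0; have [b b0 hb] := h a a0.
have := le_integral_abse mu measurableT mQ b0.
rewrite setTI; under [X in (_ <= X)%E]eq_integral do rewrite gee0_abs//.
move=> /le_lt_trans/(_ iQ) bQ.
have mS : measurable [set x | (b%:E <= `|Q x|)%E].
  rewrite -[X in measurable X]setTI.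
  by apply: emeasurable_fun_c_infty => //; exact: measurableT_comp.
apply: (@le_lt_trans _ _ (mu [set x | (b%:E <= `|Q x|)%E])).
  apply: le_measure; rewrite ?inE//; first exact: measurable_levels.
  by move=> x /= /hb; rewrite gee0_abs.
by move: bQ; rewrite -lte_pdivlMl// => /lt_le_trans -> //; exact: leey.
Qed.

Lemma fin_levelsB f g : measurable_fun setT f -> measurable_fun setT g ->
  fin_levels f -> fin_levels g -> fin_levels (fun x => f x - g x).
Proof.
move=> mf mg lf lg a a0; have a20 : 0 < a / 2 by rewrite divr_gt0.
have m1 := measurable_levels (a / 2) mf; have m2 := measurable_levels (a / 2) mg.
apply: (@le_lt_trans _ _ (mu ([set x | (a / 2 < `|f x|)%R] `|` [set x | (a / 2 < `|g x|)%R]))).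
  apply: le_measure; rewrite ?inE.
  - by apply: measurable_levels; exact: measurable_funB.
  - exact: measurableU.
  - move=> x /= h; have [h1|h1] := ltP (a / 2) `|f x|; [by left|right => /=].
    have := ler_normB (f x) (g x); lra.
apply: (le_lt_trans (measureU2 _ m1 m2)).
by rewrite lte_add_pinfty//; [exact: lf|exact: lg].
Qed.

End levels.

Section flow_levels.
Context d (X : measurableType d) (R : realType).
Variable mu : {sigma_finite_measure set X -> \bar R}.
Local Notation leb := (@lebesgue_measure R).
Variable phi : R -> X -> X.
Hypothesis mphi :
  measurable_fun setT (fun q : measurableTypeR R * X => phi q.1 q.2).
Hypothesis phip : forall s A, measurable A -> mu (phi s @^-1` A) = mu A.
Implicit Types (w psi : X -> R) (s t : R).

Lemma fin_levels_sqint w : sqint mu w -> fin_levels mu w.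
Proof.
move=> [mw iw]; apply: (fin_levels_ge0_integral mw _ _ iw) => //.
- by apply/measurable_EFinP; exact: measurable_funX.
- by move=> x; rewrite lee_fin sqr_ge0.
move=> a a0; exists (a ^+ 2); first by rewrite exprn_gt0.
move=> x /ltW ax; rewrite lee_fin -[w x ^+ 2]real_normK ?num_real//.
by rewrite ler_sqr ?nnegrE// ltW.
Qed.

(** Averages of a square integrable function decompose into a bounded part that
    is as small as desired and a part controlled by the average of the square. *)
Lemma fin_levels_flow_average t w : 0 <= t -> sqint mu w ->
  fin_levels mu (flow_average phi t w).
Proof.
move=> t0 sw; have [mw iw] := sw.
pose K (q : measurableTypeR R * X) : \bar R :=
  ((\1_(`[0, t]%classic : set R) q.1 : R) * (w (phi q.1 q.2) ^+ 2))%:E.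
have mK : measurable_fun setT K.
  apply/measurable_EFinP; apply: measurable_funM.
    have mI : measurable_fun setT (\1_(`[0, t]%classic) : measurableTypeR R -> R).
      exact: measurable_indic.
    exact: (measurableT_comp mI measurable_fst).
  by apply: measurable_funX; exact: (measurableT_comp mw mphi).
have K0 q : (0 <= K q)%E.
  by rewrite lee_fin mulr_ge0 ?sqr_ge0// indicE ler0n.
pose Q x := (\int[leb]_s K (s, x))%E.
have QE x : Q x = (\int[leb]_(s in `[0%R, t]) (w (phi s x) ^+ 2)%:E)%E.
  rewrite [RHS]integral_mkcond; apply: eq_integral => s _.
  by rewrite /K /= patchE indicE; case: ifPn => _; rewrite ?mul1r ?mul0r.
have iQ : (\int[mu]_x Q x < +oo)%E.
  rewrite /Q -(fubini_tonelli (m1 := leb) (m2 := mu) K mK K0).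
  have -> : (\int[leb]_s \int[mu]_x K (s, x) = \int[leb]_s
     ((\1_(`[0%R, t]%classic : set R) s : R)%:E * \int[mu]_x (w x ^+ 2)%:E))%E.
    apply: eq_integral => s _; rewrite /K /=; under eq_integral do rewrite EFinM.
    have [mws iws] := sqint_phi mphi phip s sw.
    rewrite ge0_integralZl_EFin//.
    - rewrite (ge0_integral_measure_preserving (measurable_phi mphi s) (phip s)
        (F := fun x => (w x ^+ 2)%:E)) //.
        by apply/measurable_EFinP; exact: measurable_funX.
      by move=> x; rewrite lee_fin sqr_ge0.
    - by move=> x _; rewrite lee_fin sqr_ge0.
    - by apply/measurable_EFinP; exact: measurable_funX.
  have I0 : (0 <= \int[mu]_x (w x ^+ 2)%:E)%E.
    by apply: integral_ge0 => x _; rewrite lee_fin sqr_ge0.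
  have h1 : measurable_fun setT
    (fun s : measurableTypeR R => (\1_(`[0%R, t]%classic : set R) s : R)%:E).
    by apply/measurable_EFinP; exact: measurable_indic.
  rewrite ge0_integralZr//.
  rewrite integral_indic// setIT lte_mul_pinfty//= lebesgue_measure_itv/=.
  by case: ifPn => _; rewrite ?ltry.
apply: (fin_levels_ge0_integral _ _ _ iQ).
- exact: (measurable_flow_average mphi).
- exact: (measurable_fun_fubini_tonelli_G (fun q => K q)).
- by move=> x; apply: integral_ge0 => s _.
move=> a a0; pose e := a / (2 * (t + 1)).
have t10 : 0 < 2 * (t + 1) by lra.
have e0 : 0 < e by rewrite divr_gt0.
exists (e * (a / 2)); first by rewrite mulr_gt0// divr_gt0.
move=> x ax.
have mo := measurable_orbit mphi x mw.
have h : (`|flow_average phi t w x|%:E <= (e * t)%:E + e^-1%:E * Q x)%E.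
  apply: (@le_trans _ _ (\int[leb]_(s in `[0%R, t]) `|(w (phi s x))%:E|)%E).
    apply: (@le_trans _ _ `|\int[leb]_(s in `[0%R, t]) (w (phi s x))%:E|%E).
      rewrite /flow_average /Rintegral.
      by case: (\int[_]_(_ in _) _)%E => [r| |]//=; rewrite leey.
    by apply: le_abse_integral => //; apply/measurable_EFinP; exact: measurable_funS mo.
  have -> : ((e * t)%:E = \int[leb]_(s in `[0%R, t]) e%:E)%E.
    rewrite integral_cst//= lebesgue_measure_itv/= lte_fin.
    by case: ltgtP t0 => // [tp|<-] _; rewrite ?mulr0 ?mule0 ?sube0// -EFinM.
  have mo2 : measurable_fun `[0, t] (fun s : measurableTypeR R => (w (phi s x) ^+ 2)%:E).
    by apply/measurable_EFinP; apply: measurable_funX; exact: measurable_funS mo.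
  rewrite QE -ge0_integralZl_EFin//; last 2 first.
    by move=> s _; rewrite lee_fin sqr_ge0.
    by rewrite invr_ge0 ltW.
  (* the pointwise bound is b <= e + b^2 / e, for b = |w| *)
  rewrite -ge0_integralD//; last 3 first.
    by move=> s _; rewrite lee_fin ltW.
    by move=> s _; rewrite mule_ge0 ?lee_fin ?invr_ge0 ?sqr_ge0 ?ltW.
    exact: measurable_funeM.
  apply: ge0_le_integral => //.
  - apply: measurableT_comp => //; apply/measurable_EFinP; exact: measurable_funS mo.
  - by apply: emeasurable_funD => //; exact: measurable_funeM.
  - move=> s _; rewrite /= -EFinM -EFinD lee_fin.
    rewrite -[w _ ^+ 2]real_normK ?num_real//.
    have := normr_ge0 (w (phi s x)); move: `|w _| => b b0.
    have [be|be] := leP b e; first by rewrite (le_trans be)// lerDl mulr_ge0 ?invr_ge0 ?sqr_ge0 ?ltW.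
    rewrite (@le_trans _ _ (e^-1 * b ^+ 2))//; last by rewrite lerDr ltW.
    by rewrite mulrC ler_pdivlMr// expr2 ler_wpM2l// ltW.
have et : e * t <= a / 2.
  rewrite /e mulrAC ler_pdivrMr//; nra.
have Q0 : (0 <= Q x)%E by apply: integral_ge0.
move: Q0 h; case: (Q x) => [q| |] //; last by move=> _ _; rewrite leey.
rewrite !lee_fin => q0 h.
have : a / 2 <= e^-1 * q by lra.
by rewrite -ler_pdivrMl ?invr_gt0// invrK.
Qed.

Hypothesis phiD : forall s t x, phi (s + t) x = phi s (phi t x).

Lemma flow_averageD s t w x : 0 <= s -> 0 <= t -> measurable_fun setT w ->
  (forall r, leb.-integrable `[0, r] (fun s => (w (phi s x))%:E)) ->
  flow_average phi (t + s) w x = flow_average phi s w x + flow_average phi t w (phi s x).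
Proof.
move=> s0 t0 mw iw.
have key := @Rintegral_itvB R (fun s => w (phi s x)) (BLeft 0) (BRight (t + s)) s (iw (t + s)).
suff E : \int[leb]_(r in `]s, t + s]) w (phi r x) = flow_average phi t w (phi s x).
  by rewrite -E -key ?bnd_simp ?lerDr// [RHS]addrC subrK.
rewrite Rintegral_itv_obnd_cbnd; last first.
  apply: integrableS (iw (t + s)) => //.
  by move=> r /=; rewrite !in_itv /= => /andP[h1 ->]; rewrite andbT (le_trans s0)// ltW.
rewrite -(Rintegral_shift s t (g := fun s => w (phi s x))); last exact: (measurable_orbit mphi x mw).
by apply: eq_Rintegral => r _; rewrite phiD.
Qed.

End flow_levels.

Section backward.
Context d (X : measurableType d) (R : realType).
Variable mu : {sigma_finite_measure set X -> \bar R}.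
Local Notation leb := (@lebesgue_measure R).
Variable phi : R -> X -> X.
Hypothesis mphi :
  measurable_fun setT (fun q : measurableTypeR R * X => phi q.1 q.2).
Hypothesis phip : forall s A, measurable A -> mu (phi s @^-1` A) = mu A.
Hypothesis phiNK : forall s x, phi (- s) (phi s x) = x.
Implicit Types (w psi : X -> R) (s t : R).

Definition backward_average t psi x : R := \int[leb]_(s in `[0, t]) psi (phi (- s) x).

Let mphiN : measurable_fun setT (fun q : measurableTypeR R * X => phi (- q.1) q.2).
Proof.
have mN : measurable_fun setT (fun q : measurableTypeR R * X => (- q.1 : measurableTypeR R, q.2)).
  apply/measurable_fun_pairP; split; last exact: measurable_snd.
  exact: (measurable_funN (measurable_fst)).
exact: (measurableT_comp mphi mN).
Qed.

Lemma pairing_backward w psi s : measurable_fun setT w -> measurable_fun setT psi ->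
  pairing mu phi w psi s = \int[mu]_x (w x * psi (phi (- s) x)).
Proof.
move=> mw mpsi; rewrite /pairing /Rintegral; congr fine.
have mF : measurable_fun setT (fun x => (w x * psi (phi (- s) x))%:E).
  apply/measurable_EFinP; apply: measurable_funM => //.
  exact: (measurableT_comp mpsi (measurable_phi mphi (- s))).
rewrite -(integral_measure_preserving (measurable_phi mphi s) (phip s) mF).
by apply: eq_integral => x _; rewrite phiNK.
Qed.

Definition backward_fun t w psi (q : measurableTypeR R * X) : R :=
  \1_(`[0, t]%classic : set R) q.1 * (w q.2 * psi (phi (- q.1) q.2)).

Lemma measurable_backward_fun t w psi : measurable_fun setT w ->
  measurable_fun setT psi -> measurable_fun setT (backward_fun t w psi).
Proof.
move=> mw mpsi; apply: measurable_funM.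
  have mI : measurable_fun setT (\1_(`[0, t]%classic) : measurableTypeR R -> R).
    exact: measurable_indic.
  exact: (measurableT_comp mI measurable_fst).
apply: measurable_funM; first exact: (measurableT_comp mw measurable_snd).
exact: (measurableT_comp mpsi mphiN).
Qed.

Lemma integrable_backward_fun t w psi : sqint mu w -> dominated mu psi ->
  (leb \x mu)%E.-integrable setT (EFin \o backward_fun t w psi).
Proof.
move=> sw dpsi; have mw := sw.1; have mpsi := dpsi.1.
have mB : measurable_fun setT (EFin \o backward_fun t w psi).
  by apply/measurable_EFinP; exact: measurable_backward_fun.
apply/integrable12ltyP => //.
have iK := integrable_fubini_fun mphi phip t sw dpsi.
have := (integrable12ltyP _ _ (measurable_int _ iK)).1 iK.
apply: le_lt_trans; rewrite le_eqVlt; apply/orP; left; apply/eqP.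
apply: eq_integral => s _.
have mF : measurable_fun setT (fun x => `|(EFin \o backward_fun t w psi) (s, x)|%E).
  apply: measurableT_comp => //.
  exact: (measurableT_comp mB (pair1_measurable (s : measurableTypeR R))).
rewrite -(integral_measure_preserving (measurable_phi mphi s) (phip s) mF).
by apply: eq_integral => x _; rewrite /backward_fun /fubini_fun /= phiNK.
Qed.

Lemma integral_backward_fun t w psi x : dominated mu psi ->
  (\int[leb]_s (backward_fun t w psi (s, x))%:E = (w x * backward_average t psi x)%:E)%E.
Proof.
move=> [mpsi [C [E [_ _ C0 psiC]]]].
have mg : measurable_fun setT (fun s : measurableTypeR R => psi (phi (- s) x)).
  exact: (measurableT_comp mpsi (measurableT_comp mphiN (pair2_measurable x))).
have ig : leb.-integrable `[0, t] (EFin \o (fun s => psi (phi (- s) x))).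
  apply: (@le_integrable _ _ _ leb _ _ _ (EFin \o (fun=> C))) => //.
  - by apply/measurable_EFinP; exact: measurable_funS mg.
  - move=> s _ /=; rewrite lee_fin (ger0_norm C0) (le_trans (psiC _))//.
    by rewrite ler_piMr// indicE lern1 leq_b1.
  - apply/integrableP; split; first exact: measurable_cst.
    rewrite integral_cst//= lte_mul_pinfty//= lebesgue_measure_itv/=.
    by case: ifPn => _; rewrite ?ltry.
transitivity (\int[leb]_(s in `[0%R, t]) (w x * psi (phi (- s) x))%:E)%E.
  rewrite [RHS]integral_mkcond; apply: eq_integral => s _.
  rewrite /backward_fun /= patchE indicE.
  by case: ifPn => _; rewrite ?mul1r ?mul0r.
have igw : leb.-integrable `[0, t] (EFin \o (fun s => w x * psi (phi (- s) x))).
  have mI : measurable (`[0, t]%classic : set (measurableTypeR R)) by exact: measurable_itv.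
  by have := integrableZl mI (w x) ig.
rewrite /backward_average -RintegralZl// /Rintegral fineK//.
exact: integrable_fin_num igw.
Qed.

(** The counterpart of [integral_flow_average] in which invariance of the
    measure has moved the flow to the other factor. *)
Lemma integral_backward_average t w psi : sqint mu w -> dominated mu psi ->
  \int[mu]_x (w x * backward_average t psi x) =
  \int[leb]_(s in `[0, t]) pairing mu phi w psi s.
Proof.
move=> sw dpsi; rewrite [RHS]Rintegral_mkcond /Rintegral; congr fine.
have iK := integrable_backward_fun t sw dpsi.
transitivity (\int[mu]_x \int[leb]_s (backward_fun t w psi (s, x))%:E)%E.
  by apply: eq_integral => x _; rewrite integral_backward_fun.
rewrite -(Fubini iK); apply: eq_integral => s _.
rewrite patchE /backward_fun /= indicE; case: ifPn => _; last first.
  by under eq_integral do rewrite mul0r; rewrite integral0.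
under eq_integral do rewrite mul1r.
have E := pairing_backward s sw.1 dpsi.1.
rewrite E /Rintegral fineK//.
have := integrable_fin_num measurableT (integrable_mul_dominated (sqint_phi mphi phip s sw) dpsi).
congr (_ \is a fin_num).
have mF : measurable_fun setT (fun x => (w x * psi (phi (- s) x))%:E).
  apply/measurable_EFinP; apply: measurable_funM; first exact: sw.1.
  exact: (measurableT_comp dpsi.1 (measurable_phi mphi (- s))).
rewrite -(integral_measure_preserving (measurable_phi mphi s) (phip s) mF).
by apply: eq_integral => x _; rewrite /= phiNK.
Qed.

End backward.

(** * Differentiability along the horocycle flow *)

Section factorization.
Variable R : realType.
Local Notation G := (SL2 R).
Implicit Types s t : R.

Lemma expTD s t : (expT s * expT t)%g = expT (s + t) :> G.
Proof.
by apply/val_inj/matrixP; apply: ord2E; apply: ord2E;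
  rewrite SL2_mulE !mxE /= ?cosD ?sinD; ring.
Qed.

Lemma expYD s t : (expY s * expY t)%g = expY (s + t) :> G.
Proof.
by apply/val_inj/matrixP; apply: ord2E; apply: ord2E;
  rewrite SL2_mulE !mxE /= /cosh /sinh !opprD !expRD; field.
Qed.

Definition thetaU t : R := atan (t / 2) / 2.
Definition upsU t : R := - ln (t / 2 + Num.sqrt (1 + (t / 2) ^+ 2)).

(** The Cartan decomposition of exp(tU): the two outer angles agree and are
    half of the arc tangent of t/2, and the middle factor has sinh y = - t/2. *)
Lemma expU_factor t : expU t = (expT (thetaU t) * expY (upsU t) * expT (thetaU t))%g :> G.
Proof.
set h := t / 2; set q := Num.sqrt (1 + h ^+ 2).
have q1 : 0 < 1 + h ^+ 2 by rewrite ltr_pwDl// sqr_ge0.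
have q0 : 0 < q by rewrite sqrtr_gt0.
have qq : q ^+ 2 = 1 + h ^+ 2 by rewrite sqr_sqrtr// ltW.
have p0 : 0 < h + q.
  rewrite -ltrBlDl sub0r; have [h0|h0] := ltP (- h) 0; first exact: lt_trans q0.
  by rewrite -ltr_sqr ?nnegrE ?(ltW q0)// qq sqrrN ltrDr.
have eN : expR (- upsU t) = h + q by rewrite /upsU opprK lnK.
have eP : expR (upsU t) = q - h.
  rewrite -[upsU t]opprK expRN eN; apply: (mulfI (lt0r_neq0 p0)); rewrite mulfV ?gt_eqF//.
  by have -> : (h + q) * (q - h) = q ^+ 2 - h ^+ 2; [ring|rewrite qq addrK].
have ch : cosh (upsU t) = q by rewrite /cosh eN eP; field.
have sh : sinh (upsU t) = - h by rewrite /sinh eN eP; field.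
have th : thetaU t + thetaU t = atan h by rewrite /thetaU -splitr.
have c2 : cos (thetaU t) * cos (thetaU t) - sin (thetaU t) * sin (thetaU t) = q^-1.
  by rewrite -cosD th cos_atan.
have s2 : sin (thetaU t) * cos (thetaU t) + cos (thetaU t) * sin (thetaU t) = h / q.
  rewrite -sinD th; have hE : sin (atan h) * q = h.
    by have := atanK h; rewrite /tan cos_atan invrK.
  by rewrite -[X in _ = X / _]hE mulfK ?gt_eqF.
have cs : cos (thetaU t) ^+ 2 + sin (thetaU t) ^+ 2 = 1 by rewrite cos2Dsin2.
have th2 : t = h + h by rewrite /h -splitr.
apply/val_inj/matrixP; apply: ord2E; apply: ord2E; rewrite !SL2_mulE !mxE /= ch sh;
  move: (cos _) (sin _) c2 s2 cs => c s c2 s2 cs; apply: esym.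
- transitivity (q * (c * c - s * s)); first by ring.
  by rewrite c2 mulfV ?gt_eqF.
- transitivity (q * (s * c + c * s) + h * (c ^+ 2 + s ^+ 2)); first by ring.
  by rewrite s2 cs mulrCA mulfV ?gt_eqF// th2 !mulr1.
- transitivity (h * (c ^+ 2 + s ^+ 2) - q * (s * c + c * s)); first by ring.
  by rewrite s2 cs mulrCA mulfV ?gt_eqF// !mulr1 subrr.
- transitivity (q * (c * c - s * s)); first by ring.
  by rewrite c2 mulfV ?gt_eqF.
Qed.

Lemma is_derive_thetaU : is_derive (0 : R) 1 thetaU 4^-1.
Proof.
have d1 : is_derive (0 : R) 1 (fun t : R => t / 2) 2^-1.
  have := is_deriveZ (2^-1 : R) (@is_derive_id R R 0 1).
  by rewrite [_%:A]mulr1; congr is_derive; apply/funext => t; rewrite [LHS]mulrC.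
have d2 : is_derive (0 / 2 : R) 1 atan 1.
  by have := is_derive1_atan (0 / 2 : R); rewrite mul0r expr0n addr0 invr1.
have d3 := @is_derive1_comp _ atan (fun t : R => t / 2) 0 _ _ d2 d1.
have := is_deriveZ (2^-1 : R) d3.
rewrite mul1r [_ *: _](_ : _ = 4^-1); last by rewrite /GRing.scale /=; field.
by congr is_derive; apply/funext => t; rewrite /thetaU [LHS]mulrC.
Qed.

Lemma is_derive_upsU : is_derive (0 : R) 1 upsU (- 2^-1).
Proof.
have d1 : is_derive (0 : R) 1 (fun t : R => t / 2) 2^-1.
  have := is_deriveZ (2^-1 : R) (@is_derive_id R R 0 1).
  by rewrite [_%:A]mulr1; congr is_derive; apply/funext => t; rewrite [LHS]mulrC.
pose b (t : R) := 1 + t / 2 * (t / 2).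
have b0 : b 0 = 1 by rewrite /b !mul0r addr0.
have db : is_derive (0 : R) 1 b 0.
  have := is_deriveD (@is_derive_cst _ R R (1 : R) 0 1) (is_deriveM d1 d1).
  by rewrite mul0r !scale0r !addr0.
pose r (t : R) := Num.sqrt (b t).
have r0 : r 0 = 1 by rewrite /r b0 sqrtr1.
have dr : is_derive (0 : R) 1 r 0.
  have d2 : is_derive (b 0) 1 (@Num.sqrt R) 2^-1.
    by rewrite b0; have := is_derive1_sqrt (@ltr01 R); rewrite sqrtr1 mulr1.
  by have := is_derive1_comp d2 db; rewrite mulr0.
pose p (t : R) := t / 2 + r t.
have p0 : p 0 = 1 by rewrite /p r0 mul0r add0r.
have dp : is_derive (0 : R) 1 p 2^-1.
  by have := is_deriveD d1 dr; rewrite addr0.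
have dl : is_derive (0 : R) 1 (fun t => ln (p t)) 2^-1.
  have d2 : is_derive (p 0) 1 (@ln R) 1.
    by rewrite p0; have := is_derive1_ln (@ltr01 R); rewrite invr1.
  by have := is_derive1_comp d2 dp; rewrite mul1r.
exact: is_deriveN dl.
Qed.

End factorization.

Section differentiability.
Variables (R : realType) (Gamma : groupClosed (SL2 R)).
Local Notation G := (SL2 R).
Local Notation SM := (SM Gamma).

(** Along a one-parameter subgroup, derivability at time 0 at every point gives
    derivability at all times, so the mean value theorem applies. *)
Lemma MVT_one_parameter (c : R -> G) (f df : SM -> R) :
  (forall s t, (c s * c t)%g = c (s + t)) ->
  (forall x, is_derive (0 : R) 1 (fun t => f (rtrans (c t) x)) (df x)) ->
  forall x t, exists2 r, `|r| <= `|t| &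
     f (rtrans (c t) x) - f (rtrans (c 0) x) = df (rtrans (c r) x) * t.
Proof.
move=> cD d x.
have dh (t : R) : is_derive t 1 (fun t => f (rtrans (c t) x)) (df (rtrans (c t) x)).
  have dsh : is_derive t 1 (fun s : R => s - t) 1.
    by have := is_deriveB (@is_derive_id R R t 1) (@is_derive_cst _ R R t t 1); rewrite subr0.
  have d0 : is_derive (t - t) 1 (fun s => f (rtrans (c s) (rtrans (c t) x))) (df (rtrans (c t) x)).
    by rewrite subrr; exact: d.
  have := @is_derive1_comp _ (fun s => f (rtrans (c s) (rtrans (c t) x)))
    (fun s : R => s - t) t _ _ d0 dsh.
  rewrite mulr1; congr is_derive.
  by apply/funext => s; rewrite /= -rtransM cD addrC subrK.
have ch : continuous (fun t => f (rtrans (c t) x)).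
  by move=> t; have [] := dh t; move=> /derivable1_diffP/differentiable_continuous.
move=> t; have [t0|t0] := leP 0 t.
  have [r] := MVT_segment t0 (fun s _ => dh s) (continuous_subspaceT ch).
  rewrite in_itv /= subr0 => /andP[r0 rt] E; exists r => //.
  by rewrite !ger0_norm.
have [r] := MVT_segment (ltW t0) (fun s _ => dh s) (continuous_subspaceT ch).
rewrite in_itv /= sub0r => /andP[tr r0] E; exists r.
  by rewrite !ler0_norm// ?lerN2// ltW.
by rewrite -opprB E mulrN opprK.
Qed.

(** Along exp(tU) = exp(theta Theta) exp(y Y) exp(theta Theta), the difference
    quotient is a combination of the derivatives along Theta and Y at nearby
    points. In the limit U = (Theta - Y) / 2. *)
Lemma is_derive_expU (f dT dY : SM -> R) : continuous dT -> continuous dY ->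
  (forall x, is_derive (0 : R) 1 (fun t => f (rtrans (expT t) x)) (dT x)) ->
  (forall x, is_derive (0 : R) 1 (fun t => f (rtrans (expY t) x)) (dY x)) ->
  forall x, is_derive (0 : R) 1 (fun t => f (rtrans (expU t) x)) ((dT x - dY x) / 2).
Proof.
move=> cT cY fT fY x.
have [gt [gtE gtc gt0]] := (is_derive1_caratheodory _ _ _).1 (is_derive_thetaU R).
have [gy [gyE gyc gy0]] := (is_derive1_caratheodory _ _ _).1 (is_derive_upsU R).
have t00 : thetaU 0 = 0 :> R by rewrite /thetaU mul0r atan0 mul0r.
have y00 : upsU 0 = 0 :> R.
  by rewrite /upsU mul0r expr0n addr0 sqrtr1 add0r ln1 oppr0.
have T0 : expT 0 = 1%g :> G by case: (velocity_expT R).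
have Y0 : expY 0 = 1%g :> G by case: (velocity_expY R).
pose x1 t := rtrans (expT (thetaU t)) x.
pose x2 t := rtrans (expY (upsU t)) (x1 t).
have /choice[r1 r1P] : forall t, exists r, `|r| <= `|thetaU t| /\
    f (x1 t) - f x = dT (rtrans (expT r) x) * thetaU t.
  move=> t; have [r rt] := MVT_one_parameter (@expTD R) fT x (thetaU t).
  by rewrite T0 rtrans1; exists r.
have /choice[r2 r2P] : forall t, exists r, `|r| <= `|upsU t| /\
    f (x2 t) - f (x1 t) = dY (rtrans (expY r) (x1 t)) * upsU t.
  move=> t; have [r rt] := MVT_one_parameter (@expYD R) fY (x1 t) (upsU t).
  by rewrite Y0 rtrans1; exists r.
have /choice[r3 r3P] : forall t, exists r, `|r| <= `|thetaU t| /\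
    f (rtrans (expT (thetaU t)) (x2 t)) - f (x2 t) = dT (rtrans (expT r) (x2 t)) * thetaU t.
  move=> t; have [r rt] := MVT_one_parameter (@expTD R) fT (x2 t) (thetaU t).
  by rewrite T0 rtrans1; exists r.
have lim0 (h g : R -> R) : (forall t, `|g t| <= `|h t|) -> h t @[t --> (0 : R)] --> (0 : R) ->
    g t @[t --> (0 : R)] --> (0 : R).
  move=> gh h0; apply: (@squeeze_cvgr _ _ _ _ (fun t => - `|h t|) (fun t => `|h t|)).
  - by near=> t; rewrite -ler_norml.
  - by have := cvgN (cvg_norm h0); rewrite normr0 oppr0; exact.
  - by have := cvg_norm h0; rewrite normr0; exact.
have tc : thetaU t @[t --> (0 : R)] --> (0 : R).
  have [d _] := is_derive_thetaU R.
  rewrite -[X in _ --> X]t00.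
  by move: d => /derivable1_diffP/differentiable_continuous; exact.
have yc : upsU t @[t --> (0 : R)] --> (0 : R).
  have [d _] := is_derive_upsU R.
  rewrite -[X in _ --> X]y00.
  by move: d => /derivable1_diffP/differentiable_continuous; exact.
have Tc (g : R -> R) : g t @[t --> (0 : R)] --> (0 : R) -> expT (g t) @[t --> (0 : R)] --> (1%g : G).
  move=> g0; have c1 := @cvg_curve R (@expT R) _ 1%g (velocity_expT R).
  have : (1 * expT (g t))%g @[t --> (0 : R)] --> (1%g : G) by exact: (cvg_comp _ _ g0 c1).
  by under eq_cvg do rewrite mul1g.
have Yc (g : R -> R) : g t @[t --> (0 : R)] --> (0 : R) -> expY (g t) @[t --> (0 : R)] --> (1%g : G).
  move=> g0; have c1 := @cvg_curve R (@expY R) _ 1%g (velocity_expY R).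
  have : (1 * expY (g t))%g @[t --> (0 : R)] --> (1%g : G) by exact: (cvg_comp _ _ g0 c1).
  by under eq_cvg do rewrite mul1g.
have cr1 := lim0 _ _ (fun t => (r1P t).1) tc.
have cr2 := lim0 _ _ (fun t => (r2P t).1) yc.
have cr3 := lim0 _ _ (fun t => (r3P t).1) tc.
have orb (k : R -> G) : k t @[t --> (0 : R)] --> (1%g : G) -> rtrans (k t) x @[t --> (0 : R)] --> x.
  move=> k1; have := cvg_comp _ _ k1 (@continuous_orbit _ _ x 1%g).
  by rewrite rtrans1.
have c1 : dT (rtrans (expT (r1 t)) x) @[t --> (0 : R)] --> dT x.
  exact: (cvg_comp _ _ (orb _ (Tc _ cr1)) (@cT x)).
have c2 : dY (rtrans (expY (r2 t)) (x1 t)) @[t --> (0 : R)] --> dY x.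
  have k1 : (expT (thetaU t) * expY (r2 t))%g @[t --> (0 : R)] --> (1%g : G).
    by have := cvg_SL2_mul (Tc _ tc) (Yc _ cr2); rewrite mulg1; exact.
  have := cvg_comp _ _ (orb _ k1) (@cY x).
  by under eq_cvg do rewrite /= rtransM.
have c3 : dT (rtrans (expT (r3 t)) (x2 t)) @[t --> (0 : R)] --> dT x.
  have k1 : (expT (thetaU t) * expY (upsU t) * expT (r3 t))%g @[t --> (0 : R)] --> (1%g : G).
    by have := cvg_SL2_mul (cvg_SL2_mul (Tc _ tc) (Yc _ yc)) (Tc _ cr3); rewrite !mulg1; exact.
  have := cvg_comp _ _ (orb _ k1) (@cT x).
  by under eq_cvg do rewrite /= !rtransM.
have U0 : rtrans (expU 0) x = x by rewrite expU0 rtrans1.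
apply/is_derive1_caratheodory.
pose gz (z : R) := if z == 0 then (dT x - dY x) / 2 else
  dT (rtrans (expT (r1 z)) x) * gt z + dY (rtrans (expY (r2 z)) (x1 z)) * gy z +
  dT (rtrans (expT (r3 z)) (x2 z)) * gt z.
have gz0 : gz 0 = (dT x - dY x) / 2 by rewrite /gz eqxx.
exists gz; split=> //.
  move=> z; rewrite U0 subr0 /gz; case: eqP => [->|z0]; first by rewrite U0 subrr mulr0.
  have -> : rtrans (expU z) x = rtrans (expT (thetaU z)) (x2 z).
    by rewrite expU_factor !rtransM.
  have tE := gtE z; have yE := gyE z; rewrite t00 !subr0 in tE; rewrite y00 !subr0 in yE.
  have -> : f (rtrans (expT (thetaU z)) (x2 z)) - f x =
    (f (x1 z) - f x) + (f (x2 z) - f (x1 z)) + (f (rtrans (expT (thetaU z)) (x2 z)) - f (x2 z)).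
    by ring.
  by rewrite (r1P z).2 (r2P z).2 (r3P z).2 tE yE; ring.
have gtc' : gt z @[z --> (0 : R)] --> (4^-1 : R) by rewrite -gt0; exact: gtc.
have gyc' : gy z @[z --> (0 : R)] --> (- 2^-1 : R) by rewrite -gy0; exact: gyc.
suff h : gz z @[z --> (0 : R)] --> gz 0 by exact: h.
rewrite gz0.
have -> : (dT x - dY x) / 2 = dT x * 4^-1 + dY x * - 2^-1 + dT x * 4^-1 by field.
have c : dT (rtrans (expT (r1 t)) x) * gt t + dY (rtrans (expY (r2 t)) (x1 t)) * gy t +
    dT (rtrans (expT (r3 t)) (x2 t)) * gt t @[t --> (0 : R)] -->
    dT x * 4^-1 + dY x * - 2^-1 + dT x * 4^-1.
  by have := cvgD (cvgD (cvgM c1 gtc') (cvgM c2 gyc')) (cvgM c3 gtc'); exact.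
move/cvgrPdist_lt : c => c; apply/cvgrPdist_lt => e e0; have := c e e0.
apply: filterS => z; rewrite /gz; case: eqP => [_ _|_]; last by apply.
rewrite [X in `|X|](_ : _ = 0) ?normr0//; by field.
Unshelve. all: by end_near.
Qed.

End differentiability.

(** * The horocycle flow *)

Section horocycle.
Variables (R : realType) (Gamma : groupClosed (SL2 R)).
Local Notation SM := (SM Gamma).
Variable vol : {measure set SM -> \bar R}.
Hypothesis Gamma_discrete : discrete_subgroup Gamma.
Hypothesis vol_inv : invariant_volume vol.

Lemma phiUD s t (x : SM) : phiU (s + t) x = phiU s (phiU t x).
Proof. by rewrite /phiU -rtransM expUD addrC. Qed.

Lemma phiU0 (x : SM) : phiU 0 x = x.
Proof. by rewrite /phiU expU0 rtrans1. Qed.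

Lemma phiUNK s (x : SM) : phiU (- s) (phiU s x) = x.
Proof. by rewrite -phiUD addrC subrr phiU0. Qed.

Lemma vol_phiU s (A : set SM) : measurable A -> vol (phiU s @^-1` A) = vol A.
Proof. exact: vol_trset. Qed.

Lemma continuous_expU : continuous (@expU R).
Proof.
move=> t; apply: cvg_SL2; apply: ord2E; apply: ord2E; rewrite mxE /=;
  (under eq_cvg do rewrite mxE /=); (exact: cvg_cst || exact: cvg_id).
Qed.

Lemma continuous_phiU : continuous (fun q : R * SM => phiU q.1 q.2).
Proof. exact: continuous_action continuous_expU. Qed.

(** The product sigma-algebra contains the open sets of the product, because
    both factors have a countable base. *)
Lemma measurable_phiU :
  measurable_fun setT (fun q : measurableTypeR R * SM => phiU q.1 q.2).
Proof.
have [E [bE baseE]] := countable_base Gamma_discrete vol_inv.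
apply: (measurability (@open SM)) => //.
move=> _ [U oU <-]; rewrite setTI.
pose I n : set R := let ab := odflt (0%Q, 0%Q) (unpickle n) in `]ratr ab.1, ratr ab.2[%classic.
have mI n : measurable (I n : set (measurableTypeR R)) by exact: measurable_itv.
have -> : (fun q : measurableTypeR R * SM => phiU q.1 q.2) @^-1` U =
    \bigcup_n \bigcup_k (if `[< I n `*` E k `<=` (fun q : R * SM => phiU q.1 q.2) @^-1` U >]
      then I n `*` E k else set0).
  apply/seteqP; split=> [[t x] Utx|[t x] [n _ [k _]]]; last first.
    by case: asboolP => // h /h.
  have := @continuous_phiU (t, x) U (open_nbhs_nbhs (conj oU Utx)).
  case=> [[B C] [/= tB xC] BC].
  have [a [b [tab abB]]] : exists a b : rat,
      ratr a < t < ratr b /\ (`]ratr a, ratr b[%classic `<=` B).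
    move: tB => /nbhs_ballP[e /= e0 eB].
    have t1 : t - e < t by rewrite gtrBl.
    have t2 : t < t + e by rewrite ltrDl.
    have [a] := rat_in_itvoo t1; rewrite in_itv /= => /andP[a1 a2].
    have [b] := rat_in_itvoo t2; rewrite in_itv /= => /andP[b1 b2].
    exists a, b; split; first by rewrite a2 b1.
    move=> s /=; rewrite in_itv /= => /andP[s1 s2]; apply: eB.
    by rewrite /ball /= ltr_norml; apply/andP; split; lra.
  have [k Ekx EkC] : exists2 k, E k x & E k `<=` C.
    move: xC; rewrite nbhsE => -[V [oV Vx] VC].
    by have [k Ekx EkV] := baseE _ x oV Vx; exists k => //; exact: subset_trans VC.
  exists (pickle (a, b)) => //; exists k => //.
  have IE : I (pickle (a, b)) = `]ratr a, ratr b[%classic by rewrite /I pickleK.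
  case: asboolP => [_|]; first by split=> //=; rewrite IE /= in_itv /=.
  by case=> -[s y] [/= Is Ey]; apply: (BC (s, y)); split; [apply: abB; rewrite -IE|exact: EkC].
apply: bigcupT_measurable => n; apply: bigcupT_measurable => k.
case: asboolP => _; last exact: measurable0.
by apply: measurableX => //; have [oE _ _] := bE k; exact: open_measurableSM.
Qed.

Lemma vol_sigma_finite : sigma_finite setT vol.
Proof.
have [E [bE baseE]] := countable_base Gamma_discrete vol_inv.
exists E.
  by apply/seteqP; split=> // x _; have [n Enx _] := baseE setT x openT I; exists n.
by move=> n; have [oE vE _] := bE n; split => //; exact: open_measurableSM.
Qed.

Lemma compact_sub_finite_vol (K : set SM) : compact K ->
  exists2 E, open E /\ (vol E < +oo)%E & K `<=` E.
Proof.
have [E [bE baseE]] := countable_base Gamma_discrete vol_inv.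
rewrite compact_cover => /(_ nat setT E)[].
- by move=> n _; have [] := bE n.
- by move=> x _; have [n Enx _] := baseE setT x openT I; exists n.
move=> D _ KD.
have [r Kr] : exists r : seq nat, K `<=` \big[setU/set0]_(i <- r) E i.
  by eexists; move: KD; rewrite /cover bigcup_fset; exact.
exists (\big[setU/set0]_(i <- r) E i) => //; split.
  by elim/big_ind : _ => [|A B|i _]; [exact: open0|exact: openU|have [] := bE i].
have mS (l : seq nat) : measurable (\big[setU/set0]_(i <- l) E i).
  by apply: bigsetU_measurable => i _; have [oE _ _] := bE i; exact: open_measurableSM.
elim: r {Kr} => [|n r IH]; first by rewrite big_nil measure0 ltry.
have [oE vE _] := bE n.
rewrite big_cons; apply: (le_lt_trans (measureU2 _ (open_measurableSM oE) (mS r))).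
by rewrite lte_add_pinfty.
Qed.

Definition csupp (f : SM -> R) : Prop :=
  exists2 K : set SM, compact K & forall x, ~ K x -> f x = 0.

(** The regularity of test functions on which the argument relies; bump
    functions have it, and so do the components of smooth test functions. *)
Definition C1U (f df : SM -> R) : Prop :=
  [/\ continuous f, continuous df, csupp f &
      forall x, is_derive (0 : R) 1 (fun t => f (phiU t x)) (df x)].

Lemma dominated_csupp f : continuous f -> csupp f -> dominated vol f.
Proof.
move=> cf [K cK fK]; split; first exact: continuous_measurableSM.
have [E [oE vE] KE] := compact_sub_finite_vol cK.
have cfK : compact (f @` K).
  by apply: continuous_compact => //; exact: continuous_subspaceT.
have [C [_ fC]] := compact_bounded cfK.
have C1 : C < `|C| + 1 by rewrite (le_lt_trans (ler_norm C))// ltrDl.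
exists (`|C| + 1), E; split => //; [exact: open_measurableSM|].
move=> x; have [Kx|nKx] := pselect (K x); last first.
  by rewrite fK// normr0 mulr_ge0// indicE ler0n.
rewrite indicE mem_set ?mulr1; last exact: KE.
by apply: (fC _ C1); exists x.
Qed.

Lemma compact_sweep (K : set SM) a b : compact K ->
  compact [set x | exists2 s, a <= s <= b & K (phiU s x)].
Proof.
move=> cK.
have cI : compact `[- b, - a]%classic by exact: segment_compact.
have -> : [set x | exists2 s, a <= s <= b & K (phiU s x)] =
   (fun q : R * SM => phiU q.1 q.2) @` (`[- b, - a]%classic `*` K).
  apply/seteqP; split=> [x [s /andP[as_ sb] Ks]|_ [[s x] [/= Is Kx] <-]].
    exists (- s, phiU s x); last by rewrite /= phiUNK.
    by split=> //=; rewrite in_itv /= !lerN2 sb as_.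
  exists (- s); last by rewrite phiUNK.
  by move: Is; rewrite in_itv /= => /andP[h1 h2]; rewrite lerNr h2 lerNl h1.
apply: continuous_compact; last exact: compact_setX.
by apply: continuous_subspaceT; exact: continuous_phiU.
Qed.

Lemma csupp_derivative f df : C1U f df -> csupp df.
Proof.
move=> [_ _ [K cK fK] d].
exists [set x | exists2 s, -1 <= s <= 1 & K (phiU s x)]; first exact: compact_sweep.
move=> x nx; have [_ <-] := d x.
have e : {near 0, (cst 0 : R -> R) =1 (fun t => f (phiU t x))}.
  near=> t; rewrite fK// => Kt; apply: nx; exists t => //.
  by rewrite -ler_norml; near: t; exact: (@nbhs0_le R R 1 ltr01).
by have [_ ->] := near_eq_is_derive e (is_derive_cst (0 : R) (0 : R) 1).
Unshelve. all: by end_near.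
Qed.

Lemma is_derive_orbit f df x (s : R) : C1U f df ->
  is_derive s 1 (fun s => f (phiU (- s) x)) (- df (phiU (- s) x)).
Proof.
move=> [_ _ _ d].
have d0 : is_derive (s - s) 1 (fun t => f (phiU (- t) (phiU (- s) x))) (- df (phiU (- s) x)).
  have dN : is_derive (0 : R) 1 (fun t : R => - t) (- 1) by exact: is_deriveNid.
  have d1 : is_derive (- 0 : R) 1 (fun t => f (phiU t (phiU (- s) x))) (df (phiU (- s) x)).
    by rewrite oppr0; exact: d.
  rewrite subrr; have := @is_derive1_comp _ (fun t => f (phiU t (phiU (- s) x))) (fun t : R => - t)
    0 _ _ d1 dN.
  by rewrite mulrN1.
have dsh : is_derive s 1 (fun r : R => r - s) 1.
  by have := is_deriveB (@is_derive_id R R s 1) (@is_derive_cst _ R R s s 1); rewrite subr0.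
have := @is_derive1_comp _ (fun t => f (phiU (- t) (phiU (- s) x))) (fun r : R => r - s) s _ _ d0 dsh.
rewrite mulr1; congr is_derive; apply/funext => r /=.
by rewrite -phiUD; congr (f (phiU _ _)); ring.
Qed.

(** Fundamental theorem of calculus along the orbit of [x]. *)
Lemma backward_average_derivative f df t x : 0 < t -> C1U f df ->
  backward_average (@phiU R Gamma) t df x = f x - f (phiU (- t) x).
Proof.
move=> t0 C1f; have [cf cdf _ d] := C1f.
have cs (g : SM -> R) : continuous g -> continuous (fun s : R => g (phiU (- s) x)).
  move=> cg s; apply: (@continuous_comp _ _ _ (fun s : R => phiU (- s) x) g); last exact: cg.
  apply: (@continuous_comp _ _ _ (fun s : R => expU (- s)) (fun h => rtrans h x)).
    apply: (@continuous_comp _ _ _ (fun s : R => - s) (@expU R)); last exact: continuous_expU.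
    exact: opp_continuous.
  exact: continuous_orbit.
have dN (s : R) : is_derive s 1 (fun s => - f (phiU (- s) x)) (df (phiU (- s) x)).
  by have := is_deriveN (is_derive_orbit x s C1f); rewrite opprK.
have cN : continuous (fun s : R => - f (phiU (- s) x)).
  by move=> s; have [/derivable1_diffP/differentiable_continuous] := dN s.
have key : (\int[lebesgue_measure]_(s in `[0%R, t]) (df (phiU (- s) x))%:E =
    (- f (phiU (- t) x))%:E - (- f (phiU (- 0) x))%:E)%E.
  apply: (@continuous_FTC2 _ (fun s => df (phiU (- s) x)) (fun s => - f (phiU (- s) x))) => //.
  - by apply: continuous_subspaceT => s; exact: (cs df cdf).
  - split.
    + by move=> s _; have [] := dN s.
    + by apply: cvg_at_right_filter; exact: cN.
    + by apply: cvg_at_left_filter; exact: cN.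
  - by move=> s _; rewrite derive1E; have [_ ->] := dN s.
by rewrite /backward_average /Rintegral key oppr0 phiU0 /= opprK addrC.
Qed.

End horocycle.

(** * The cohomological equation *)

(** A copy of a measure that carries the sigma-finiteness found for it. *)
Definition sigma_finite_copy d (T : measurableType d) (R : realType)
  (mu : {measure set T -> \bar R}) (_ : sigma_finite setT mu) : set T -> \bar R := mu.

HB.instance Definition _ d (T : measurableType d) (R : realType)
  (mu : {measure set T -> \bar R}) (sf : sigma_finite setT mu) :=
  Measure.copy (sigma_finite_copy sf) mu.

HB.instance Definition _ d (T : measurableType d) (R : realType)
  (mu : {measure set T -> \bar R}) (sf : sigma_finite setT mu) :=
  @Measure_isSigmaFinite.Build _ _ _ (sigma_finite_copy sf) sf.

Section cohomological.
Variables (R : realType) (Gamma : groupClosed (SL2 R)).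
Local Notation SM := (SM Gamma).
Local Notation leb := (@lebesgue_measure R).
Local Notation phiU := (@phiU R Gamma).
Variable vol : {measure set SM -> \bar R}.
Hypothesis Gamma_discrete : discrete_subgroup Gamma.
Hypothesis vol_inv : invariant_volume vol.
Implicit Types v w f df : SM -> R.

Lemma exists_sigma_finite :
  exists mu : {sigma_finite_measure set SM -> \bar R}, (mu : {measure set SM -> \bar R}) = vol.
Proof.
exists (sigma_finite_copy (vol_sigma_finite Gamma_discrete vol_inv)).
exact: eq_measure.
Qed.

Let mphi := measurable_phiU Gamma_discrete vol_inv.

Let pphi s A : measurable A -> vol (phiU s @^-1` A) = vol A.
Proof. exact: (vol_phiU vol_inv). Qed.

Let phiNK s x : phiU (- s) (phiU s x) = x.
Proof. exact: phiUNK. Qed.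

Lemma C1U_dominated f df : C1U f df -> dominated vol f /\ dominated vol df.
Proof.
move=> C1f; have [cf cdf sf _] := C1f.
by split; apply: (dominated_csupp Gamma_discrete vol_inv) => //; exact: csupp_derivative C1f.
Qed.

(** Invariance moves the increment of [v] to [f], where it is the integral of
    the derivative of [f] along the flow. *)
Lemma integral_increment v f df t : 0 < t -> sqint vol v -> C1U f df ->
  \int[vol]_x ((v (phiU t x) - v x) * f x) =
  - \int[leb]_(s in `[0, t]) pairing vol phiU v df s.
Proof.
move=> t0 sv C1f; have [domf domdf] := C1U_dominated C1f.
have domft : dominated vol (f \o phiU (- t)).
  have [cf cdf [K cK fK] _] := C1f.
  apply: (dominated_csupp Gamma_discrete vol_inv).
    by move=> x; apply: (@continuous_comp _ _ _ (phiU (- t)) f); [exact: continuous_rtrans|exact: cf].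
  exists [set x | exists2 s, - t <= s <= - t & K (phiU s x)]; first exact: compact_sweep.
  by move=> x nx; apply: fK => Kx; apply: nx; exists (- t); rewrite ?lexx.
have B : \int[vol]_x (v x * backward_average phiU t df x) =
    \int[leb]_(s in `[0, t]) pairing vol phiU v df s.
  have [mu muE] := exists_sigma_finite; move: pphi sv domdf; rewrite -muE => pmu svm dm.
  exact: integral_backward_average.
rewrite -B.
have ivf := integrable_mul_dominated sv domf.
have ivft := integrable_mul_dominated sv domft.
have sqt : sqint vol (v \o phiU t).
  have [mu muE] := exists_sigma_finite; move: pphi sv; rewrite -muE => pmu svm.
  exact: (sqint_phi mphi pmu).
have ivtf := integrable_mul_dominated sqt domf.
under [X in - X]eq_Rintegral do rewrite (backward_average_derivative _ t0 C1f) mulrBr.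
rewrite RintegralB//.
under [LHS]eq_Rintegral do rewrite mulrBl.
rewrite RintegralB// opprB; congr (_ - _).
have mv := sv.1; have mf := domf.1.
have [mu muE] := exists_sigma_finite; move: pphi; rewrite -muE => pmu.
exact: (pairing_backward mphi pmu phiNK t mv mf).
Qed.

Lemma integral_average w f t : sqint vol w -> dominated vol f ->
  \int[vol]_x (flow_average phiU t w x * f x) =
  \int[leb]_(s in `[0, t]) pairing vol phiU w f s.
Proof.
have [mu muE] := exists_sigma_finite; move: pphi; rewrite -muE => pmu sw df.
exact: integral_flow_average.
Qed.

Lemma integrable_average_mul w f t : sqint vol w -> dominated vol f ->
  vol.-integrable setT (EFin \o (fun x => flow_average phiU t w x * f x)).
Proof.
have [mu muE] := exists_sigma_finite; move: pphi; rewrite -muE => pmu sw df.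
exact: integrable_flow_average.
Qed.

Lemma integrable_pairing_horocycle w f t : sqint vol w -> dominated vol f ->
  leb.-integrable `[0, t] (EFin \o pairing vol phiU w f).
Proof.
have [mu muE] := exists_sigma_finite; move: pphi; rewrite -muE => pmu sw df.
exact: integrable_pairing.
Qed.

Lemma sqint_phiU t v : sqint vol v -> sqint vol (v \o phiU t).
Proof.
have [mu muE] := exists_sigma_finite; move: pphi; rewrite -muE => pmu svm.
exact: (sqint_phi mphi pmu).
Qed.

Lemma dominated_indic A : measurable A -> (vol A < +oo)%E -> dominated vol (\1_A).
Proof.
move=> mA vA; split; first exact: measurable_indic.
by exists 1, A; split=> // x; rewrite mul1r indicE ger0_norm.
Qed.

Lemma integrable_restrict (g : SM -> R) A : measurable A ->
  vol.-integrable setT (EFin \o (fun x => g x * \1_A x)) ->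
  vol.-integrable A (EFin \o g).
Proof.
move=> mA ig; apply/(integrable_mkcond _ mA).2; move: ig.
congr (_.-integrable _ _); apply/funext => x /=.
by rewrite patchE indicE; case: ifPn => _; rewrite ?mulr1 ?mulr0.
Qed.

(** The failure of the integrated equation at time [t]. *)
Definition defect v w t x : R := v (phiU t x) - v x - flow_average phiU t w x.

Lemma measurable_defect v w t : sqint vol v -> sqint vol w ->
  measurable_fun setT (defect v w t).
Proof.
move=> sv sw; apply: measurable_funB; last exact: (measurable_flow_average mphi t sw.1).
by apply: measurable_funB; [exact: (sqint_phiU t sv).1|exact: sv.1].
Qed.

Lemma integrable_defect_mul v w f t : sqint vol v -> sqint vol w -> dominated vol f ->
  vol.-integrable setT (EFin \o (fun x => defect v w t x * f x)).
Proof.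
move=> sv sw domf.
have i1 := integrable_mul_dominated sv domf.
have i2 := integrable_mul_dominated (sqint_phiU t sv) domf.
have i3 := integrable_average_mul t sw domf.
have := integrableB measurableT (integrableB measurableT i2 i1) i3.
by congr (_.-integrable _ _); apply/funext => x; rewrite /= /defect !mulrBl.
Qed.

Lemma integral_defect_mul v w f df t : 0 < t -> sqint vol v -> sqint vol w -> C1U f df ->
  \int[vol]_x (defect v w t x * f x) =
  - \int[leb]_(s in `[0, t]) (pairing vol phiU v df s + pairing vol phiU w f s).
Proof.
move=> t0 sv sw C1f; have [domf domdf] := C1U_dominated C1f.
have i1 := integrable_mul_dominated sv domf.
have i2 := integrable_mul_dominated (sqint_phiU t sv) domf.
have i21 : vol.-integrable setT (EFin \o (fun x => (v (phiU t x) - v x) * f x)).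
  have := integrableB measurableT i2 i1.
  by congr (_.-integrable _ _); apply/funext => x; rewrite /= mulrBl.
have i3 := integrable_average_mul t sw domf.
under [LHS]eq_Rintegral do rewrite /defect mulrBl.
rewrite RintegralB// (integral_increment t0 sv C1f) (integral_average t sw domf).
rewrite -opprD RintegralD//; exact: integrable_pairing_horocycle.
Qed.

(** The integrand in [integral_defect_mul] vanishes at each time [s]: it is the
    distributional equation tested against the translate of [f] by the flow at
    time [- s]. *)
Lemma defect_eq0 v w T : 0 < T -> sqint vol v -> sqint vol w ->
  (forall f df, bump_fun f -> C1U f df ->
     - (\int[vol]_x (v x * df x)) = \int[vol]_x (w x * f x)) ->
  {ae vol, forall x, defect v w T x = 0}.
Proof.
move=> T0 sv sw LU; apply: (bump_separation Gamma_discrete vol_inv).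
  split; first exact: measurable_defect.
  move=> A mA vA; apply: integrable_restrict => //.
  by apply: integrable_defect_mul => //; exact: dominated_indic.
move=> f bf; have [df C1f] : exists df, C1U f df.
  have [lf sf] := bf.
  have [df ldf d] := locally_polyflat_derive (velocity_expU R) lf.
  exists df; split => //; exact: continuous_locally_polyflat.
have [domf domdf] := C1U_dominated C1f.
rewrite (integral_defect_mul T0 sv sw C1f).
rewrite (_ : \int[leb]_(s in _) _ = 0) ?oppr0//.
transitivity (\int[leb]_(s in `[0, T]) (0 : R)); last first.
  by rewrite Rintegral_cst ?mul0r//; exact: measurable_itv.
apply: eq_Rintegral => s _.
have C1s : C1U (f \o phiU (- s)) (df \o phiU (- s)).
  have [cf cdf [K cK fK] d] := C1f.
  have cr : continuous (phiU (- s)) by exact: continuous_rtrans.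
  split.
  - by move=> x; apply: (@continuous_comp _ _ _ (phiU (- s)) f); [exact: cr|exact: cf].
  - by move=> x; apply: (@continuous_comp _ _ _ (phiU (- s)) df); [exact: cr|exact: cdf].
  - exists [set x | exists2 r, - s <= r <= - s & K (phiU r x)]; first exact: compact_sweep.
    by move=> x nx; apply: fK => Kx; apply: nx; exists (- s); rewrite ?lexx.
  - move=> x; have := d (phiU (- s) x); congr is_derive; apply/funext => t.
    by rewrite /= -!phiUD addrC.
have := LU _ _ (bump_fun_rtrans (expU (- s)) bf) C1s.
have [mu muE] := exists_sigma_finite; move: pphi; rewrite -muE => pmu.
rewrite -(pairing_backward mphi pmu phiNK s sv.1 domdf.1).
rewrite -(pairing_backward mphi pmu phiNK s sw.1 domf.1).
by move=> <-; rewrite subrr.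
Qed.

End cohomological.

Section converse.
Variables (R : realType) (Gamma : groupClosed (SL2 R)).
Local Notation G := (SL2 R).
Local Notation SM := (SM Gamma).
Local Notation leb := (@lebesgue_measure R).
Local Notation phiU := (@phiU R Gamma).
Variable vol : {measure set SM -> \bar R}.
Hypothesis Gamma_discrete : discrete_subgroup Gamma.
Hypothesis vol_inv : invariant_volume vol.
Implicit Types v w f df : SM -> R.

Let mphi := measurable_phiU Gamma_discrete vol_inv.

Let pphi s A : measurable A -> vol (phiU s @^-1` A) = vol A.
Proof. exact: (vol_phiU vol_inv). Qed.

(** The cocycle relation, satisfied by increments and by averages; the latter
    are additive only along the orbits where [w] is integrable. *)
Lemma defectD v w s t : 0 <= s -> 0 <= t -> sqint vol w ->
  {ae vol, forall x, defect v w (t + s) x = defect v w s x + defect v w t (phiU s x)}.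
Proof.
move=> s0 t0 sw.
have : {ae vol, forall x r, leb.-integrable `[0, r] (fun s => (w (phiU s x))%:E)}.
  have [mu muE] := exists_sigma_finite Gamma_discrete vol_inv.
  move: pphi sw; rewrite -muE => pmu sw.
  exact: ae_integrable_orbit.
apply: filterS => x ix; rewrite /defect.
have -> := @flow_averageD _ _ R phiU mphi (@phiUD R Gamma) s t w x s0 t0 sw.1 ix.
by rewrite phiUD; ring.
Qed.

(** Computing the defect at time T + t in two ways shows that the defect at time
    [t] is invariant under the flow at time [T]; the Mautner phenomenon then
    makes it invariant at all times. *)
Lemma defect_phiU v w T t c : 0 < T -> 0 <= t -> sqint vol v -> sqint vol w ->
  {ae vol, forall x, defect v w T x = 0} ->
  {ae vol, forall x, defect v w t (phiU c x) = defect v w t x}.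
Proof.
move=> T0 t0 sv sw d0.
have md := measurable_defect Gamma_discrete vol_inv t sv sw.
apply: (mautner Gamma_discrete vol_inv c T0 md).
  have [mu muE] := exists_sigma_finite Gamma_discrete vol_inv.
  have svt := sqint_phiU Gamma_discrete vol_inv t sv.
  have mA := measurable_flow_average mphi t sw.1.
  have l1 : fin_levels vol (v \o phiU t).
    by move: svt; rewrite -muE; exact: fin_levels_sqint.
  have l2 : fin_levels vol v by move: sv; rewrite -muE; exact: fin_levels_sqint.
  have l3 : fin_levels vol (flow_average phiU t w).
    move: pphi sw; rewrite -muE => pmu sw'; exact: fin_levels_flow_average.
  apply: (fin_levelsB _ mA (fin_levelsB svt.1 sv.1 l1 l2) l3).
  by apply: measurable_funB; [exact: svt.1|exact: sv.1].
have h1 := defectD v (ltW T0) t0 sw.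
have h2 := defectD v t0 (ltW T0) sw.
have h3 := ae_rtrans vol_inv (expU t) d0.
near=> x.
have e1 : defect v w (t + T) x = defect v w T x + defect v w t (phiU T x) by near: x.
have e2 : defect v w (T + t) x = defect v w t x + defect v w T (phiU t x) by near: x.
have e3 : defect v w T (phiU t x) = 0 by near: x.
have e4 : defect v w T x = 0 by near: x.
by move: e1 e2; rewrite addrC e3 e4 add0r addr0 => -> ->.
Unshelve. all: by end_near.
Qed.

(** An invariant cocycle is additive, so it vanishes at the times T/n. *)
Lemma defect_div_eq0 v w T n : 0 < T -> sqint vol v -> sqint vol w ->
  {ae vol, forall x, defect v w T x = 0} ->
  {ae vol, forall x, defect v w (T / n.+1%:R) x = 0}.
Proof.
move=> T0 sv sw d0; set t := T / n.+1%:R.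
have t0 : 0 <= t by rewrite divr_ge0// ltW.
have inv k := defect_phiU (k%:R * t) T0 t0 sv sw d0.
have h k : {ae vol, forall x, defect v w (k.+1%:R * t) x = k.+1%:R * defect v w t x}.
  elim: k => [|k IH]; first by apply/aeW => x; rewrite !mul1r.
  have := defectD v (mulr_ge0 (ler0n R k.+1) t0) t0 sw.
  move=> D; have I := inv k.+1.
  near=> x.
  have e1 : defect v w (k.+1%:R * t) x = k.+1%:R * defect v w t x by near: x.
  have e2 : defect v w t (phiU (k.+1%:R * t) x) = defect v w t x by near: x.
  have -> : k.+2%:R * t = t + k.+1%:R * t by rewrite -nat1r mulrDl mul1r.
  have -> : defect v w (t + k.+1%:R * t) x =
    defect v w (k.+1%:R * t) x + defect v w t (phiU (k.+1%:R * t) x) by near: x.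
  by rewrite e1 e2 -[k.+2%:R]nat1r mulrDl mul1r addrC.
have hn := h n.
near=> x.
have e1 : defect v w (n.+1%:R * t) x = n.+1%:R * defect v w t x by near: x.
have e2 : defect v w T x = 0 by near: x.
move: e1; rewrite {1}/t mulrC divfK ?pnatr_eq0// e2 => /esym/eqP.
by rewrite mulf_eq0 pnatr_eq0 => /eqP.
Unshelve. all: by end_near.
Qed.

(** Moving the flow to [f] makes dominated convergence applicable: for times in
    [0, T] the translates of [f] live in a common set of finite volume. *)
Lemma cvg_pairing w f T (u : nat -> R) : sqint vol w -> continuous f -> csupp f ->
  (forall n, 0 <= u n <= T) -> u n @[n --> \oo] --> (0 : R) ->
  pairing vol phiU w f (u n) @[n --> \oo] --> pairing vol phiU w f 0.
Proof.
move=> sw cf sf uT u0; have [K cK fK] := sf.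
have domf := dominated_csupp Gamma_discrete vol_inv cf sf.
have [mf [C [E' [mE' vE' C0 fC]]]] := domf.
have fC' x : `|f x| <= C by rewrite (le_trans (fC x))// ler_piMr// indicE lern1 leq_b1.
have [E [oE vE] KE] := compact_sub_finite_vol Gamma_discrete vol_inv (compact_sweep (a := - T) (b := 0) cK).
have mE := open_measurableSM oE.
have fE s x : 0 <= s <= T -> `|f (phiU (- s) x)| <= C * \1_E x.
  move=> /andP[s0 sT]; have [Kx|nKx] := pselect (K (phiU (- s) x)); last first.
    by rewrite fK// normr0 mulr_ge0// indicE ler0n.
  rewrite indicE mem_set ?mulr1//; apply: KE; exists (- s) => //.
  by rewrite lerN2 sT oppr_le0.
have pE s : pairing vol phiU w f s = \int[vol]_x (w x * f (phiU (- s) x)).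
  have [mu muE] := exists_sigma_finite Gamma_discrete vol_inv.
  move: pphi; rewrite -muE => pmu.
  exact: (pairing_backward mphi pmu (@phiUNK R Gamma) s sw.1 mf).
under eq_cvg do rewrite pE.
rewrite pE.
have mfs s : measurable_fun setT (fun x => f (phiU (- s) x)).
  exact: (measurableT_comp mf (measurable_rtrans _)).
have domE : dominated vol (fun x => C * \1_E x).
  split; first by apply: measurable_funM => //; exact: measurable_indic.
  by exists C, E; split => // x; rewrite ger0_norm// mulr_ge0// indicE.
have iM := integrable_mul_dominated sw domE.
have domfs s : 0 <= s <= T -> dominated vol (fun x => f (phiU (- s) x)).
  by move=> sT; split; [exact: mfs|exists C, E; split => // x; exact: fE].
have ifs s : 0 <= s <= T -> vol.-integrable setT (EFin \o (fun x => w x * f (phiU (- s) x))).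
  by move=> sT; exact: integrable_mul_dominated sw (domfs s sT).
have T0 : (0 : R) <= 0 <= T.
  by have /andP[h1 h2] := uT 0%N; rewrite lexx (le_trans h1 h2).
have [|||||_ _ c] := @dominated_convergence _ _ _ vol setT measurableT
  (fun n x => (w x * f (phiU (- u n) x))%:E) (fun x => (w x * f (phiU (- 0) x))%:E)
  (fun x => `|(w x * (C * \1_E x))%:E|%E).
- by move=> n; case/integrableP : (ifs _ (uT n)).
- by case/integrableP : (ifs _ T0).
- apply/aeW => x _; apply: cvg_EFin; first by near=> n.
  have cx : f (phiU (- u n) x) @[n --> \oo] --> f (phiU (- 0) x).
    have c1 : phiU (- u n) x @[n --> \oo] --> phiU (- 0) x.
      have cU : expU (- u n) @[n --> \oo] --> (expU (- 0) : G).
        have uN : (- u n) @[n --> \oo] --> (- 0 : R) by exact: cvgN.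
        exact: (cvg_comp (fun n => - u n) (@expU R) uN (@continuous_expU R (- 0))).
      exact: (cvg_comp _ _ cU (@continuous_orbit R Gamma x _)).
    exact: (cvg_comp _ _ c1 (@cf _)).
  by have := cvgM (@cvg_cst _ (w x) _ \oo _) cx; exact.
- exact: integrable_abse.
- apply/aeW => x n _ /=; rewrite lee_fin !normrM ler_wpM2l//.
  rewrite (le_trans (fE _ _ (uT n)))// -normrM; exact: ler_norm.
apply: fine_cvg; rewrite fineK; last exact: integrable_fin_num (ifs _ T0).
exact: c.
Unshelve. all: by end_near.
Qed.

(** The function J below is the integrand in [integral_defect_mul]; as the
    defect vanishes at the times T/n, the integrals of J over [0, T/n] vanish,
    and J, being continuous at 0, vanishes there. *)
Lemma LU_of_defect_eq0 v w T f df : 0 < T -> sqint vol v -> sqint vol w ->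
  {ae vol, forall x, defect v w T x = 0} -> C1U f df ->
  - (\int[vol]_x (v x * df x)) = \int[vol]_x (w x * f x).
Proof.
move=> T0 sv sw d0 C1f; have [cf cdf sf _] := C1f.
have sdf := csupp_derivative C1f.
have [domf domdf] := C1U_dominated Gamma_discrete vol_inv C1f.
pose J s := pairing vol phiU v df s + pairing vol phiU w f s.
have J0 n : \int[leb]_(s in `[0, T / n.+1%:R]) J s = 0.
  have tn0 : 0 < T / n.+1%:R by rewrite divr_gt0.
  have := integral_defect_mul Gamma_discrete vol_inv tn0 sv sw C1f.
  have dn := defect_div_eq0 n T0 sv sw d0.
  have -> : \int[vol]_x (defect v w (T / n.+1%:R) x * f x) = 0.
    rewrite /Rintegral (ae_eq_integral (cst 0%E)) ?integral0//.
    - by case/integrableP : (integrable_defect_mul Gamma_discrete vol_inv (T / n.+1%:R) sv sw domf).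
    - by apply: filterS dn => x -> _; rewrite mul0r.
  by move=> /esym/eqP; rewrite oppr_eq0 => /eqP.
have iJ t : leb.-integrable `[0, t] (EFin \o J).
  have h1 := integrable_pairing_horocycle Gamma_discrete vol_inv t sv domdf.
  have h2 := integrable_pairing_horocycle Gamma_discrete vol_inv t sw domf.
  by apply: (integrableD _ h1 h2); exact: measurable_itv.
have cJ (u : nat -> R) : (forall n, 0 <= u n <= T) -> u n @[n --> \oo] --> (0 : R) ->
    J (u n) @[n --> \oo] --> J 0.
  move=> uT u0; have := cvgD (cvg_pairing sv cdf sdf uT u0) (cvg_pairing sw cf sf uT u0).
  exact.
suff JE : J 0 = 0.
  move: JE; rewrite /J /pairing => /eqP; rewrite addrC addr_eq0 => /eqP.
  under eq_Rintegral do rewrite phiU0.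
  under [in X in _ = X -> _]eq_Rintegral do rewrite phiU0.
  by move=> ->.
apply: contrapT => /eqP J00.
have sq0 : 0 < J 0 ^+ 2 / 2 by rewrite divr_gt0// exprn_even_gt0.
have tn0 n : 0 < T / n.+1%:R by rewrite divr_gt0.
have [n nJ] : exists n, forall s, 0 <= s <= T / n.+1%:R -> J 0 ^+ 2 / 2 <= J 0 * J s.
  apply: contrapT => /forallNP h.
  have /choice[u uP] n : exists s, 0 <= s <= T / n.+1%:R /\ J 0 * J s < J 0 ^+ 2 / 2.
    have /existsNP[s /not_implyP[sT /negP]] := h n.
    by rewrite -ltNge => Js; exists s.
  have u0 : u n @[n --> \oo] --> (0 : R).
    apply: (@squeeze_cvgr _ _ _ _ (fun=> 0) (fun n => T / n.+1%:R)).
    - by near=> n; have [] := uP n.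
    - exact: cvg_cst.
    - by have := cvgM (@cvg_cst _ T _ \oo _) (@cvg_harmonic R); rewrite mulr0; exact.
  have uT n : 0 <= u n <= T.
    have [/andP[-> un] _] := uP n; apply: (le_trans un).
    by rewrite ler_pdivrMr// ler_peMr// ?ler1n// ltW.
  have c : J 0 * J (u n) @[n --> \oo] --> J 0 * J 0.
    by apply: cvgM; [exact: cvg_cst|exact: cJ].
  have lt2 : J 0 ^+ 2 / 2 < J 0 * J 0 by rewrite -expr2; lra.
  have [N _ /(_ N (leqnn N)) /= gtN] := cvgr_gt _ c _ lt2.
  by have [_ /lt_trans /(_ gtN)] := uP N; rewrite ltxx.
have lebT : leb `[0, T / n.+1%:R] = (T / n.+1%:R)%:E.
  by rewrite lebesgue_measure_itv /= lte_fin tn0 -EFinD subr0.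
have mI : measurable (`[0, T / n.+1%:R] : set (measurableTypeR R)).
  exact: measurable_itv.
have : J 0 ^+ 2 / 2 * (T / n.+1%:R) <= J 0 * 0.
  have <- : J 0 * \int[leb]_(s in `[0, T / n.+1%:R]) J s = J 0 * 0 by rewrite J0.
  rewrite -RintegralZl//.
  have -> : J 0 ^+ 2 / 2 * (T / n.+1%:R) =
      \int[leb]_(s in `[0, T / n.+1%:R]) (J 0 ^+ 2 / 2).
    by rewrite Rintegral_cst// [X in fine X]lebT.
  apply: (@le_Rintegral _ _ _ leb _ _ _ mI).
  - apply/integrableP; split; first exact: measurable_cst.
    by rewrite integral_cst//= [X in (_ * X)%E]lebT -EFinM ltry.
  - exact: (integrableZl mI (J 0) (iJ (T / n.+1%:R))).
  - by move=> s /=; rewrite in_itv /= => sT; exact: nJ.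
by rewrite mulr0 leNgt mulr_gt0.
Unshelve. all: by end_near.
Qed.

End converse.

(** * Real and imaginary parts *)

Section components.
Variables (R : realType) (Gamma : groupClosed (SL2 R)).
Local Notation SM := (SM Gamma).
Local Notation phiU := (@phiU R Gamma).
Local Notation Re := (@complex.Re R).
Local Notation Im := (@complex.Im R).
Variable vol : {measure set SM -> \bar R}.
Hypothesis Gamma_discrete : discrete_subgroup Gamma.
Hypothesis vol_inv : invariant_volume vol.
Implicit Types u f phi : SM -> R[i].

Lemma ReM (z w : R[i]) : Re (z * w) = Re z * Re w - Im z * Im w.
Proof. by case: z => a b; case: w. Qed.

Lemma ImM (z w : R[i]) : Im (z * w) = Re z * Im w + Im z * Re w.
Proof. by case: z => a b; case: w. Qed.

(** The frame consists of X, Y and Theta; differentiability along U comes from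
    [is_derive_expU]. *)
Lemma test_SM_C1U phi : test_SM phi ->
  C1U (fun x => Re (phi x)) (fun x => Re (dcurve (flow (@expU R)) phi x)) /\
  C1U (fun x => Im (phi x)) (fun x => Im (dcurve (flow (@expU R)) phi x)).
Proof.
move=> [[K cK phiK] sm].
have [cphi dphi] := sm 1%N.
have [dY [cY _]] := dphi (Ordinal (isT : (1 < 3)%N)).
have [dT [cT _]] := dphi (Ordinal (isT : (2 < 3)%N)).
have part (p : R[i] -> R) : p 0 = 0 ->
    (forall x, {for x, continuous (fun y => p (phi y))}) ->
    (forall c x, p (dcurve (flow c) phi x) =
       derive1 (fun t => p (phi (flow c x t))) 0) ->
    (forall x, derivable (fun t => p (phi (flow (@expY R) x t))) 0 1) ->
    (forall x, derivable (fun t => p (phi (flow (@expT R) x t))) 0 1) ->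
    (forall x, {for x, continuous (fun y => p (dcurve (flow (@expY R)) phi y))}) ->
    (forall x, {for x, continuous (fun y => p (dcurve (flow (@expT R)) phi y))}) ->
    C1U (fun x => p (phi x)) (fun x => p (dcurve (flow (@expU R)) phi x)).
  move=> p0 cp pd dYp dTp cYp cTp.
  have isd c : (forall x, derivable (fun t => p (phi (flow c x t))) 0 1) ->
      forall x, is_derive (0 : R) 1 (fun t => p (phi (rtrans (c t) x)))
        (p (dcurve (flow c) phi x)).
    by move=> h x; rewrite pd derive1E; exact: derivableP (h x).
  have dU := is_derive_expU (f := fun x => p (phi x)) cTp cYp (isd _ dTp) (isd _ dYp).
  have E : (fun x => p (dcurve (flow (@expU R)) phi x)) =
    (fun x => (p (dcurve (flow (@expT R)) phi x) - p (dcurve (flow (@expY R)) phi x)) / 2).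
    by apply/funext => x; rewrite pd derive1E; have [_ ->] := dU x.
  rewrite E; split => //.
  - by move=> x; exact: (cvgM (cvgB (cTp x) (cYp x)) (cvg_cst _)).
  - by exists K => // x /phiK ->.
split; apply: part => //= x.
- exact: (cphi x I).1.
- exact: (dY x I).1.
- exact: (dT x I).1.
- exact: (cY x I).1.
- exact: (cT x I).1.
- exact: (cphi x I).2.
- exact: (dY x I).2.
- exact: (dT x I).2.
- exact: (cY x I).2.
- exact: (cT x I).2.
Qed.

Lemma L2_sqint u : L2 vol u ->
  sqint vol (fun x => Re (u x)) /\ sqint vol (fun x => Im (u x)).
Proof.
move=> [[mr mi] u2]; split; (split=> //; apply: le_lt_trans u2; apply: ge0_le_integral => //).
- by move=> x _; rewrite lee_fin sqr_ge0.
- by apply/measurable_EFinP; exact: measurable_funX.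
- by apply/measurable_EFinP; apply: measurable_funD; exact: measurable_funX.
- by move=> x _; rewrite lee_fin lerDl sqr_ge0.
- by move=> x _; rewrite lee_fin sqr_ge0.
- by apply/measurable_EFinP; exact: measurable_funX.
- by apply/measurable_EFinP; apply: measurable_funD; exact: measurable_funX.
- by move=> x _; rewrite lee_fin lerDr sqr_ge0.
Qed.

Lemma ae_averageP u f T :
  {ae vol, forall x, u (phiU T x) - u x = average T f x} <->
  {ae vol, forall x, defect (fun x => Re (u x)) (fun x => Re (f x)) T x = 0} /\
  {ae vol, forall x, defect (fun x => Im (u x)) (fun x => Im (f x)) T x = 0}.
Proof.
split=> [h|[hr hi]].
  split; apply: filterS h => x; rewrite /defect /average /cintegral;
  case: (u (phiU T x)) => a b; case: (u x) => a' b' [/= e1 e2]; apply/eqP;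
  by rewrite subr_eq0 ?e1 ?e2.
apply: filterS2 hr hi => x; rewrite /defect /average /cintegral.
case: (u (phiU T x)) => a b; case: (u x) => a' b' /=.
by move=> /eqP; rewrite subr_eq0 => /eqP e1 /eqP; rewrite subr_eq0 => /eqP e2; simpc; rewrite e1 e2.
Qed.

(** Tested against a real function, the equation splits into its components. *)
Lemma LU_eq_components u f (g dg : SM -> R) : LU_eq vol u f ->
  bump_fun g -> C1U g dg ->
  - (\int[vol]_x (Re (u x) * dg x)) = \int[vol]_x (Re (f x) * g x) /\
  - (\int[vol]_x (Im (u x) * dg x)) = \int[vol]_x (Im (f x) * g x).
Proof.
move=> LU bg [_ _ _ d]; have := LU _ (bump_fun_test bg).
rewrite (dcurve_real d) /cintegral => -[/= e1 e2]; split.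
  move: e1; under eq_Rintegral do rewrite ReM /= mulr0 subr0.
  by under [in X in _ = X -> _]eq_Rintegral do rewrite ReM /= mulr0 subr0.
move: e2; under eq_Rintegral do rewrite ImM /= mulr0 add0r.
by under [in X in _ = X -> _]eq_Rintegral do rewrite ImM /= mulr0 add0r.
Qed.

Lemma LU_eq_of_components u f : L2 vol u -> L2 vol f ->
  (forall g dg, C1U g dg ->
    - (\int[vol]_x (Re (u x) * dg x)) = \int[vol]_x (Re (f x) * g x) /\
    - (\int[vol]_x (Im (u x) * dg x)) = \int[vol]_x (Im (f x) * g x)) ->
  LU_eq vol u f.
Proof.
move=> L2u L2f eqC phi tphi.
have [sur sui] := L2_sqint L2u; have [sfr sfi] := L2_sqint L2f.
have [C1r C1i] := test_SM_C1U tphi.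
have [domr domdr] := C1U_dominated Gamma_discrete vol_inv C1r.
have [domi domdi] := C1U_dominated Gamma_discrete vol_inv C1i.
have [rr ir] := eqC _ _ C1r; have [ri ii] := eqC _ _ C1i.
rewrite /cintegral; apply/eqP; rewrite eq_complex /=; apply/andP; split; apply/eqP.
  under eq_Rintegral do rewrite ReM.
  under [RHS]eq_Rintegral do rewrite ReM.
  rewrite !RintegralB//; try exact: integrable_mul_dominated.
  by rewrite opprB -rr -ii opprK addrC.
under eq_Rintegral do rewrite ImM.
under [RHS]eq_Rintegral do rewrite ImM.
rewrite !RintegralD//; try exact: integrable_mul_dominated.
by rewrite opprD -ri -ir.
Qed.

End components.

Local Close Scope complex_scope.
Local Close Scope quotient_scope.

Theorem proposition1p4 (R : realType) (Gamma : groupClosed (SL2 R))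
    (Gamma_discrete : discrete_subgroup Gamma)
    (Gamma_free : acts_freely Gamma)
    (area : {measure set (M Gamma) -> \bar R})
    (area_hyp : hyperbolic_area area)
    (M_cpt_or_finite : compact [set: M Gamma] \/
       (~ compact [set: M Gamma] /\ (area [set: M Gamma] < +oo)%E))
    (vol : {measure set (SM Gamma) -> \bar R})
    (vol_inv : invariant_volume vol)
    (gap : spectral_gap area)
    (T s : R) (T_gt0 : 0 < T) (s_gt1 : 1 < s)
    (f : SM Gamma -> R[i]) (f_W : W vol s f)
    (u : SM Gamma -> R[i]) (u_L2 : L2 vol u) :
  LU_eq vol u f <->
  {ae vol, forall x, u (phiU T x) - u x = average T f x}.
Proof.
have [f_L2 _] := f_W.
have [sur sui] := L2_sqint u_L2; have [sfr sfi] := L2_sqint f_L2.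
split=> [LU|/ae_averageP[dr di]].
  apply/ae_averageP; split; apply: (defect_eq0 Gamma_discrete vol_inv) => // g dg bg C1g.
    exact: (LU_eq_components LU bg C1g).1.
  exact: (LU_eq_components LU bg C1g).2.
apply: (LU_eq_of_components Gamma_discrete vol_inv) => // g dg C1g; split.
  exact: (LU_of_defect_eq0 Gamma_discrete vol_inv T_gt0 sur sfr dr C1g).
exact: (LU_of_defect_eq0 Gamma_discrete vol_inv T_gt0 sui sfi di C1g).
Qed.
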